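(* For $p\in(0,1]$ let $(\varphi_1,\varphi_2)$ be the solution, as functions of $y\in\mathbb{R}$, of the initial value problem $$\varphi_1''=(1-2\varphi_1^2-8\varphi_2^2)\varphi_1,\qquad \varphi_2''=(4-2\varphi_1^2-8\varphi_2^2)\varphi_2,$$ $$\varphi_1(0)=0,\quad \varphi_2(0)=p,\quad \varphi_1'(0)=2p,\quad \varphi_2'(0)=0.$$ Let (Z) denote the condition: $\varphi_1$ has exactly two zeros in a period and $\varphi_2$ is positive everywhere. Then: 1. For all $p\in(0,1]$ with $p\neq\sqrt3/2$, $(\varphi_1,\varphi_2)$ is periodic or quasi-periodic. 2. For $p=\frac{\sqrt3}{2}$, $(\varphi_1,\varphi_2)$ tends to the origin $(0,0)$ as $y\to\infty$ (hence, it is not periodic). 3. For all $p\in(\sqrt3/2,1]$, $\varphi_2$ vanishes at least once in each period (of $\varphi_2$). Hence, condition (Z) is not satisfied. 4. There exists a countable dense subset $\mathcal{P}\subset(0,\sqrt3/2)$, with $\sqrt{3/8}\in\mathcal{P}$, such that the solution $(\varphi_1,\varphi_2)$ corresponding to $p\in(0,\sqrt3/2)$ is periodic if and only if $p\in\mathcal{P}$. 5. For $p=\sqrt{3/8}$, $(\varphi_1,\varphi_2)$ satisfies (Z) and, for any $p\in\mathcal{P}$ with $p\neq\sqrt{3/8}$, $\varphi_1$ admits at least 6 zeros in a period.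
   Context: A solution $(\varphi_1,\varphi_2)$ is called periodic if the pair is periodic in $y$; ''in a period'' (in condition (Z) and in item 5) means in a half-open interval $[y_0,y_0+T)$ where $T>0$ is the least common period of the pair $(\varphi_1,\varphi_2)$. Quasi-periodic (with two frequencies) has its usual meaning: the solution has the form $y\mapsto F(\omega_1y,\omega_2y)$ with $F$ continuous on the two-dimensional torus $\mathbb{R}^2/\mathbb{Z}^2$ and $\omega_1,\omega_2\in\mathbb{R}$. *)

(* Defs.v *)
From Stdlib Require Import Reals List.
From Coquelicot Require Import Coquelicot.
Open Scope R_scope.

(* [Derive] is total, so differentiability of each function and of each first
   derivative is required explicitly. *)
Record ivp_solution (p : R) (phi1 phi2 : R -> R) : Prop := {
  ivp_ex_derive1 : forall y, ex_derive phi1 y;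
  ivp_ex_derive2 : forall y, ex_derive phi2 y;
  ivp_ode1 : forall y,
    is_derive (Derive phi1) y
      ((1 - 2 * phi1 y ^ 2 - 8 * phi2 y ^ 2) * phi1 y);
  ivp_ode2 : forall y,
    is_derive (Derive phi2) y
      ((4 - 2 * phi1 y ^ 2 - 8 * phi2 y ^ 2) * phi2 y);
  ivp_phi1_0 : phi1 0 = 0;
  ivp_phi2_0 : phi2 0 = p;
  ivp_dphi1_0 : Derive phi1 0 = 2 * p;
  ivp_dphi2_0 : Derive phi2 0 = 0
}.

Definition is_period {A : Type} (f : R -> A) (T : R) : Prop :=
  0 < T /\ forall y, f (y + T) = f y.

Definition is_least_period {A : Type} (f : R -> A) (T : R) : Prop :=
  is_period f T /\ forall T', is_period f T' -> T <= T'.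

Definition pair_fun (phi1 phi2 : R -> R) (y : R) : R * R := (phi1 y, phi2 y).

Definition periodic (phi1 phi2 : R -> R) : Prop :=
  exists T, is_period (pair_fun phi1 phi2) T.

(* A continuous function on the torus R^2/Z^2 is represented by a continuous
   function on R^2 that is 1-periodic in each variable. *)
Definition quasi_periodic (phi1 phi2 : R -> R) : Prop :=
  exists (F : R * R -> R * R) (omega1 omega2 : R),
    (forall z, continuous F z) /\
    (forall s t, F (s + 1, t) = F (s, t)) /\
    (forall s t, F (s, t + 1) = F (s, t)) /\
    (forall y, pair_fun phi1 phi2 y = F (omega1 * y, omega2 * y)).

Definition zero_in_interval (f : R -> R) (y0 T y : R) : Prop :=
  y0 <= y < y0 + T /\ f y = 0.

Definition exactly_zeros (n : nat) (f : R -> R) (y0 T : R) : Prop :=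
  exists l : list R,
    NoDup l /\ length l = n /\
    forall y, In y l <-> zero_in_interval f y0 T y.

Definition at_least_zeros (n : nat) (f : R -> R) (y0 T : R) : Prop :=
  exists l : list R,
    NoDup l /\ length l = n /\
    forall y, In y l -> zero_in_interval f y0 T y.

Definition condition_Z (phi1 phi2 : R -> R) : Prop :=
  (exists T, is_least_period (pair_fun phi1 phi2) T /\
     forall y0, exactly_zeros 2 phi1 y0 T) /\
  (forall y, 0 < phi2 y).

Definition countable (P : R -> Prop) : Prop :=
  exists e : nat -> R, forall x, P x -> exists n, e n = x.

Definition dense_subset (a b : R) (P : R -> Prop) : Prop :=
  (forall x, P x -> a < x < b) /\
  (forall x, a < x < b ->
     forall eps, 0 < eps -> exists q, P q /\ Rabs (q - x) < eps).

(* Main.v *)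
Require Import Defs.
From Stdlib Require Import ZArith Reals List Lra Lia Psatz Classical ClassicalEpsilon.
From Stdlib Require FinFun Cantor.
From Coquelicot Require Import Coquelicot.
Open Scope R_scope.

(** Why the statement holds.

    Put [b = 4 * p ^ 2]. The system is a Garnier system, which separates in
    elliptic coordinates [mu1 <= 1 <= mu2 <= 4] given by
    [3 * phi1 ^ 2 = (1 - mu1) * (mu2 - 1)] and
    [12 * phi2 ^ 2 = (4 - mu1) * (4 - mu2)]: in the time [t] with
    [dt = dy / (mu2 - mu1)], both roots satisfy [mu' ^ 2 = 4 * P mu], and for the
    given initial values the quintic splits,
    [P x = x * (x - 1) * (x - 4) * (x - (4 - b)) * (x - (1 + b))].
    Each root is a function of an angle that moves autonomously in the time [t], so
    the solution is explicit up to quadratures. [low_solution] ([b < 3]) and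
    [high_solution] ([b > 3]) verify this, using uniqueness for the initial value
    problem ([first_order_unique]).

    In coordinates in which the flow on the torus of the two angles is linear the
    solution is quasi-periodic ([separated_quasi_periodic]); the change of
    coordinates is invertible because [mu1 < mu2] with a gap. At [b = 3] the roots
    1 and 4 of [P] become double and the solution is a pair of hyperbolic functions
    that decay ([homoclinic_case]). For [b > 3] the root [mu2] sweeps all of
    [1, 4], and [phi2] vanishes whenever [mu2 = 4].

    For [b < 3] the function [phi2] is positive and [phi1] vanishes at each
    half-turn of the first angle. The solution is periodic exactly when [n] full
    turns of the first angle take as long as [m] half-turns of the second, or when
    [b = 3 / 2], that is [p = sqrt (3 / 8)], where [mu2] is constant
    ([period_admissible], [admissible_period]). A full turn of the first angle
    takes the time [4 * J k] and a half-turn of the second the time [2 * W b],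
    where [k = b * (3 - b)].

    The key identity is [W b = J k + K k] ([period_identity]), in which [K] is the
    integral of [dx / sqrt P] beyond 4, up to a factor. It expresses the ratio of
    the two times by [J] and [K], which are integrals of the same kernel
    [/ sqrt (x + k)] against positive densities that do not depend on [k]. Two
    consequences follow. First, [K k < J k < 3 * K k] ([K_lt_J], [J_lt_3K]), so the
    ratio lies strictly between 1 and 3 / 2, its denominator [n] is at least 3, and
    [phi1] has [2 * n >= 6] zeros in a period. Second, an equation
    [A * J k = B * K k] has at most two solutions [k] ([level_set_at_most_two]):
    the density of [A * J - B * K] changes sign at most twice and the kernels form
    a Chebyshev system. Hence each rational value of the ratio belongs to finitely
    many [p], which gives countability, and the ratio, being continuous and nowhere
    locally constant, takes rational values in every interval, which gives
    density. *)

(** * Integrals of continuous functions *)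

(** Integrals are typed in a normed module whose carrier is only convertible to
    R; the algebraic tactics need the equation at type R. *)
Ltac eqR := match goal with |- @eq _ ?x ?y => change (@eq R x y) end.

Lemma ex_RInt_cont (f : R -> R) (a b : R) :
  (forall x, continuous f x) -> ex_RInt f a b.
Proof. intros Hf. apply (ex_RInt_continuous (V := R_CompleteNormedModule)). intros; apply Hf. Qed.

Lemma RInt_le_const (f : R -> R) (a b M : R) :
  a <= b -> (forall x, continuous f x) ->
  (forall x, a <= x <= b -> Rabs (f x) <= M) ->
  Rabs (RInt f a b) <= M * (b - a).
Proof.
  intros Hab Hf HM.
  rewrite Rmult_comm.
  apply abs_RInt_le_const; auto using ex_RInt_cont.
Qed.

Lemma RInt_lt_cont (f g : R -> R) (a b : R) :
  a < b -> (forall x, continuous f x) -> (forall x, continuous g x) ->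
  (forall x, a < x < b -> f x < g x) -> RInt f a b < RInt g a b.
Proof.
  intros Hab Hf Hg H. apply RInt_lt; auto.
Qed.

Lemma RInt_le_cont (f g : R -> R) (a b : R) :
  a <= b -> (forall x, continuous f x) -> (forall x, continuous g x) ->
  (forall x, a < x < b -> f x <= g x) -> RInt f a b <= RInt g a b.
Proof.
  intros Hab Hf Hg H. apply RInt_le; auto using ex_RInt_cont.
Qed.

Lemma RInt_pos_cont (f : R -> R) (a b : R) :
  a < b -> (forall x, continuous f x) ->
  (forall x, a < x < b -> 0 < f x) -> 0 < RInt f a b.
Proof.
  intros Hab Hf H.
  replace 0 with (RInt (fun _ : R => 0) a b).
  - apply RInt_lt_cont; auto. intros; apply continuous_const.
  - rewrite RInt_const. unfold scal; simpl; unfold mult; simpl; ring.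
Qed.

Lemma RInt_lin (f g : R -> R) (a b u v : R) :
  (forall x, continuous f x) -> (forall x, continuous g x) ->
  RInt (fun x => u * f x + v * g x) a b = u * RInt f a b + v * RInt g a b.
Proof.
  intros Hf Hg.
  apply is_RInt_unique.
  apply (is_RInt_plus (V := R_NormedModule)
           (fun x => u * f x) (fun x => v * g x)).
  - apply (is_RInt_scal (V := R_NormedModule) f). apply (RInt_correct (V := R_CompleteNormedModule)); auto using ex_RInt_cont.
  - apply (is_RInt_scal (V := R_NormedModule) g). apply (RInt_correct (V := R_CompleteNormedModule)); auto using ex_RInt_cont.
Qed.

Lemma RInt_split (f : R -> R) (a b c : R) :
  (forall x, continuous f x) -> RInt f a c = RInt f a b + RInt f b c.
Proof.
  intros Hf. symmetry.
  apply (RInt_Chasles (V := R_CompleteNormedModule) f); apply ex_RInt_cont; auto.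
Qed.

Lemma is_derive_RInt_cont (f : R -> R) (a x : R) :
  (forall t, continuous f t) -> is_derive (fun t => RInt f a t) x (f x).
Proof.
  intros Hf. apply (is_derive_RInt (V := R_NormedModule) f (fun t => RInt f a t) a x).
  - exists (mkposreal 1 Rlt_0_1). intros y _. apply (RInt_correct (V := R_CompleteNormedModule)).
    apply ex_RInt_cont; auto.
  - apply Hf.
Qed.

Lemma RInt_FTC (F f : R -> R) (a b : R) :
  (forall x, is_derive F x (f x)) -> (forall x, continuous f x) ->
  RInt f a b = F b - F a.
Proof.
  intros HF Hf. apply is_RInt_unique.
  apply (is_RInt_derive (V := R_CompleteNormedModule) F f); intros; auto.
Qed.

Lemma continuity_2d_pt_fst (f : R -> R -> R) (x y : R) :
  continuity_2d_pt f x y -> continuous (fun t => f t y) x.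
Proof.
  intros H. apply continuity_2d_pt_filterlim in H.
  apply (filterlim_comp _ _ _ (fun t => (t, y)) (fun z => f (fst z) (snd z)) (locally x) (locally (x, y)) (locally (f x y)));
    [ | exact H].
  intros P [e He]. exists e. intros t Ht. apply He. split; [exact Ht | apply ball_center].
Qed.

Lemma continuity_2d_pt_snd (f : R -> R -> R) (x y : R) :
  continuity_2d_pt f x y -> continuous (fun t => f x t) y.
Proof.
  intros H. apply continuity_2d_pt_filterlim in H.
  apply (filterlim_comp _ _ _ (fun t => (x, t)) (fun z => f (fst z) (snd z)) (locally y) (locally (x, y)) (locally (f x y)));
    [ | exact H].
  intros P [e He]. exists e. intros t Ht. apply He. split; [apply ball_center | exact Ht].
Qed.

Lemma continuity_2d_pt_swap (f : R -> R -> R) (x y : R) :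
  continuity_2d_pt f x y -> continuity_2d_pt (fun u v => f v u) y x.
Proof.
  intros H eps. destruct (H eps) as [d Hd]. exists d. intros u v Hu Hv. apply Hd; auto.
Qed.

Lemma continuous_RInt_param (f : R -> R -> R) (a b x : R) :
  a <= b -> (forall t, continuity_2d_pt f x t) ->
  locally x (fun u => forall t, continuous (f u) t) ->
  continuous (fun u => RInt (f u) a b) x.
Proof.
  intros Hab H2 [d0 Hd0].
  assert (Hx : forall t, continuous (f x) t) by (apply Hd0, ball_center).
  apply filterlim_locally. intros eps.
  assert (He : 0 < eps / (b - a + 1)).
  { apply Rdiv_lt_0_compat. apply cond_pos. lra. }
  destruct (uniform_continuity_2d_1d' f a b x (fun t _ => H2 t) (mkposreal _ He)) as [d Hd].
  assert (Hm : 0 < Rmin d d0) by (apply Rmin_pos; apply cond_pos).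
  exists (mkposreal _ Hm). intros u Hu.
  assert (Hu' : Rabs (u - x) < Rmin d d0) by exact Hu.
  assert (Hcu : forall t, continuous (f u) t).
  { apply Hd0. change (Rabs (u - x) < d0). eapply Rlt_le_trans; [exact Hu' | apply Rmin_r]. }
  change (Rabs (RInt (f u) a b - RInt (f x) a b) < eps).
  replace (RInt (f u) a b - RInt (f x) a b) with (1 * RInt (f u) a b + (-1) * RInt (f x) a b) by ring.
  rewrite <- RInt_lin; auto.
  assert (Hux : Rabs (u - x) < d) by (eapply Rlt_le_trans; [exact Hu' | apply Rmin_l]).
  apply Rle_lt_trans with (eps / (b - a + 1) * (b - a)).
  - apply RInt_le_const; auto.
    + intros t. apply (continuous_plus (V := R_NormedModule) (fun t => 1 * f u t) (fun t => -1 * f x t));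
        apply (continuous_scal_r (V := R_NormedModule)); auto.
    + intros t Ht. replace (1 * f u t + -1 * f x t) with (f u t - f x t) by ring.
      apply Rlt_le. apply (Hd t x t u); auto.
      * pose proof (cond_pos d). lra.
      * apply Rabs_lt_between' in Hux. lra.
      * rewrite Rminus_eq_0, Rabs_R0. apply cond_pos.
  - pose proof (cond_pos eps).
    apply Rmult_lt_reg_r with (b - a + 1); [lra |].
    field_simplify; nra.
Qed.

(** For a function continuous on the whole plane, the two iterated integrals
    have the same derivative with respect to the upper bound of one variable. *)
Lemma RInt_fubini (f : R -> R -> R) (a b c d : R) :
  a <= b -> c <= d -> (forall x y, continuity_2d_pt f x y) ->
  RInt (fun x => RInt (fun y => f x y) c d) a b =
  RInt (fun y => RInt (fun x => f x y) a b) c d.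
Proof.
  intros Hab Hcd Hf.
  assert (Hf1 : forall x y, continuous (fun t => f t y) x)
    by (intros; apply continuity_2d_pt_fst; auto).
  assert (Hf2 : forall x y, continuous (f x) y)
    by (intros; apply continuity_2d_pt_snd; auto).
  assert (HD : forall t y, Derive (fun z => RInt (fun x => f x y) a z) t = f t y).
  { intros t y. apply is_derive_unique.
    apply (is_derive_RInt_cont (fun x => f x y)). intros; auto. }
  assert (Hc : forall z y, continuous (fun v => RInt (fun x => f x v) a z) y).
  { intros z y. destruct (Rle_dec a z) as [Hz | Hz].
    - apply (continuous_RInt_param (fun v x => f x v)); auto.
      + intros t. apply continuity_2d_pt_swap; auto.
      + exists (mkposreal 1 Rlt_0_1). auto.
    - apply (continuous_ext (fun v => - RInt (fun x => f x v) z a)).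
      + intros v. apply (opp_RInt_swap (V := R_CompleteNormedModule) (fun x => f x v)).
        apply ex_RInt_cont; auto.
      + apply (continuous_opp (V := R_NormedModule)).
        apply (continuous_RInt_param (fun v x => f x v)).
        * lra.
        * intros t. apply continuity_2d_pt_swap; auto.
        * exists (mkposreal 1 Rlt_0_1). auto. }
  rewrite (RInt_FTC (fun z => RInt (fun y => RInt (fun x => f x y) a z) c d)).
  - rewrite (RInt_ext (fun y => RInt (fun x => f x y) a a) (fun _ => 0)).
    + rewrite RInt_const. unfold scal; simpl; unfold mult; simpl. ring.
    + intros y _. apply (RInt_point (V := R_CompleteNormedModule) a (fun x => f x y)).
  - intros t.
    replace (RInt (fun y => f t y) c d) with
      (RInt (fun y => Derive (fun z => RInt (fun x => f x y) a z) t) c d)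
      by (apply RInt_ext; intros; apply HD).
    apply (is_derive_RInt_param (fun z y => RInt (fun x => f x y) a z)).
    + exists (mkposreal 1 Rlt_0_1). intros z _ y _. exists (f z y).
      apply (is_derive_RInt_cont (fun x => f x y)). auto.
    + intros y _. apply continuity_2d_pt_ext with f; auto.
    + exists (mkposreal 1 Rlt_0_1). intros z _. apply ex_RInt_cont. auto.
  - intros t. apply continuous_RInt_param; auto.
    exists (mkposreal 1 Rlt_0_1). auto.
Qed.

Lemma cos2_plus_sin2 (t : R) : cos t ^ 2 + sin t ^ 2 = 1.
Proof. pose proof (sin2_cos2 t) as H. unfold Rsqr in H. lra. Qed.

Lemma cos2_sin2_pos (A B t : R) : 0 < A -> 0 < B -> 0 < A * cos t ^ 2 + B * sin t ^ 2.
Proof.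
  intros HA HB. pose proof (cos2_plus_sin2 t) as H.
  pose proof (pow2_ge_0 (sin t)). pose proof (pow2_ge_0 (cos t)).
  destruct (Rle_dec A B).
  - replace (A * cos t ^ 2 + B * sin t ^ 2) with (A * (cos t ^ 2 + sin t ^ 2) + (B - A) * sin t ^ 2) by ring.
    rewrite H. nra.
  - replace (A * cos t ^ 2 + B * sin t ^ 2) with (B * (cos t ^ 2 + sin t ^ 2) + (A - B) * cos t ^ 2) by ring.
    rewrite H. nra.
Qed.

(** A primitive that stays smooth at PI / 2, unlike
    [atan (sqrt (B / A) * tan t) / sqrt (A * B)], of which it is a continuous
    determination. *)
Lemma RInt_inv_cos2_sin2 (A B : R) :
  0 < A -> 0 < B ->
  RInt (fun t => / (A * cos t ^ 2 + B * sin t ^ 2)) 0 (PI / 2) =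
  PI / 2 / sqrt (A * B).
Proof.
  intros HA HB.
  set (m := sqrt (B / A)).
  assert (Hm : 0 < m) by (apply sqrt_lt_R0, Rdiv_lt_0_compat; auto).
  assert (Hm2 : m ^ 2 = B / A) by (apply pow2_sqrt, Rlt_le, Rdiv_lt_0_compat; auto).
  assert (HAB : sqrt (A * B) = A * m).
  { apply sqrt_lem_1; try nra. replace (A * m * (A * m)) with (A ^ 2 * m ^ 2) by ring.
    rewrite Hm2. field. lra. }
  assert (Hcs : forall t, 0 < A * cos t ^ 2 + B * sin t ^ 2) by (intros; apply cos2_sin2_pos; auto).
  assert (Hcm : forall t, 0 < cos t ^ 2 + m * sin t ^ 2)
    by (intros t; pose proof (cos2_sin2_pos 1 m t); lra).
  rewrite (RInt_FTC
    (fun t => (t + atan ((m - 1) * sin t * cos t / (cos t ^ 2 + m * sin t ^ 2))) / sqrt (A * B))).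
  - rewrite sin_PI2, cos_PI2, sin_0, cos_0, HAB.
    replace ((m - 1) * 1 * 0 / (0 ^ 2 + m * 1 ^ 2)) with 0 by (field; lra).
    replace ((m - 1) * 0 * 1 / (1 ^ 2 + m * 0 ^ 2)) with 0 by field.
    rewrite atan_0. eqR. field; lra.
  - intros t. rewrite HAB.
    assert (Hc := Hcm t). assert (Hd := Hcs t). 
    auto_derive.
    + lra.
    + replace B with (A * m ^ 2) in * by (rewrite Hm2; field; lra).
      pose proof (cos2_plus_sin2 t) as Hsc.
      revert Hc Hd Hsc. generalize (cos t) (sin t). intros c s Hc Hd Hsc.
      assert (Hq : (c ^ 2 + m * s ^ 2) ^ 2 + ((m - 1) * s * c) ^ 2 = c ^ 2 + m ^ 2 * s ^ 2).
      { replace (c ^ 2) with (1 - s ^ 2) by lra.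
        replace (((m - 1) * s * c) ^ 2) with ((m - 1) ^ 2 * s ^ 2 * c ^ 2) by ring.
        replace (c ^ 2) with (1 - s ^ 2) by lra. ring. }
      assert (Hp : 0 < c ^ 2 + m ^ 2 * s ^ 2) by nra.
      apply Rmult_eq_reg_r with (A * m * (c ^ 2 + m ^ 2 * s ^ 2)); [| nra].
      transitivity m; [| field; repeat split; nra].
      rewrite <- Hq.
      field_simplify_eq; [| repeat split; nra].
      transitivity ((m ^ 3 * s ^ 2 + m * c ^ 2) * (c ^ 2 + s ^ 2) ^ 3); [ring |].
      transitivity ((m ^ 3 * s ^ 2 + m * c ^ 2) * (c ^ 2 + s ^ 2)); [| ring].
      rewrite Hsc. ring.
  - intros t. apply (ex_derive_continuous (V := R_NormedModule)). auto_derive. pose proof (Hcs t). lra.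
Qed.

(** * Period integrals of the separated motion *)

Lemma RInt_mult_l (f : R -> R) (a b u : R) :
  (forall x, continuous f x) -> RInt (fun x => u * f x) a b = u * RInt f a b.
Proof.
  intros Hf. apply (RInt_scal (V := R_CompleteNormedModule) f). apply ex_RInt_cont; auto.
Qed.

(** Continuity through differentiability; leaves the positivity of the arguments
    of the square roots and the non-vanishing of the denominators. *)
Ltac cont1 :=
  apply (ex_derive_continuous (V := R_NormedModule)); auto_derive.

(** Joint continuity by descent through the expression, with the same side
    conditions. *)
Ltac cont2 :=
  repeat match goal with
  | |- continuity_2d_pt (fun u v => ?c) _ _ => apply continuity_2d_pt_const
  | |- continuity_2d_pt (fun u v => u) _ _ => apply continuity_2d_pt_id1
  | |- continuity_2d_pt (fun u v => v) _ _ => apply continuity_2d_pt_id2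
  | |- continuity_2d_pt (fun u v => @?f u v + @?g u v) _ _ => apply (continuity_2d_pt_plus f g)
  | |- continuity_2d_pt (fun u v => @?f u v - @?g u v) _ _ => apply (continuity_2d_pt_minus f g)
  | |- continuity_2d_pt (fun u v => @?f u v * @?g u v) _ _ => apply (continuity_2d_pt_mult f g)
  | |- continuity_2d_pt (fun u v => @?f u v / @?g u v) _ _ =>
      apply (continuity_2d_pt_mult f (fun u v => / g u v))
  | |- continuity_2d_pt (fun u v => / @?f u v) _ _ => apply (continuity_2d_pt_inv f)
  | |- continuity_2d_pt (fun u v => cos (@?f u v)) _ _ =>
      apply (continuity_1d_2d_pt_comp cos f); [apply continuity_cos |]
  | |- continuity_2d_pt (fun u v => sin (@?f u v)) _ _ =>
      apply (continuity_1d_2d_pt_comp sin f); [apply continuity_sin |]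
  | |- continuity_2d_pt (fun u v => sqrt (@?f u v)) _ _ =>
      apply (continuity_1d_2d_pt_comp sqrt f); [apply continuity_pt_sqrt |]
  | |- continuity_2d_pt (fun u v => @?f u v ^ ?n) _ _ =>
      apply (continuity_1d_2d_pt_comp (fun x => x ^ n) f);
      [apply derivable_continuous_pt, derivable_pt_pow |]
  end.

Lemma cos2_bounds (t : R) : 0 <= cos t ^ 2 <= 1.
Proof.
  pose proof (cos2_plus_sin2 t). pose proof (pow2_ge_0 (sin t)).
  pose proof (pow2_ge_0 (cos t)). lra.
Qed.

Lemma sqrt_neq_0 (x : R) : 0 < x -> sqrt x <> 0.
Proof. intros H. apply Rgt_not_eq, sqrt_lt_R0. exact H. Qed.

(** The oscillating root [mu2] of the elliptic coordinates, between [4 - b]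
    (at angle 0) and [1 + b]. *)
Definition mu2 (b t : R) : R := (4 - b) * cos t ^ 2 + (1 + b) * sin t ^ 2.

(** Half of the travel time of the second angle from 0 to PI. *)
Definition W (b : R) : R :=
  RInt (fun t => / sqrt (mu2 b t * (mu2 b t - 1) * (4 - mu2 b t))) 0 (PI / 2).

(** The inverse of the speed of the first angle. The travel time depends on [b]
    only through [k = b * (3 - b)], since
    [(4 - b - x) * (1 + b - x) = (1 - x) * (4 - x) + k]. *)
Definition Jf (k a : R) : R := / sqrt ((3 + sin a ^ 2) * (sin a ^ 2 * (3 + sin a ^ 2) + k)).

Definition J (k : R) : R := RInt (Jf k) 0 (PI / 2).

(** The integral of the same differential over the real branch beyond 4 of the
    spectral curve, in the parameter [4 + tan a ^ 2]. *)
Definition Kf (k a : R) : R :=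
  cos a ^ 2 / sqrt ((4 * cos a ^ 2 + sin a ^ 2) * (3 * cos a ^ 2 + sin a ^ 2) *
    (k * cos a ^ 4 + 3 * cos a ^ 2 * sin a ^ 2 + sin a ^ 4)).

Definition K (k : R) : R := RInt (Kf k) 0 (PI / 2).

Lemma mu2_bounds (b t : R) : 0 < b < 3 -> 1 < mu2 b t < 4.
Proof.
  intros Hb. unfold mu2.
  pose proof (cos2_sin2_pos (3 - b) b t). pose proof (cos2_sin2_pos b (3 - b) t).
  pose proof (cos2_plus_sin2 t). nra.
Qed.

Lemma Jf_pos (k a : R) : 0 < k -> 0 < (3 + sin a ^ 2) * (sin a ^ 2 * (3 + sin a ^ 2) + k).
Proof.
  intros Hk. pose proof (pow2_ge_0 (sin a)). apply Rmult_lt_0_compat; nra.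
Qed.

Lemma Kf_pos (k a : R) : 0 < k ->
  0 < (4 * cos a ^ 2 + sin a ^ 2) * (3 * cos a ^ 2 + sin a ^ 2) *
    (k * cos a ^ 4 + 3 * cos a ^ 2 * sin a ^ 2 + sin a ^ 4).
Proof.
  intros Hk.
  pose proof (cos2_sin2_pos 4 1 a). pose proof (cos2_sin2_pos 3 1 a).
  pose proof (cos2_plus_sin2 a). pose proof (pow2_ge_0 (cos a)). pose proof (pow2_ge_0 (sin a)).
  apply Rmult_lt_0_compat; [apply Rmult_lt_0_compat; lra |].
  replace (sin a ^ 4) with (sin a ^ 2 * sin a ^ 2) by ring.
  replace (cos a ^ 4) with (cos a ^ 2 * cos a ^ 2) by ring.
  destruct (Req_dec (sin a ^ 2) 0) as [E | E].
  - rewrite E in *. replace (cos a ^ 2) with 1 by lra. lra.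
  - assert (0 < sin a ^ 2 * sin a ^ 2) by nra.
    assert (0 <= k * (cos a ^ 2 * cos a ^ 2)) by (apply Rmult_le_pos; nra).
    assert (0 <= cos a ^ 2 * sin a ^ 2) by nra. lra.
Qed.

Lemma continuous_Jf (k a : R) : 0 < k -> continuous (Jf k) a.
Proof.
  intros Hk. unfold Jf. pose proof (Jf_pos k a Hk). cont1.
  split; [lra |]. split; auto. apply sqrt_neq_0. lra.
Qed.

Lemma continuous_Kf (k a : R) : 0 < k -> continuous (Kf k) a.
Proof.
  intros Hk. unfold Kf. pose proof (Kf_pos k a Hk). cont1.
  split; [lra |]. split; auto. apply sqrt_neq_0. lra.
Qed.

Section identity.
Variable b : R.
Hypothesis Hb : 0 < b < 3.
Let k := b * (3 - b).
Let z := mu2 b.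

Lemma inner_alpha (t : R) :
  RInt (fun a => / (z t - cos a ^ 2) * / sqrt (4 - z t)) 0 (PI / 2) =
  PI / 2 * / sqrt (z t * (z t - 1) * (4 - z t)).
Proof.
  pose proof (mu2_bounds b t Hb) as Hz. fold z in Hz.
  rewrite (RInt_ext _ (fun a => / sqrt (4 - z t) * / ((z t - 1) * cos a ^ 2 + z t * sin a ^ 2))).
  - rewrite RInt_mult_l, RInt_inv_cos2_sin2; try lra.
    + replace (z t * (z t - 1) * (4 - z t)) with ((z t - 1) * z t * (4 - z t)) by ring.
      rewrite (sqrt_mult ((z t - 1) * z t)); try nra.
      eqR. field. split; apply sqrt_neq_0; nra.
    + intros a. pose proof (cos2_sin2_pos (z t - 1) (z t) a). cont1. lra.
  - intros a _. pose proof (cos2_plus_sin2 a) as E.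
    replace (z t - cos a ^ 2) with ((z t - 1) * cos a ^ 2 + z t * sin a ^ 2)
      by (replace (sin a ^ 2) with (1 - cos a ^ 2) by lra; ring).
    apply Rmult_comm.
Qed.

Lemma inner_psi (y : R) : y < 4 ->
  RInt (fun a => / (4 * cos a ^ 2 + sin a ^ 2 - y * cos a ^ 2)) 0 (PI / 2) = PI / 2 / sqrt (4 - y).
Proof.
  intros Hy.
  rewrite (RInt_ext _ (fun a => / ((4 - y) * cos a ^ 2 + 1 * sin a ^ 2))).
  - rewrite RInt_inv_cos2_sin2, Rmult_1_r; lra.
  - intros. f_equal. ring.
Qed.

Let x (a : R) := cos a ^ 2.
Let n (p : R) := 4 * cos p ^ 2 + sin p ^ 2.

Lemma n_minus_pos (y p : R) : y < 4 -> 0 < n p - y * cos p ^ 2.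
Proof.
  intros Hy. unfold n. pose proof (cos2_sin2_pos (4 - y) 1 p). lra.
Qed.

(** The partial fraction decomposition of [/ ((z - x) * (n - z c2))] in [z]
    separates the two remaining variables. *)
Lemma inner_beta (a p : R) :
  RInt (fun t => / (z t - x a) * / (n p - z t * cos p ^ 2)) 0 (PI / 2) =
  PI / 2 * (/ (n p - x a * cos p ^ 2) *
    (cos p ^ 2 / sqrt ((b * cos p ^ 2 + sin p ^ 2) * ((3 - b) * cos p ^ 2 + sin p ^ 2)) +
     / sqrt ((4 - b - x a) * (1 + b - x a)))).
Proof.
  assert (Hx := cos2_bounds a). fold (x a) in Hx.
  assert (Hn := n_minus_pos (x a) p).
  assert (Hz : forall t, 1 < z t < 4) by (intros; apply mu2_bounds; auto).
  assert (Hnz : forall t, 0 < n p - z t * cos p ^ 2) by (intros; apply n_minus_pos; apply Hz).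
  pose proof (cos2_sin2_pos b 1 p). pose proof (cos2_sin2_pos (3 - b) 1 p).
  rewrite (RInt_ext _ (fun t =>
    cos p ^ 2 / (n p - x a * cos p ^ 2) *
      / ((b * cos p ^ 2 + sin p ^ 2) * cos t ^ 2 + ((3 - b) * cos p ^ 2 + sin p ^ 2) * sin t ^ 2) +
    / (n p - x a * cos p ^ 2) * / ((4 - b - x a) * cos t ^ 2 + (1 + b - x a) * sin t ^ 2))).
  - rewrite RInt_lin.
    + rewrite !RInt_inv_cos2_sin2; lra.
    + intros t.
      pose proof (cos2_sin2_pos (b * cos p ^ 2 + sin p ^ 2) ((3 - b) * cos p ^ 2 + sin p ^ 2) t).
      cont1. lra.
    + intros t. pose proof (cos2_sin2_pos (4 - b - x a) (1 + b - x a) t). cont1. lra.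
  - intros t _. specialize (Hz t). specialize (Hnz t).
    replace ((b * cos p ^ 2 + sin p ^ 2) * cos t ^ 2 + ((3 - b) * cos p ^ 2 + sin p ^ 2) * sin t ^ 2)
      with (n p - z t * cos p ^ 2).
    2: { unfold n, z, mu2. pose proof (cos2_plus_sin2 t) as E.
         replace (sin t ^ 2) with (1 - cos t ^ 2) by lra. ring. }
    replace ((4 - b - x a) * cos t ^ 2 + (1 + b - x a) * sin t ^ 2) with (z t - x a).
    2: { unfold z, mu2. pose proof (cos2_plus_sin2 t) as E.
         replace (sin t ^ 2) with (1 - cos t ^ 2) by lra. ring. }
    eqR. field. repeat split; lra.
Qed.

(** This is the relation between the periods of [dx / sqrt P] over the three
    real branches of the curve, usually read off from a contour at infinity. Here
    [/ sqrt (z * (z - 1))] and [/ sqrt (4 - z)] are replaced by integrals of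
    rational functions of [z], after which every order of integration is
    elementary. *)
Theorem period_identity : W b = J k + K k.
Proof.
  assert (Hz : forall t, 1 < z t < 4) by (intros; apply mu2_bounds; auto).
  assert (Hx : forall a, 0 <= x a <= 1) by (intros; apply cos2_bounds).
  assert (HPI := PI_RGT_0).
  assert (Hzn : forall t p, 0 < n p - z t * cos p ^ 2) by (intros; apply n_minus_pos; apply Hz).
  assert (Hxn : forall a p, 0 < n p - x a * cos p ^ 2).
  { intros a p; apply n_minus_pos. pose proof (Hx a). lra. }
  assert (Hd1 : forall p, 0 < b * cos p ^ 2 + sin p ^ 2)
    by (intros p; pose proof (cos2_sin2_pos b 1 p); lra).
  assert (Hd2 : forall p, 0 < (3 - b) * cos p ^ 2 + sin p ^ 2)
    by (intros p; pose proof (cos2_sin2_pos (3 - b) 1 p); lra).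
  assert (E1 : PI / 2 * W b =
    RInt (fun a => RInt (fun t => / (z t - x a) * / sqrt (4 - z t)) 0 (PI / 2)) 0 (PI / 2)).
  { rewrite <- (RInt_fubini (fun t a => / (z t - x a) * / sqrt (4 - z t))); try lra.
    - unfold W. rewrite <- RInt_mult_l.
      + apply RInt_ext. intros t _. symmetry. apply inner_alpha.
      + intros t. specialize (Hz t). unfold z, mu2 in Hz |- *. unfold mu2. cont1.
        split; [| split; auto; apply sqrt_neq_0]; apply Rmult_lt_0_compat; nra.
    - intros t a. specialize (Hz t). specialize (Hx a). unfold z, x, mu2 in *. cont2; try lra.
      apply sqrt_neq_0. lra. }
  assert (E2 : forall a, PI / 2 * RInt (fun t => / (z t - x a) * / sqrt (4 - z t)) 0 (PI / 2) =
    RInt (fun p => PI / 2 * (/ (n p - x a * cos p ^ 2) *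
    (cos p ^ 2 / sqrt ((b * cos p ^ 2 + sin p ^ 2) * ((3 - b) * cos p ^ 2 + sin p ^ 2)) +
     / sqrt ((4 - b - x a) * (1 + b - x a))))) 0 (PI / 2)).
  { intros a.
    rewrite (RInt_ext (fun p => PI / 2 * _)
      (fun p => RInt (fun t => / (z t - x a) * / (n p - z t * cos p ^ 2)) 0 (PI / 2)))
      by (intros; symmetry; apply inner_beta).
    rewrite <- (RInt_fubini (fun t p => / (z t - x a) * / (n p - z t * cos p ^ 2))); try lra.
    - rewrite <- RInt_mult_l.
      + apply RInt_ext. intros t _.
        rewrite RInt_mult_l.
        * unfold n. rewrite inner_psi by apply Hz. eqR. specialize (Hz t). specialize (Hx a).
          field. split; [| lra]. apply sqrt_neq_0. lra.
        * intros p. specialize (Hzn t p). unfold n in *. cont1. lra.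
      + intros t. specialize (Hz t). specialize (Hx a). unfold z, mu2 in *. cont1.
        repeat split; try lra. apply sqrt_neq_0. lra.
    - intros t p. specialize (Hz t). specialize (Hx a). specialize (Hzn t p).
      unfold z, n, mu2 in *. cont2; lra. }
  set (q p := cos p ^ 2 / sqrt ((b * cos p ^ 2 + sin p ^ 2) * ((3 - b) * cos p ^ 2 + sin p ^ 2))).
  assert (Hq : forall p, continuous q p).
  { intros p. specialize (Hd1 p). specialize (Hd2 p). unfold q. cont1.
    split; [| split; auto; apply sqrt_neq_0]; apply Rmult_lt_0_compat; lra. }
  assert (E3 : forall a, RInt (fun t => / (z t - x a) * / sqrt (4 - z t)) 0 (PI / 2) =
    RInt (fun p => q p * / (n p - x a * cos p ^ 2)) 0 (PI / 2) + PI / 2 * Jf k a).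
  { intros a. apply Rmult_eq_reg_l with (PI / 2); [| lra]. rewrite E2.
    assert (Ha := Hx a).
    rewrite (RInt_ext _ (fun p => PI / 2 * (q p * / (n p - x a * cos p ^ 2)) +
       (PI / 2 * / sqrt ((4 - b - x a) * (1 + b - x a))) * / (n p - x a * cos p ^ 2)))
      by (intros; unfold q; eqR; ring).
    rewrite RInt_lin.
    - unfold n. rewrite inner_psi by lra.
      unfold Jf. replace (3 + sin a ^ 2) with (4 - x a)
        by (unfold x; pose proof (cos2_plus_sin2 a); lra).
      replace (sin a ^ 2 * (4 - x a) + k) with ((4 - b - x a) * (1 + b - x a)).
      2: { unfold x, k. pose proof (cos2_plus_sin2 a).
           replace (sin a ^ 2) with (1 - cos a ^ 2) by lra. ring. }
      rewrite (sqrt_mult (4 - x a)); try nra. eqR. field.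
      split; apply sqrt_neq_0; nra.
    - intros p. apply (continuous_mult q); auto.
      specialize (Hxn a p). unfold n in *. cont1. lra.
    - intros p. specialize (Hxn a p). unfold n in *. cont1. lra. }
  apply Rmult_eq_reg_l with (PI / 2); [| lra]. rewrite E1.
  rewrite (RInt_ext _ (fun a => 1 * RInt (fun p => q p * / (n p - x a * cos p ^ 2)) 0 (PI / 2) +
     PI / 2 * Jf k a)) by (intros a _; rewrite E3; eqR; ring).
  assert (H2 : forall p a, continuity_2d_pt (fun p a => q p * / (n p - x a * cos p ^ 2)) p a).
  { intros p a. specialize (Hd1 p). specialize (Hd2 p). specialize (Hxn a p). unfold q, n, x in *.
    cont2; try lra. 
    - assert (0 < (b * cos p ^ 2 + sin p ^ 2) * ((3 - b) * cos p ^ 2 + sin p ^ 2))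
        by (apply Rmult_lt_0_compat; lra). lra.
    - apply sqrt_neq_0, Rmult_lt_0_compat; lra. }
  rewrite RInt_lin.
  - rewrite <- (RInt_fubini (fun p a => q p * / (n p - x a * cos p ^ 2))); try lra; auto.
    rewrite (RInt_ext _ (fun p => PI / 2 * Kf k p)).
    + rewrite RInt_mult_l.
      * unfold J, K. eqR. ring.
      * intros. apply continuous_Kf. unfold k. nra.
    + intros p _. rewrite RInt_mult_l.
      * rewrite (RInt_ext _ (fun a => / ((3 * cos p ^ 2 + sin p ^ 2) * cos a ^ 2 + n p * sin a ^ 2))).
        -- pose proof (cos2_sin2_pos 3 1 p). pose proof (cos2_sin2_pos 4 1 p).
           specialize (Hd1 p). specialize (Hd2 p).
           rewrite RInt_inv_cos2_sin2; unfold n; try lra.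
           unfold q, Kf.
           replace (k * cos p ^ 4 + 3 * cos p ^ 2 * sin p ^ 2 + sin p ^ 4) with
             ((b * cos p ^ 2 + sin p ^ 2) * ((3 - b) * cos p ^ 2 + sin p ^ 2)) by (unfold k; ring).
           rewrite (Rmult_comm (4 * cos p ^ 2 + sin p ^ 2)).
           assert (0 < (b * cos p ^ 2 + sin p ^ 2) * ((3 - b) * cos p ^ 2 + sin p ^ 2))
             by (apply Rmult_lt_0_compat; lra).
           assert (0 < (3 * cos p ^ 2 + sin p ^ 2) * (4 * cos p ^ 2 + sin p ^ 2))
             by (apply Rmult_lt_0_compat; lra).
           rewrite (sqrt_mult ((3 * cos p ^ 2 + sin p ^ 2) * _)) by lra.
           eqR. field. split; apply sqrt_neq_0; lra.
        -- intros a _. f_equal. unfold n, x. pose proof (cos2_plus_sin2 a).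
           replace (sin a ^ 2) with (1 - cos a ^ 2) by lra. ring.
      * intros a. specialize (Hxn a p). unfold x in *. cont1. lra.
  - intros a. apply (continuous_RInt_param (fun a p => q p * / (n p - x a * cos p ^ 2))).
    + lra.
    + intros p. apply (continuity_2d_pt_swap _ _ _ (H2 p a)).
    + exists (mkposreal 1 Rlt_0_1). intros a' _ p. apply (continuity_2d_pt_fst (fun p a => q p * / (n p - x a * cos p ^ 2)) p a'). auto.
  - intros a. apply continuous_Jf. unfold k. nra.
Qed.

End identity.

(** * Comparison of the two period integrals *)

Lemma J_pos (k : R) : 0 < k -> 0 < J k.
Proof.
  intros Hk. apply RInt_pos_cont.
  - pose proof PI_RGT_0. lra.
  - intros. apply continuous_Jf; auto.
  - intros. apply Rinv_0_lt_compat, sqrt_lt_R0, Jf_pos; auto.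
Qed.

Lemma continuous_J (k : R) : 0 < k -> continuous J k.
Proof.
  intros Hk. apply (continuous_RInt_param Jf).
  - pose proof PI_RGT_0. lra.
  - intros a. unfold Jf. pose proof (Jf_pos k a Hk). cont2; [lra | apply sqrt_neq_0; lra].
  - exists (mkposreal k Hk). intros u Hu a. apply continuous_Jf.
    apply Rabs_lt_between' in Hu. simpl in Hu. lra.
Qed.

Lemma continuous_K (k : R) : 0 < k -> continuous K k.
Proof.
  intros Hk. apply (continuous_RInt_param Kf).
  - pose proof PI_RGT_0. lra.
  - intros a. unfold Kf. pose proof (Kf_pos k a Hk). cont2; [lra | apply sqrt_neq_0; lra].
  - exists (mkposreal k Hk). intros u Hu a. apply continuous_Kf.
    apply Rabs_lt_between' in Hu. simpl in Hu. lra.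
Qed.

Lemma Kf_sin2 (k a : R) : let x := sin a ^ 2 in
  Kf k a = (1 - x) / sqrt ((4 - 3 * x) * (3 - 2 * x) * (x * (3 - 2 * x) + k * (1 - x) ^ 2)).
Proof.
  unfold Kf. cbv zeta.
  replace (cos a ^ 4) with ((cos a ^ 2) ^ 2) by ring.
  replace (cos a ^ 2) with (1 - sin a ^ 2) by (pose proof (cos2_plus_sin2 a); lra).
  f_equal. f_equal. ring.
Qed.

Lemma sin2_bounds (t : R) : 0 <= sin t ^ 2 <= 1.
Proof.
  pose proof (cos2_plus_sin2 t). pose proof (cos2_bounds t). lra.
Qed.

Lemma sin2_strict (t : R) : 0 < t < PI / 2 -> 0 < sin t ^ 2 < 1.
Proof.
  intros H. pose proof (cos2_plus_sin2 t).
  assert (0 < sin t) by (apply sin_gt_0; lra).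
  assert (0 < cos t) by (apply cos_gt_0; lra). nra.
Qed.

(** After squaring, the difference of the two sides is
    [x * (...) + k * (1 - x) ^ 2 * (9 - 18 * x + 6 * x ^ 2)], whose last factor
    becomes negative only where the first term is large. *)
Lemma Kf_lt_Jf (k a : R) : 0 < k <= 9 / 4 -> 0 < a < PI / 2 -> Kf k a < Jf k a.
Proof.
  intros Hk Ha. rewrite Kf_sin2. unfold Jf.
  assert (Hx := sin2_strict a Ha). revert Hx. generalize (sin a ^ 2). intros x Hx.
  assert (H1 : 0 < (4 - 3 * x) * (3 - 2 * x)) by nra.
  assert (H2 : 0 < x * (3 - 2 * x)) by nra.
  assert (H3 : 0 <= k * (1 - x) ^ 2) by (apply Rmult_le_pos; [lra | apply pow2_ge_0]).
  set (A := (4 - 3 * x) * (3 - 2 * x) * (x * (3 - 2 * x) + k * (1 - x) ^ 2)).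
  set (B := (3 + x) * (x * (3 + x) + k)).
  assert (HB : 0 < B) by (unfold B; apply Rmult_lt_0_compat; nra).
  assert (HAB : (1 - x) ^ 2 * B < A).
  { unfold A, B.
    assert (E : (4 - 3 * x) * (3 - 2 * x) * (x * (3 - 2 * x) + k * (1 - x) ^ 2) -
      (1 - x) ^ 2 * ((3 + x) * (x * (3 + x) + k)) =
      x * ((4 - 3 * x) * (3 - 2 * x) ^ 2 - (1 - x) ^ 2 * (3 + x) ^ 2) +
      k * ((1 - x) ^ 2 * (9 - 18 * x + 6 * x ^ 2))) by ring.
    assert (F : 1 - 7 * (1 - x) ^ 2 + 7 * (1 - x) <=
       (4 - 3 * x) * (3 - 2 * x) ^ 2 - (1 - x) ^ 2 * (3 + x) ^ 2).
    { assert (E2 : (4 - 3 * x) * (3 - 2 * x) ^ 2 - (1 - x) ^ 2 * (3 + x) ^ 2 -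
        (1 - 7 * (1 - x) ^ 2 + 7 * (1 - x)) =
        (1 - x) ^ 2 * (16 + 12 * (1 - x) + 7 - (4 - (1 - x)) ^ 2)) by ring.
      assert (0 <= (1 - x) ^ 2 * (16 + 12 * (1 - x) + 7 - (4 - (1 - x)) ^ 2))
        by (apply Rmult_le_pos; nra).
      lra. }
    destruct (Rle_dec x (3 / 5)) as [Hc | Hc].
    - assert (0 <= k * ((1 - x) ^ 2 * (9 - 18 * x + 6 * x ^ 2)))
        by (apply Rmult_le_pos; [lra | apply Rmult_le_pos; [apply pow2_ge_0 | nra]]).
      assert (0 < 1 - 7 * (1 - x) ^ 2 + 7 * (1 - x)) by nra.
      assert (0 < x * ((4 - 3 * x) * (3 - 2 * x) ^ 2 - (1 - x) ^ 2 * (3 + x) ^ 2))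
        by (apply Rmult_lt_0_compat; lra).
      lra.
    - assert (G : - 3 * (1 - x) ^ 2 <= (1 - x) ^ 2 * (9 - 18 * x + 6 * x ^ 2))
        by (assert (0 <= (1 - x) ^ 2 * (12 - 18 * x + 6 * x ^ 2))
              by (apply Rmult_le_pos; [apply pow2_ge_0 | nra]); lra).
      assert (G' : - (27 / 4) * (1 - x) ^ 2 <= k * ((1 - x) ^ 2 * (9 - 18 * x + 6 * x ^ 2))) by nra.
      assert (3 / 5 * (1 - 7 * (1 - x) ^ 2 + 7 * (1 - x)) <=
         x * ((4 - 3 * x) * (3 - 2 * x) ^ 2 - (1 - x) ^ 2 * (3 + x) ^ 2)) by nra.
      nra. }
  assert (HA : 0 < A) by nra.
  apply Rmult_lt_reg_r with (sqrt A * sqrt B).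
  { apply Rmult_lt_0_compat; apply sqrt_lt_R0; auto. }
  replace ((1 - x) / sqrt A * (sqrt A * sqrt B)) with ((1 - x) * sqrt B)
    by (field; apply sqrt_neq_0; auto).
  replace (/ sqrt B * (sqrt A * sqrt B)) with (sqrt A) by (field; apply sqrt_neq_0; auto).
  rewrite <- (sqrt_pow2 (1 - x)) by lra.
  rewrite <- sqrt_mult by nra. apply sqrt_lt_1; nra.
Qed.

Lemma K_lt_J (k : R) : 0 < k <= 9 / 4 -> K k < J k.
Proof.
  intros Hk. apply RInt_lt_cont.
  - pose proof PI_RGT_0. lra.
  - intros; apply continuous_Kf; lra.
  - intros; apply continuous_Jf; lra.
  - intros. apply Kf_lt_Jf; auto.
Qed.

Lemma RInt_sin_quadratic (a b c : R) :
  RInt (fun t => a + b * sin t ^ 2 + c * sin t ^ 4) 0 (PI / 2) = PI / 2 * (a + b / 2 + 3 * c / 8).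
Proof.
  rewrite (RInt_FTC (fun t => a * t + b * ((t - sin t * cos t) / 2) +
    c * (3 / 8 * t - 3 / 8 * (sin t * cos t) - sin t ^ 3 * cos t / 4))).
  - rewrite sin_PI2, cos_PI2, sin_0, cos_0. eqR. field.
  - intros t. auto_derive; auto.
    transitivity (a + b * ((1 + sin t ^ 2 - cos t ^ 2) / 2) +
      c * (3 / 8 * (1 + sin t ^ 2 - cos t ^ 2) + sin t ^ 4 / 4 - 3 / 4 * (sin t ^ 2 * cos t ^ 2))).
    { field. }
    replace (cos t ^ 2) with (1 - sin t ^ 2) by (pose proof (cos2_plus_sin2 t); lra). field.
  - intros t. cont1. auto.
Qed.

(** The difference is bounded below by [(17 / 25 - x) * h * / sqrt (x * (3 + x) + k)]
    with [x = sin a ^ 2] and [h] positive. The last factor decreases in [x], and the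
    less steeply the larger [k] is; replacing it by a multiple of its value
    [/ (x + 3 / 2)] at [k = 9 / 4] therefore only lowers the bound on both sides of
    [x = 17 / 25], and leaves a single function of [x] to estimate. *)
Lemma Jf_lt_3Kf (k a : R) : 0 < k <= 9 / 4 ->
  let C := (17 / 25 + 3 / 2) / sqrt (17 / 25 * (3 + 17 / 25) + k) in
  C * (18 / 100 - 192 / 1000 * sin a ^ 2 - 2 / 10 * (sin a ^ 2) ^ 2) <= 3 * Kf k a - Jf k a.
Proof.
  intros Hk C. rewrite Kf_sin2. unfold Jf.
  assert (Hx := sin2_bounds a). revert Hx. generalize (sin a ^ 2). intros x Hx.
  set (X := x * (3 + x)). set (X0 := 17 / 25 * (3 + 17 / 25)) in *.
  set (v := / sqrt (X + k)).
  assert (HX : 0 <= X) by (unfold X; nra).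
  assert (Hv : 0 < v) by (apply Rinv_0_lt_compat, sqrt_lt_R0; lra).
  assert (HX0 : 0 < X0) by (unfold X0; lra).
  assert (HC : 0 < C) by (apply Rdiv_lt_0_compat; [lra | apply sqrt_lt_R0; lra]).
  (* The linear factor is slightly above the chord of the convex function
     [/ sqrt (3 + x)] on [0, 1]. *)
  assert (HJ : / sqrt ((3 + x) * (X + k)) <= (578 / 1000 - 78 / 1000 * x) * v).
  { rewrite sqrt_mult by lra. rewrite Rinv_mult. fold v.
    apply Rmult_le_compat_r; [lra |].
    rewrite <- (Rinv_inv (578 / 1000 - 78 / 1000 * x)).
    apply Rinv_le_contravar; [apply Rinv_0_lt_compat; lra |].
    rewrite <- (sqrt_pow2 (/ (578 / 1000 - 78 / 1000 * x)))
      by (apply Rlt_le, Rinv_0_lt_compat; lra).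
    apply sqrt_le_1_alt.
    apply Rmult_le_reg_r with ((578 / 1000 - 78 / 1000 * x) ^ 2); [apply pow_lt; lra |].
    rewrite <- Rpow_mult_distr, Rinv_l by lra. 
    assert (0 <= x * (1 - x)) by nra. nra. }
  (* [(7 - 5 * x) / 2] is the arithmetic mean of the two factors whose geometric
     mean it replaces. *)
  assert (HK : 2 * (1 - x) / (7 - 5 * x) * v <=
    (1 - x) / sqrt ((4 - 3 * x) * (3 - 2 * x) * (x * (3 - 2 * x) + k * (1 - x) ^ 2))).
  { assert (H1 : 0 < (4 - 3 * x) * (3 - 2 * x)) by nra.
    assert (H2 : 0 < x * (3 - 2 * x) + k * (1 - x) ^ 2).
    { destruct (Req_dec x 0) as [-> | Hx0]; [lra |].
      assert (0 < x * (3 - 2 * x)) by nra. nra. }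
    assert (H3 : x * (3 - 2 * x) + k * (1 - x) ^ 2 <= X + k).
    { unfold X. assert (0 <= k * (x * (2 - x))) by (apply Rmult_le_pos; nra). nra. }
    replace (2 * (1 - x) / (7 - 5 * x) * v) with ((1 - x) * (2 / (7 - 5 * x) * v)) by (field; lra).
    apply Rmult_le_compat_l; [lra |].
    replace (2 / (7 - 5 * x) * v) with (/ ((7 - 5 * x) / 2 * sqrt (X + k)))
      by (unfold v; field; split; [apply sqrt_neq_0 |]; lra).
    apply Rinv_le_contravar.
    - apply sqrt_lt_R0. nra.
    - rewrite <- (sqrt_pow2 ((7 - 5 * x) / 2)) by lra.
      rewrite <- sqrt_mult; [| nra | lra]. apply sqrt_le_1_alt.
      apply Rmult_le_compat; nra. }
  assert (Hs : 0 <= (17 / 25 - x) * (v - C / (x + 3 / 2))).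
  { assert (Hcmp : forall y1 y2, 0 <= y1 <= y2 -> 
      (y2 + 3 / 2) / sqrt (y2 * (3 + y2) + k) / (y1 + 3 / 2) <= / sqrt (y1 * (3 + y1) + k)).
    { intros y1 y2 Hy.
      assert (P1 : 0 < y1 * (3 + y1) + k) by nra. assert (P2 : 0 < y2 * (3 + y2) + k) by nra.
      assert (S1 := sqrt_lt_R0 _ P1). assert (S2 := sqrt_lt_R0 _ P2).
      apply Rmult_le_reg_r with (sqrt (y2 * (3 + y2) + k) * (y1 + 3 / 2) * sqrt (y1 * (3 + y1) + k)).
      { repeat apply Rmult_lt_0_compat; lra. }
      replace (_ * (sqrt (y2 * (3 + y2) + k) * (y1 + 3 / 2) * sqrt (y1 * (3 + y1) + k)))
        with ((y2 + 3 / 2) * sqrt (y1 * (3 + y1) + k)) by (field; repeat split; lra).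
      replace (_ * (sqrt (y2 * (3 + y2) + k) * (y1 + 3 / 2) * sqrt (y1 * (3 + y1) + k)))
        with ((y1 + 3 / 2) * sqrt (y2 * (3 + y2) + k)) by (field; lra).
      rewrite <- (sqrt_pow2 (y2 + 3 / 2)), <- (sqrt_pow2 (y1 + 3 / 2)) by lra.
      rewrite <- !sqrt_mult by nra. apply sqrt_le_1_alt.
      assert (0 <= (9 / 4 - k) * (y2 * (3 + y2) - y1 * (3 + y1))) by (apply Rmult_le_pos; nra).
      nra. }
    destruct (Rle_dec x (17 / 25)) as [Hc | Hc].
    - apply Rmult_le_pos; [lra |]. specialize (Hcmp x (17 / 25)).
      fold X X0 in Hcmp. fold C v in Hcmp. lra.
    - specialize (Hcmp (17 / 25) x). fold X X0 in Hcmp.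
      assert (Hd : v <= C / (x + 3 / 2)).
      { apply Rmult_le_reg_r with ((x + 3 / 2) / (17 / 25 + 3 / 2)).
        - apply Rdiv_lt_0_compat; lra.
        - replace (C / (x + 3 / 2) * ((x + 3 / 2) / (17 / 25 + 3 / 2))) with (/ sqrt (X0 + k)).
          + replace (v * ((x + 3 / 2) / (17 / 25 + 3 / 2)))
              with ((x + 3 / 2) / sqrt (X + k) / (17 / 25 + 3 / 2)).
            * apply Hcmp; lra.
            * unfold v. field. apply sqrt_neq_0. lra.
          + unfold C. field. split; [apply sqrt_neq_0 |]; lra. }
      nra. }
  set (h := (285 / 100 + 39 / 100 * x) / (7 - 5 * x)).
  assert (Hh : 0 < h) by (apply Rdiv_lt_0_compat; lra).
  assert (H4 : (17 / 25 - x) * h * v <= 3 * (2 * (1 - x) / (7 - 5 * x) * v) - (578 / 1000 - 78 / 1000 * x) * v).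
  { replace (3 * (2 * (1 - x) / (7 - 5 * x) * v) - (578 / 1000 - 78 / 1000 * x) * v) with
      ((6 * (1 - x) - (578 / 1000 - 78 / 1000 * x) * (7 - 5 * x)) / (7 - 5 * x) * v) by (field; lra).
    apply Rmult_le_compat_r; [lra |]. unfold h.
    replace ((17 / 25 - x) * ((285 / 100 + 39 / 100 * x) / (7 - 5 * x))) with
      ((17 / 25 - x) * (285 / 100 + 39 / 100 * x) / (7 - 5 * x)) by (field; lra).
    apply Rmult_le_compat_r; [apply Rlt_le, Rinv_0_lt_compat; lra |]. nra. }
  assert (H5 : C * ((17 / 25 - x) * h / (x + 3 / 2)) <= (17 / 25 - x) * h * v).
  { assert (0 <= h * ((17 / 25 - x) * (v - C / (x + 3 / 2)))) by (apply Rmult_le_pos; lra).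
    replace (C * ((17 / 25 - x) * h / (x + 3 / 2))) with (h * (17 / 25 - x) * (C / (x + 3 / 2)))
      by (field; lra). nra. }
  (* A quadratic below the remaining function of [x], with positive mean against
     [x = sin a ^ 2]. *)
  assert (H6 : 18 / 100 - 192 / 1000 * x - 2 / 10 * x ^ 2 <= (17 / 25 - x) * h / (x + 3 / 2)).
  { unfold h. replace ((17 / 25 - x) * ((285 / 100 + 39 / 100 * x) / (7 - 5 * x)) / (x + 3 / 2)) with
      ((17 / 25 - x) * (285 / 100 + 39 / 100 * x) / ((7 - 5 * x) * (x + 3 / 2))) by (field; lra).
    apply Rmult_le_reg_r with ((7 - 5 * x) * (x + 3 / 2)); [apply Rmult_lt_0_compat; lra |].
    replace ((17 / 25 - x) * (285 / 100 + 39 / 100 * x) / ((7 - 5 * x) * (x + 3 / 2)) *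
      ((7 - 5 * x) * (x + 3 / 2))) with ((17 / 25 - x) * (285 / 100 + 39 / 100 * x))
      by (field; lra).
    assert (E1 : 0 <= x ^ 2 * (x * (1 - x))) by (apply Rmult_le_pos; [apply pow2_ge_0 | nra]).
    assert (E2 : 0 <= 48 / 1000 - 4788 / 10000 * x + 2514 / 1000 * x ^ 2 - 206 / 100 * x ^ 3).
    { destruct (Rle_dec x (1 / 2)).
      - assert (0 <= x ^ 2 * (1 / 2 - x)) by (apply Rmult_le_pos; [apply pow2_ge_0 | lra]).
        assert (0 <= 48 / 1000 - 4788 / 10000 * x + 1484 / 1000 * x ^ 2) by nra.
        lra.
      - assert (0 <= (1 - x) * (16308 / 10000 - 3666 / 1000 * (1 - x) + 206 / 100 * (1 - x) ^ 2))
          by (apply Rmult_le_pos; nra).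
        lra. }
    nra. }
  assert (H7 := Rmult_le_compat_l C _ _ (Rlt_le _ _ HC) H6). lra.
Qed.

Lemma J_lt_3K (k : R) : 0 < k <= 9 / 4 -> J k < 3 * K k.
Proof.
  intros Hk. assert (HPI := PI_RGT_0).
  set (C := (17 / 25 + 3 / 2) / sqrt (17 / 25 * (3 + 17 / 25) + k)).
  assert (HC : 0 < C) by (apply Rdiv_lt_0_compat; [lra | apply sqrt_lt_R0; lra]).
  assert (H : RInt (fun a => C * (18 / 100 + - (192 / 1000) * sin a ^ 2 + - (2 / 10) * sin a ^ 4)) 0 (PI / 2)
    <= RInt (fun a => 3 * Kf k a + (-1) * Jf k a) 0 (PI / 2)).
  { apply RInt_le_cont.
    - lra.
    - intros. cont1; auto.
    - intros a. apply (continuous_plus (V := R_NormedModule) (fun a => 3 * Kf k a) (fun a => -1 * Jf k a));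
        apply (continuous_scal_r (V := R_NormedModule)).
      + apply continuous_Kf; lra.
      + apply continuous_Jf; lra.
    - intros a _. pose proof (Jf_lt_3Kf k a Hk) as H. cbv zeta in H. fold C in H.
      replace (sin a ^ 4) with ((sin a ^ 2) ^ 2) by ring. lra. }
  rewrite RInt_lin in H by (intros; (apply continuous_Kf || apply continuous_Jf); lra).
  rewrite RInt_mult_l in H by (intros; cont1; auto).
  rewrite RInt_sin_quadratic in H. fold (K k) (J k) in H.
  assert (0 < C * (PI / 2 * (18 / 100 + - (192 / 1000) / 2 + 3 * - (2 / 10) / 8)))
    by (apply Rmult_lt_0_compat; [exact HC |]; apply Rmult_lt_0_compat; lra).
  lra.
Qed.

(** * Level sets of the ratio of the two period integrals *)

Definition rho (k1 k x : R) : R := sqrt (x + k1) / sqrt (x + k).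

Lemma is_derive_rho (k1 k x : R) : 0 < x + k1 -> 0 < x + k ->
  is_derive (rho k1 k) x ((k - k1) / (2 * sqrt (x + k1) * (sqrt (x + k) * (x + k)))).
Proof.
  intros H1 H2. unfold rho.
  assert (S1 := sqrt_lt_R0 _ H1). assert (S2 := sqrt_lt_R0 _ H2).
  auto_derive.
  - repeat split; lra.
  - assert (E1 : sqrt (x + k1) * sqrt (x + k1) = x + k1) by (apply sqrt_sqrt; lra).
    assert (E2 : sqrt (x + k) * sqrt (x + k) = x + k) by (apply sqrt_sqrt; lra).
    transitivity ((sqrt (x + k) * sqrt (x + k) - sqrt (x + k1) * sqrt (x + k1)) /
      (2 * sqrt (x + k1) * (sqrt (x + k) * (sqrt (x + k) * sqrt (x + k))))).
    + field. lra.
    + rewrite E1, E2. f_equal. ring.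
Qed.

Lemma rho_mean_value (k1 k2 k3 x y : R) :
  0 < k1 < k2 -> k2 < k3 -> 0 <= x < y ->
  exists c, x < c < y /\ 0 < rho k1 k2 y - rho k1 k2 x /\
  rho k1 k3 y - rho k1 k3 x =
    (k3 - k1) / (k2 - k1) * (rho (k2) k3 c * ((c + k2) / (c + k3))) * (rho k1 k2 y - rho k1 k2 x).
Proof.
  intros Hk1 Hk2 Hxy.
  set (d := fun k t => (k - k1) / (2 * sqrt (t + k1) * (sqrt (t + k) * (t + k)))).
  assert (Hd : forall k t, k1 < k -> 0 <= t -> 0 < d k t).
  { intros k t Hk Ht. unfold d.
    assert (0 < sqrt (t + k1)) by (apply sqrt_lt_R0; lra).
    assert (0 < sqrt (t + k)) by (apply sqrt_lt_R0; lra).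
    apply Rdiv_lt_0_compat; [lra |]. repeat apply Rmult_lt_0_compat; lra. }
  assert (D : forall k t, k1 < k -> 0 <= t -> is_derive (rho k1 k) t (d k t)).
  { intros k t Hk Ht. apply is_derive_rho; lra. }
  assert (Hpos : 0 < rho k1 k2 y - rho k1 k2 x).
  { destruct (MVT_cor2 (rho k1 k2) (d k2) x y) as [c [Hc1 Hc2]]; [lra | |].
    - intros t Ht. apply is_derive_Reals, D; lra.
    - rewrite Hc1. apply Rmult_lt_0_compat; [apply Hd |]; lra. }
  set (u := rho k1 k2 y - rho k1 k2 x) in *. set (v := rho k1 k3 y - rho k1 k3 x).
  destruct (MVT_cor2 (fun t => v * rho k1 k2 t - u * rho k1 k3 t)
    (fun t => v * d k2 t - u * d k3 t) x y) as [c [Hc1 Hc2]]; [lra | |].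
  - intros t Ht. apply is_derive_Reals.
    apply (is_derive_minus (V := R_NormedModule) (fun t => v * rho k1 k2 t) (fun t => u * rho k1 k3 t)).
    + apply is_derive_scal, D; lra.
    + apply is_derive_scal, D; lra.
  - exists c. split; [exact Hc2 |]. split; [exact Hpos |].
    assert (E : v * d k2 c - u * d k3 c = 0).
    { apply Rmult_eq_reg_r with (y - x); [| lra]. rewrite <- Hc1. unfold u, v. ring. }
    assert (P2 : 0 < d k2 c) by (apply Hd; lra).
    apply Rmult_eq_reg_r with (d k2 c); [| lra].
    replace (v * d k2 c) with (u * d k3 c) by lra.
    unfold d, rho.
    assert (0 < sqrt (c + k1)) by (apply sqrt_lt_R0; lra).
    assert (0 < sqrt (c + k2)) by (apply sqrt_lt_R0; lra).
    assert (0 < sqrt (c + k3)) by (apply sqrt_lt_R0; lra).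
    field. repeat split; lra.
Qed.

(** [rho k1 k3] is a strictly convex function of [rho k1 k2]. *)
Lemma rho_convex (k1 k2 k3 x y z : R) :
  0 < k1 < k2 -> k2 < k3 -> 0 <= x < y -> y < z ->
  (rho k1 k3 y - rho k1 k3 x) * (rho k1 k2 z - rho k1 k2 y) <
  (rho k1 k3 z - rho k1 k3 y) * (rho k1 k2 y - rho k1 k2 x).
Proof.
  intros Hk1 Hk2 Hxy Hyz.
  destruct (rho_mean_value k1 k2 k3 x y) as [c [Hc [Hu Ec]]]; try lra.
  destruct (rho_mean_value k1 k2 k3 y z) as [d [Hd [Hv Ed]]]; try lra.
  rewrite Ec, Ed.
  set (u := rho k1 k2 y - rho k1 k2 x) in *. set (v := rho k1 k2 z - rho k1 k2 y) in *.
  assert (HL : rho k2 k3 c * ((c + k2) / (c + k3)) < rho k2 k3 d * ((d + k2) / (d + k3))).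
  { assert (Hr : (c + k2) / (c + k3) < (d + k2) / (d + k3)).
    { apply Rmult_lt_reg_r with ((c + k3) * (d + k3)); [apply Rmult_lt_0_compat; lra |].
      replace ((c + k2) / (c + k3) * ((c + k3) * (d + k3))) with ((c + k2) * (d + k3)) by (field; lra).
      replace ((d + k2) / (d + k3) * ((c + k3) * (d + k3))) with ((d + k2) * (c + k3)) by (field; lra).
      nra. }
    assert (H0 : 0 < (c + k2) / (c + k3)) by (apply Rdiv_lt_0_compat; lra).
    assert (Hrho : forall t, 0 < t -> rho k2 k3 t = sqrt ((t + k2) / (t + k3))).
    { intros t Ht. unfold rho. rewrite sqrt_div_alt; [reflexivity | lra]. }
    rewrite !Hrho by lra.
    apply Rmult_gt_0_lt_compat.
    - lra.
    - apply sqrt_lt_R0; lra.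
    - apply sqrt_lt_1; lra.
    - exact Hr. }
  assert (0 < (k3 - k1) / (k2 - k1)) by (apply Rdiv_lt_0_compat; lra).
  assert (0 < u * v) by (apply Rmult_lt_0_compat; lra).
  assert (HL2 := Rmult_lt_compat_l ((k3 - k1) / (k2 - k1)) _ _ H HL).
  nra.
Qed.

(** Multiplied by [sqrt (x + k1)], a combination becomes affine in [rho k1 k2] and
    [rho k1 k3], so by [rho_convex] the sign of the chord of one as a function of
    the other decides. *)
Lemma chebyshev_combination (k1 k2 k3 x1 x2 : R) :
  0 < k1 < k2 -> k2 < k3 -> 0 <= x1 < x2 ->
  exists a1 a2 a3, forall x, 0 <= x ->
  let h := a1 / sqrt (x + k1) + a2 / sqrt (x + k2) + a3 / sqrt (x + k3) in
  (x < x1 -> h < 0) /\ (x1 < x < x2 -> 0 < h) /\ (x2 < x -> h < 0).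
Proof.
  intros Hk1 Hk2 Hx.
  set (r2 := rho k1 k2). set (r3 := rho k1 k3).
  set (a2 := r3 x2 - r3 x1). set (a3 := - (r2 x2 - r2 x1)).
  exists (- (a2 * r2 x1 + a3 * r3 x1)), a2, a3. intros x Hx0 h.
  assert (S1 : 0 < sqrt (x + k1)) by (apply sqrt_lt_R0; lra).
  assert (S2 : 0 < sqrt (x + k2)) by (apply sqrt_lt_R0; lra).
  assert (S3 : 0 < sqrt (x + k3)) by (apply sqrt_lt_R0; lra).
  set (m := (r3 x2 - r3 x1) * (r2 x - r2 x1) - (r2 x2 - r2 x1) * (r3 x - r3 x1)).
  assert (Eh : h = m * / sqrt (x + k1)).
  { assert (R2 : r2 x = sqrt (x + k1) / sqrt (x + k2)) by reflexivity.
    assert (R3 : r3 x = sqrt (x + k1) / sqrt (x + k3)) by reflexivity.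
    unfold h, m, a2, a3. rewrite R2, R3. field. repeat split; lra. }
  assert (Si := Rinv_0_lt_compat _ S1). rewrite Eh.
  repeat split; intros Hc.
  - pose proof (rho_convex k1 k2 k3 x x1 x2 Hk1 Hk2) as Hconv. fold r2 r3 in Hconv.
    assert (m < 0) by (unfold m; specialize (Hconv ltac:(lra) ltac:(lra)); lra). nra.
  - pose proof (rho_convex k1 k2 k3 x1 x x2 Hk1 Hk2) as Hconv. fold r2 r3 in Hconv.
    assert (0 < m) by (unfold m; specialize (Hconv ltac:(lra) ltac:(lra)); lra). nra.
  - pose proof (rho_convex k1 k2 k3 x1 x2 x Hk1 Hk2) as Hconv. fold r2 r3 in Hconv.
    assert (m < 0) by (unfold m; specialize (Hconv ltac:(lra) ltac:(lra)); lra). nra.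
Qed.

Definition qf (a : R) : R := sin a ^ 2 * (3 + sin a ^ 2).

(** Part of [K] with [tan] below 1, in the variable of [J], in which the kernel
    [/ sqrt (qf a + k)] is the same for both integrals. *)
Definition K1f (k a : R) : R :=
  cos a / sqrt (4 + sin a ^ 2) / sqrt (3 + sin a ^ 2) / sqrt (qf a + k).

Lemma qf_ge_0 (a : R) : 0 <= qf a.
Proof. unfold qf. pose proof (sin2_bounds a). nra. Qed.

Lemma continuous_K1f (k a : R) : 0 < k -> continuous (K1f k) a.
Proof.
  intros Hk. pose proof (qf_ge_0 a) as Hq. pose proof (sin2_bounds a).
  unfold K1f, qf in *. cont1.
  repeat split; try lra; apply sqrt_neq_0; lra.
Qed.

Lemma Jf_factor (k a : R) : 0 < k -> Jf k a = / sqrt (3 + sin a ^ 2) / sqrt (qf a + k).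
Proof.
  intros Hk. pose proof (qf_ge_0 a). pose proof (sin2_bounds a). unfold Jf.
  fold (qf a). rewrite sqrt_mult by lra. field. split; apply sqrt_neq_0; lra.
Qed.

Lemma cos_atan_pow2 (x : R) : cos (atan x) ^ 2 = / (1 + x ^ 2).
Proof.
  rewrite cos_atan. unfold Rsqr.
  assert (0 < sqrt (1 + x * x)) by (apply sqrt_lt_R0; nra).
  replace ((1 / sqrt (1 + x * x)) ^ 2) with (/ (sqrt (1 + x * x) * sqrt (1 + x * x))) by (field; lra).
  rewrite sqrt_sqrt by nra. f_equal. ring.
Qed.

Lemma K_split (k : R) : 0 < k ->
  K k = RInt (K1f k) 0 (PI / 2) + RInt (Kf k) (PI / 4) (PI / 2).
Proof.
  intros Hk. unfold K. rewrite (RInt_split _ 0 (PI / 4)) by (intros; apply continuous_Kf; auto).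
  f_equal.
  replace 0 with (atan (sin 0)) at 1 by (rewrite sin_0; apply atan_0).
  replace (PI / 4) with (atan (sin (PI / 2))) by (rewrite sin_PI2; apply atan_1).
  rewrite <- (RInt_comp (V := R_CompleteNormedModule) (Kf k) (fun a => atan (sin a))
    (fun a => cos a / (1 + sin a ^ 2))).
  - apply RInt_ext. intros a _.
    change (cos a / (1 + sin a ^ 2) * Kf k (atan (sin a)) = K1f k a).
    assert (Hx := sin2_bounds a). assert (Hq := qf_ge_0 a).
    unfold Kf, K1f. unfold qf in *.
    replace (sin (atan (sin a)) ^ 4) with ((sin (atan (sin a)) ^ 2) ^ 2) by ring.
    replace (cos (atan (sin a)) ^ 4) with ((cos (atan (sin a)) ^ 2) ^ 2) by ring.
    replace (sin (atan (sin a)) ^ 2) with (1 - cos (atan (sin a)) ^ 2)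
      by (pose proof (cos2_plus_sin2 (atan (sin a))); lra).
    rewrite cos_atan_pow2. revert Hx Hq. generalize (sin a ^ 2). intros x Hx Hq.
    replace ((4 * / (1 + x) + (1 - / (1 + x))) * (3 * / (1 + x) + (1 - / (1 + x))) *
      (k * (/ (1 + x)) ^ 2 + 3 * / (1 + x) * (1 - / (1 + x)) + (1 - / (1 + x)) ^ 2)) with
      ((4 + x) * (3 + x) * (x * (3 + x) + k) * (/ (1 + x) ^ 2) ^ 2) by (field; lra).
    rewrite sqrt_mult_alt by (apply Rmult_le_pos; nra).
    rewrite sqrt_pow2 by (apply Rlt_le, Rinv_0_lt_compat; nra).
    rewrite !sqrt_mult by nra. field.
    repeat split; try lra; apply sqrt_neq_0; lra.
  - intros. apply continuous_Kf; auto.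
  - intros a _. assert (Hx := sin2_bounds a). split.
    + auto_derive; auto. field. nra.
    + cont1. nra.
Qed.

Lemma Kf_tan (k a : R) : 0 < k -> PI / 4 < a < PI / 2 ->
  let t := sin a ^ 2 / cos a ^ 2 in
  Kf k a = cos a ^ 2 / sqrt ((4 * cos a ^ 2 + sin a ^ 2) * (3 * cos a ^ 2 + sin a ^ 2)) / cos a ^ 2
    * / sqrt (t * (3 + t) + k) /\ 4 < t * (3 + t) /\
  0 < cos a ^ 2 / sqrt ((4 * cos a ^ 2 + sin a ^ 2) * (3 * cos a ^ 2 + sin a ^ 2)) / cos a ^ 2.
Proof.
  intros Hk Ha t.
  assert (Hc : 0 < cos a) by (apply cos_gt_0; lra).
  assert (Hsc : cos a < sin a).
  { rewrite <- sin_shift. apply sin_increasing_1; lra. }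
  assert (Hc2 : 0 < cos a ^ 2) by nra.
  assert (Ht : 1 < t).
  { unfold t. apply Rmult_lt_reg_r with (cos a ^ 2); auto. field_simplify; nra. }
  assert (P : 0 < (4 * cos a ^ 2 + sin a ^ 2) * (3 * cos a ^ 2 + sin a ^ 2))
    by (apply Rmult_lt_0_compat; nra).
  assert (Q : 0 < t * (3 + t) + k) by nra.
  split; [| split].
  - unfold Kf.
    replace ((4 * cos a ^ 2 + sin a ^ 2) * (3 * cos a ^ 2 + sin a ^ 2) *
      (k * cos a ^ 4 + 3 * cos a ^ 2 * sin a ^ 2 + sin a ^ 4)) with
      ((4 * cos a ^ 2 + sin a ^ 2) * (3 * cos a ^ 2 + sin a ^ 2) * ((t * (3 + t) + k) * (cos a ^ 2) ^ 2))
      by (unfold t; field; lra).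
    rewrite sqrt_mult by nra. rewrite (sqrt_mult (t * (3 + t) + k)) by nra.
    rewrite (sqrt_pow2 (cos a ^ 2)) by lra.
    field. repeat split; try lra; apply sqrt_neq_0; lra.
  - nra.
  - apply Rdiv_lt_0_compat; [apply Rdiv_lt_0_compat |]; auto. apply sqrt_lt_R0; auto.
Qed.

(** On the common variable [x] of the two kernels, the density of [A * J - B * K]
    changes sign at most twice, the second time at [x = 4] where the density of
    [J] stops. A Chebyshev combination of the values at three zeros, with the
    same sign changes, would be an integral of constant sign. *)
Lemma level_set_at_most_two (A B k1 k2 k3 : R) :
  0 < A -> 0 < B -> 0 < k1 < k2 -> k2 < k3 ->
  A * J k1 = B * K k1 -> A * J k2 = B * K k2 -> A * J k3 = B * K k3 -> False.
Proof.
  intros HA HB Hk1 Hk2 E1 E2 E3. assert (HPI := PI_RGT_0).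
  set (x0 := Rmax 0 ((B ^ 2 - 4 * A ^ 2) / (A ^ 2 + B ^ 2))).
  assert (HAB : 0 < A ^ 2 + B ^ 2) by nra.
  assert (Hx0 : 0 <= x0 < 1).
  { split; [apply Rmax_l |]. apply Rmax_lub_lt; [lra |].
    apply Rmult_lt_reg_r with (A ^ 2 + B ^ 2); auto. field_simplify; nra. }
  assert (Hbelow : forall x, 0 <= x < x0 -> A ^ 2 * (4 + x) < B ^ 2 * (1 - x)).
  { intros x Hx. unfold x0, Rmax in Hx. destruct Rle_dec as [Hl | Hl]; [| lra].
    assert (x * (A ^ 2 + B ^ 2) < B ^ 2 - 4 * A ^ 2).
    { replace (B ^ 2 - 4 * A ^ 2) with ((B ^ 2 - 4 * A ^ 2) / (A ^ 2 + B ^ 2) * (A ^ 2 + B ^ 2))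
        by (field; lra). apply Rmult_lt_compat_r; lra. }
    nra. }
  assert (Habove : forall x, x0 <= x -> B ^ 2 * (1 - x) <= A ^ 2 * (4 + x)).
  { intros x Hx. assert (Hm : (B ^ 2 - 4 * A ^ 2) / (A ^ 2 + B ^ 2) <= x)
      by (eapply Rle_trans; [apply Rmax_r | exact Hx]).
    assert (B ^ 2 - 4 * A ^ 2 <= x * (A ^ 2 + B ^ 2)).
    { replace (B ^ 2 - 4 * A ^ 2) with ((B ^ 2 - 4 * A ^ 2) / (A ^ 2 + B ^ 2) * (A ^ 2 + B ^ 2))
        by (field; lra). apply Rmult_le_compat_r; lra. }
    nra. }
  destruct (chebyshev_combination k1 k2 k3 (x0 * (3 + x0)) 4) as [a1 [a2 [a3 Hh]]]; auto.
  { split; nra. }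
  set (h := fun x => a1 / sqrt (x + k1) + a2 / sqrt (x + k2) + a3 / sqrt (x + k3)).
  assert (CJ : forall k, 0 < k -> forall a, continuous (Jf k) a) by (intros; apply continuous_Jf; auto).
  assert (CK : forall k, 0 < k -> forall a, continuous (Kf k) a) by (intros; apply continuous_Kf; auto).
  assert (C1 : forall k, 0 < k -> forall a, continuous (K1f k) a) by (intros; apply continuous_K1f; auto).
  assert (Clin : forall u v f g, (forall x, continuous f x) -> (forall x, continuous g x) ->
    forall x : R, continuous (fun t : R => u * f t + v * g t) x).
  { intros u v f g Hf Hg x.
    apply (continuous_plus (V := R_NormedModule) (fun t => u * f t) (fun t => v * g t));
    apply (continuous_scal_r (V := R_NormedModule)); auto. }
  set (I k a := A * Jf k a + - B * K1f k a).
  assert (CI : forall k, 0 < k -> forall a, continuous (I k) a) by (intros; apply Clin; auto).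
  assert (EI : forall k, 0 < k -> RInt (I k) 0 (PI / 2) =
     A * J k - B * K k + B * RInt (Kf k) (PI / 4) (PI / 2)).
  { intros k Hk. unfold I. rewrite RInt_lin; auto. rewrite (K_split k Hk). fold (J k). eqR. ring. }
  assert (Hin : 0 <= RInt (fun a => 1 * (a1 * I k1 a + a2 * I k2 a) + a3 * I k3 a) 0 (PI / 2)).
  { replace 0 with (RInt (fun _ : R => 0) 0 (PI / 2)) at 1
      by (rewrite RInt_const; apply Rmult_0_r).
    apply RInt_le_cont.
    - lra.
    - intros; apply continuous_const.
    - apply (Clin 1 a3 (fun a => a1 * I k1 a + a2 * I k2 a)); [apply Clin |]; apply CI; lra.
    - intros a Ha. assert (Hs := sin2_strict a Ha).
      assert (Hc : 0 < cos a) by (apply cos_gt_0; lra).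
      assert (Hc2 := cos2_plus_sin2 a).
      set (g := A - B * (cos a / sqrt (4 + sin a ^ 2))).
      replace (1 * (a1 * I k1 a + a2 * I k2 a) + a3 * I k3 a)
        with (g * h (qf a) * / sqrt (3 + sin a ^ 2)).
      2: { unfold I, g, h, K1f. rewrite !Jf_factor by lra. pose proof (qf_ge_0 a).
           field. repeat split; apply sqrt_neq_0; lra. }
      apply Rmult_le_pos; [| apply Rlt_le, Rinv_0_lt_compat, sqrt_lt_R0; lra].
      destruct (Hh (qf a) (qf_ge_0 a)) as [N1 [N2 N3]]. fold (h (qf a)) in N1, N2, N3.
      assert (S4 : 0 < sqrt (4 + sin a ^ 2)) by (apply sqrt_lt_R0; lra).
      assert (Eg : g * sqrt (4 + sin a ^ 2) = A * sqrt (4 + sin a ^ 2) - B * cos a)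
        by (unfold g; field; lra).
      assert (Ssq : sqrt (4 + sin a ^ 2) ^ 2 = 4 + sin a ^ 2) by (apply pow2_sqrt; lra).
      destruct (Rtotal_order (sin a ^ 2) x0) as [Hl | [He | Hg]].
      + assert (h (qf a) < 0) by (apply N1; unfold qf; nra).
        assert (Hb := Hbelow _ (conj (Rlt_le _ _ (proj1 Hs)) Hl)).
        assert (A * sqrt (4 + sin a ^ 2) < B * cos a).
        { apply Rsqr_incrst_0; unfold Rsqr; nra. }
        assert (g < 0) by nra. nra.
      + assert (Hb := Habove (sin a ^ 2) ltac:(lra)).
        assert (g = 0).
        { assert (Hx0p : x0 = (B ^ 2 - 4 * A ^ 2) / (A ^ 2 + B ^ 2)).
          { unfold x0, Rmax in *. destruct Rle_dec; lra. }
          assert (Eq : A ^ 2 * (4 + sin a ^ 2) = B ^ 2 * (1 - sin a ^ 2))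
            by (rewrite He, Hx0p; field; lra).
          assert (A * sqrt (4 + sin a ^ 2) = B * cos a).
          { apply Rsqr_inj; unfold Rsqr; nra. }
          apply Rmult_eq_reg_r with (sqrt (4 + sin a ^ 2)); lra. }
        rewrite H. lra.
      + assert (0 < h (qf a)) by (apply N2; unfold qf; nra).
        assert (Hb := Habove (sin a ^ 2) ltac:(lra)).
        assert (B * cos a <= A * sqrt (4 + sin a ^ 2)).
        { apply Rsqr_incr_0; unfold Rsqr; nra. }
        assert (0 <= g) by nra. nra. }
  assert (Hout : 0 < RInt (fun a => -1 * (a1 * Kf k1 a + a2 * Kf k2 a) + - a3 * Kf k3 a) (PI / 4) (PI / 2)).
  { apply RInt_pos_cont.
    - lra.
    - apply (Clin (-1) (- a3) (fun a => a1 * Kf k1 a + a2 * Kf k2 a)); [apply Clin |]; apply CK; lra.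
    - intros a Ha.
      destruct (Kf_tan k1 a ltac:(lra) Ha) as [F1 [Ht Hp]].
      destruct (Kf_tan k2 a ltac:(lra) Ha) as [F2 _].
      destruct (Kf_tan k3 a ltac:(lra) Ha) as [F3 _].
      rewrite F1, F2, F3. clear F1 F2 F3.
      set (t := sin a ^ 2 / cos a ^ 2) in *. revert Hp.
      generalize (cos a ^ 2 / sqrt ((4 * cos a ^ 2 + sin a ^ 2) * (3 * cos a ^ 2 + sin a ^ 2)) / cos a ^ 2).
      intros w Hw.
      destruct (Hh (t * (3 + t)) ltac:(lra)) as [_ [_ N3]].
      fold (h (t * (3 + t))) in N3. specialize (N3 Ht). unfold h in N3. unfold Rdiv in N3. nra. }
  rewrite RInt_lin in Hin.
  2: apply Clin; apply CI; lra.
  2: apply CI; lra.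
  rewrite RInt_lin in Hin by (apply CI; lra).
  rewrite !EI in Hin by lra.
  rewrite RInt_lin in Hout.
  2: apply Clin; apply CK; lra.
  2: apply CK; lra.
  rewrite RInt_lin in Hout by (apply CK; lra).
  rewrite E1, E2, E3 in Hin. nra.
Qed.

(** * Uniqueness for the initial value problem, and the homoclinic solution *)

Ltac splits := repeat match goal with |- _ /\ _ => split end.

(** The derivatives are separate functions so that an explicit solution can be
    given together with closed forms of its derivatives. *)
Definition first_order_solution (p : R) (f1 g1 f2 g2 : R -> R) : Prop :=
  (forall y, is_derive f1 y (g1 y)) /\
  (forall y, is_derive f2 y (g2 y)) /\
  (forall y, is_derive g1 y ((1 - 2 * f1 y ^ 2 - 8 * f2 y ^ 2) * f1 y)) /\
  (forall y, is_derive g2 y ((4 - 2 * f1 y ^ 2 - 8 * f2 y ^ 2) * f2 y)) /\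
  f1 0 = 0 /\ f2 0 = p /\ g1 0 = 2 * p /\ g2 0 = 0.

Lemma ivp_first_order (p : R) (f1 f2 : R -> R) :
  ivp_solution p f1 f2 -> first_order_solution p f1 (Derive f1) f2 (Derive f2).
Proof.
  intros H. destruct H. unfold first_order_solution. splits; auto; intros y; apply Derive_correct; auto.
Qed.

Lemma is_derive_continuity_pt (f : R -> R) (x l : R) : is_derive f x l -> continuity_pt f x.
Proof.
  intros H. apply continuity_pt_filterlim.
  apply (ex_derive_continuous (V := R_NormedModule) f). exists l; auto.
Qed.

(** [N t * exp (- C * t)] decreases to the right of 0 and [N t * exp (C * t)]
    increases to its left. *)
Lemma gronwall_zero (N dN : R -> R) (T C : R) :
  (forall y, is_derive N y (dN y)) -> (forall y, Rabs y <= T -> Rabs (dN y) <= C * N y) ->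
  N 0 = 0 -> (forall y, 0 <= N y) -> forall y, Rabs y <= T -> N y = 0.
Proof.
  intros HN HC H0 Hpos y Hy.
  assert (HD : forall c t, is_derive (fun t => N t * exp (c * t)) t ((dN t + c * N t) * exp (c * t))).
  { intros c t. auto_derive.
    - exists (dN t); auto.
    - rewrite (is_derive_unique (fun x : R => N x) _ _ (HN t)). ring. }
  assert (Hle : N y <= 0).
  { destruct (Rle_dec 0 y) as [Hs | Hs].
    - destruct (MVT_gen (fun t => N t * exp (- C * t)) 0 y (fun t => (dN t + - C * N t) * exp (- C * t)))
        as [c [Hc1 Hc2]].
      + intros; apply HD.
      + intros t _. exact (is_derive_continuity_pt _ _ _ (HD (- C) t)).
      + rewrite Rmin_left, Rmax_right in Hc1 by lra.
        assert (Hb := HC c). rewrite (Rabs_pos_eq c) in Hb by lra.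
        rewrite (Rabs_pos_eq y) in Hy by lra. specialize (Hb ltac:(lra)).
        apply Rabs_le_between in Hb.
        assert (P := exp_pos (- C * c)). assert (P2 := exp_pos (- C * y)).
        rewrite H0 in Hc2.
        assert (0 <= - (dN c + - C * N c) * exp (- C * c) * (y - 0)).
        { apply Rmult_le_pos; [apply Rmult_le_pos |]; lra. }
        destruct (Rle_dec (N y) 0) as [|n]; auto. apply Rnot_le_lt in n.
        assert (0 < N y * exp (- C * y)) by (apply Rmult_lt_0_compat; auto). lra.
    - apply Rnot_le_lt in Hs.
      destruct (MVT_gen (fun t => N t * exp (C * t)) 0 y (fun t => (dN t + C * N t) * exp (C * t)))
        as [c [Hc1 Hc2]].
      + intros; apply HD.
      + intros t _. exact (is_derive_continuity_pt _ _ _ (HD C t)).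
      + rewrite Rmin_right, Rmax_left in Hc1 by lra.
        assert (Hb := HC c). rewrite (Rabs_left1 c) in Hb by lra.
        rewrite (Rabs_left1 y) in Hy by lra. specialize (Hb ltac:(lra)).
        apply Rabs_le_between in Hb.
        assert (P := exp_pos (C * c)). assert (P2 := exp_pos (C * y)).
        rewrite H0 in Hc2.
        assert (0 <= (dN c + C * N c) * exp (C * c) * (0 - y)).
        { apply Rmult_le_pos; [apply Rmult_le_pos |]; lra. }
        destruct (Rle_dec (N y) 0) as [|n]; auto. apply Rnot_le_lt in n.
        assert (0 < N y * exp (C * y)) by (apply Rmult_lt_0_compat; auto). lra. }
  specialize (Hpos y). lra.
Qed.

Lemma Rabs_mult_le_sum (a b c d : R) :
  (Rabs a + Rabs b) * (Rabs c + Rabs d) <= a ^ 2 + b ^ 2 + c ^ 2 + d ^ 2.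
Proof.
  rewrite <- (pow2_abs a), <- (pow2_abs b), <- (pow2_abs c), <- (pow2_abs d).
  generalize (Rabs a) (Rabs b) (Rabs c) (Rabs d). intros x y z t.
  pose proof (pow2_ge_0 (x + y - z - t)). pose proof (pow2_ge_0 (x - y)). pose proof (pow2_ge_0 (z - t)). nra.
Qed.

(** One statement for both equations: [u] is [u1] with [c = 1], or [u2] with
    [c = 4]. *)
Lemma cubic_lipschitz (c u1 u2 v1 v2 u v B : R) :
  0 <= c <= 4 -> u1 ^ 2 + u2 ^ 2 + v1 ^ 2 + v2 ^ 2 <= B -> v ^ 2 <= B ->
  Rabs (u - v) <= Rabs (u1 - v1) + Rabs (u2 - v2) ->
  Rabs ((c - 2 * u1 ^ 2 - 8 * u2 ^ 2) * u - (c - 2 * v1 ^ 2 - 8 * v2 ^ 2) * v) <=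
  (4 + 30 * B) * (Rabs (u1 - v1) + Rabs (u2 - v2)).
Proof.
  intros Hc HB Hv Hu.
  replace ((c - 2 * u1 ^ 2 - 8 * u2 ^ 2) * u - (c - 2 * v1 ^ 2 - 8 * v2 ^ 2) * v) with
    ((c - 2 * u1 ^ 2 - 8 * u2 ^ 2) * (u - v) +
     (- 2 * v * (u1 + v1)) * (u1 - v1) + (- 8 * v * (u2 + v2)) * (u2 - v2)) by ring.
  eapply Rle_trans; [apply Rabs_triang |].
  eapply Rle_trans; [apply Rplus_le_compat_r, Rabs_triang |].
  rewrite !(Rabs_mult _ (_ - _)).
  assert (A1 : Rabs (c - 2 * u1 ^ 2 - 8 * u2 ^ 2) <= 4 + 8 * B).
  { apply Rabs_le. pose proof (pow2_ge_0 u1). pose proof (pow2_ge_0 u2).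
    pose proof (pow2_ge_0 v1). pose proof (pow2_ge_0 v2). split; lra. }
  assert (A2 : Rabs (- 2 * v * (u1 + v1)) <= 4 * B).
  { apply Rabs_le. pose proof (pow2_ge_0 (v - (u1 + v1))). pose proof (pow2_ge_0 (v + (u1 + v1))).
    pose proof (pow2_ge_0 (u1 - v1)). pose proof (pow2_ge_0 u2). pose proof (pow2_ge_0 v2). split; nra. }
  assert (A3 : Rabs (- 8 * v * (u2 + v2)) <= 16 * B).
  { apply Rabs_le. pose proof (pow2_ge_0 (v - (u2 + v2))). pose proof (pow2_ge_0 (v + (u2 + v2))).
    pose proof (pow2_ge_0 (u2 - v2)). pose proof (pow2_ge_0 u1). pose proof (pow2_ge_0 v1). split; nra. }
  assert (P1 := Rabs_pos (u1 - v1)). assert (P2 := Rabs_pos (u2 - v2)). assert (P := Rabs_pos (u - v)).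
  assert (HB0 : 0 <= B) by (pose proof (pow2_ge_0 v); lra).
  assert (M1 := Rmult_le_compat _ _ _ _ (Rabs_pos _) P A1 Hu).
  assert (M2 := Rmult_le_compat_r _ _ _ P1 A2).
  assert (M3 := Rmult_le_compat_r _ _ _ P2 A3).
  nra.
Qed.

Lemma first_order_unique (p : R) (f1 g1 f2 g2 F1 G1 F2 G2 : R -> R) :
  first_order_solution p f1 g1 f2 g2 -> first_order_solution p F1 G1 F2 G2 ->
  forall y, f1 y = F1 y /\ f2 y = F2 y.
Proof.
  intros [d1 [d2 [e1 [e2 [i1 [i2 [j1 j2]]]]]]] [D1 [D2 [E1 [E2 [I1 [I2 [J1 J2]]]]]]] y.
  set (T := Rabs y + 1).
  set (N t := (f1 t - F1 t) ^ 2 + (f2 t - F2 t) ^ 2 + (g1 t - G1 t) ^ 2 + (g2 t - G2 t) ^ 2).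
  set (r1 t := (1 - 2 * f1 t ^ 2 - 8 * f2 t ^ 2) * f1 t - (1 - 2 * F1 t ^ 2 - 8 * F2 t ^ 2) * F1 t).
  set (r2 t := (4 - 2 * f1 t ^ 2 - 8 * f2 t ^ 2) * f2 t - (4 - 2 * F1 t ^ 2 - 8 * F2 t ^ 2) * F2 t).
  set (dN t := 2 * (f1 t - F1 t) * (g1 t - G1 t) + 2 * (f2 t - F2 t) * (g2 t - G2 t) +
     2 * (g1 t - G1 t) * r1 t + 2 * (g2 t - G2 t) * r2 t).
  assert (HN : forall t, is_derive N t (dN t)).
  { intros t. unfold N. auto_derive.
    - splits; auto; eexists; eauto.
    - rewrite (is_derive_unique (fun x : R => f1 x) _ _ (d1 t)), (is_derive_unique (fun x : R => f2 x) _ _ (d2 t)),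
        (is_derive_unique (fun x : R => g1 x) _ _ (e1 t)), (is_derive_unique (fun x : R => g2 x) _ _ (e2 t)),
        (is_derive_unique (fun x : R => F1 x) _ _ (D1 t)), (is_derive_unique (fun x : R => F2 x) _ _ (D2 t)),
        (is_derive_unique (fun x : R => G1 x) _ _ (E1 t)), (is_derive_unique (fun x : R => G2 x) _ _ (E2 t)).
      unfold dN, r1, r2. ring. }
  destruct (continuity_ab_maj (fun t => f1 t ^ 2 + f2 t ^ 2 + F1 t ^ 2 + F2 t ^ 2) (- T) T) as [tm [Htm _]].
  { unfold T. pose proof (Rabs_pos y). lra. }
  { intros t _. apply continuity_pt_filterlim.
    apply (ex_derive_continuous (V := R_NormedModule) (fun t => f1 t ^ 2 + f2 t ^ 2 + F1 t ^ 2 + F2 t ^ 2)).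
    auto_derive. splits; auto; eexists; eauto. }
  set (B := f1 tm ^ 2 + f2 tm ^ 2 + F1 tm ^ 2 + F2 tm ^ 2) in Htm.
  assert (HNy : N y = 0).
  { apply (gronwall_zero N dN T (1 + 2 * (4 + 30 * B))); auto.
    - intros t Ht. apply Rabs_le_between in Ht. specialize (Htm t Ht).
      assert (L1 : Rabs (r1 t) <= (4 + 30 * B) * (Rabs (f1 t - F1 t) + Rabs (f2 t - F2 t))).
      { apply cubic_lipschitz; try lra.
        - pose proof (pow2_ge_0 (f1 t)); pose proof (pow2_ge_0 (f2 t)); pose proof (pow2_ge_0 (F2 t)); lra.
        - pose proof (Rabs_pos (f2 t - F2 t)); lra. }
      assert (L2 : Rabs (r2 t) <= (4 + 30 * B) * (Rabs (f1 t - F1 t) + Rabs (f2 t - F2 t))).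
      { apply cubic_lipschitz; try lra.
        - pose proof (pow2_ge_0 (f1 t)); pose proof (pow2_ge_0 (f2 t)); pose proof (pow2_ge_0 (F1 t)); lra.
        - pose proof (Rabs_pos (f1 t - F1 t)); lra. }
      assert (M := Rabs_mult_le_sum (g1 t - G1 t) (g2 t - G2 t) (f1 t - F1 t) (f2 t - F2 t)).
      assert (HB0 : 0 <= B).
      { unfold B. pose proof (pow2_ge_0 (f1 tm)); pose proof (pow2_ge_0 (f2 tm));
        pose proof (pow2_ge_0 (F1 tm)); pose proof (pow2_ge_0 (F2 tm)); lra. }
      assert (Hd : Rabs (2 * (f1 t - F1 t) * (g1 t - G1 t) + 2 * (f2 t - F2 t) * (g2 t - G2 t)) <= N t).
      { apply Rabs_le. unfold N.
        generalize (f1 t - F1 t) (f2 t - F2 t) (g1 t - G1 t) (g2 t - G2 t). intros a b c d.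
        pose proof (pow2_ge_0 (a - c)). pose proof (pow2_ge_0 (a + c)).
        pose proof (pow2_ge_0 (b - d)). pose proof (pow2_ge_0 (b + d)). split; lra. }
      unfold dN. rewrite !Rplus_assoc. rewrite <- Rplus_assoc.
      eapply Rle_trans; [apply Rabs_triang |].
      eapply Rle_trans; [apply Rplus_le_compat_l, Rabs_triang |].
      rewrite !(Rabs_mult (2 * _) (r1 t)), !(Rabs_mult (2 * _) (r2 t)), !(Rabs_mult 2).
      rewrite (Rabs_pos_eq 2) by lra.
      assert (Q1 := Rmult_le_compat_l _ _ _ (Rabs_pos (g1 t - G1 t)) L1).
      assert (Q2 := Rmult_le_compat_l _ _ _ (Rabs_pos (g2 t - G2 t)) L2).
      assert (M' : (4 + 30 * B) * ((Rabs (g1 t - G1 t) + Rabs (g2 t - G2 t)) *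
        (Rabs (f1 t - F1 t) + Rabs (f2 t - F2 t))) <= (4 + 30 * B) * N t).
      { apply Rmult_le_compat_l; [lra |]. unfold N. lra. }
      clear - Hd Q1 Q2 M'. nra.
    - unfold N. rewrite i1, i2, j1, j2, I1, I2, J1, J2. ring.
    - intros t. unfold N. pose proof (pow2_ge_0 (f1 t - F1 t)). pose proof (pow2_ge_0 (f2 t - F2 t)).
      pose proof (pow2_ge_0 (g1 t - G1 t)). pose proof (pow2_ge_0 (g2 t - G2 t)). lra.
    - unfold T. lra. }
  unfold N in HNy.
  pose proof (pow2_ge_0 (f1 y - F1 y)). pose proof (pow2_ge_0 (f2 y - F2 y)).
  pose proof (pow2_ge_0 (g1 y - G1 y)). pose proof (pow2_ge_0 (g2 y - G2 y)).
  split; apply Rminus_diag_uniq; apply Rsqr_0_uniq; unfold Rsqr; lra.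
Qed.

(** At [p = sqrt 3 / 2] the potential [2 * f1 ^ 2 + 8 * f2 ^ 2] is the
    reflectionless [6 / cosh ^ 2], with bound states at 1 and 4. *)
Lemma homoclinic_solution :
  first_order_solution (sqrt 3 / 2)
    (fun y => sqrt 3 * sinh y / cosh y ^ 2) (fun y => sqrt 3 * (2 - cosh y ^ 2) / cosh y ^ 3)
    (fun y => sqrt 3 / 2 / cosh y ^ 2) (fun y => - sqrt 3 * sinh y / cosh y ^ 3).
Proof.
  assert (Hs : forall y, is_derive sinh y (cosh y))
    by (intros; apply is_derive_Reals, derivable_pt_lim_sinh).
  assert (Hc : forall y, is_derive cosh y (sinh y))
    by (intros; apply is_derive_Reals, derivable_pt_lim_cosh).
  assert (Hpos : forall y, cosh y <> 0).
  { intros y. unfold cosh. pose proof (exp_pos y). pose proof (exp_pos (- y)). lra. }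
  assert (Hcs : forall y, sinh y ^ 2 = cosh y ^ 2 - 1).
  { intros y. unfold cosh, sinh. assert (E : exp y * exp (- y) = 1)
      by (rewrite <- exp_plus, Rplus_opp_r; apply exp_0).
    replace (((exp y + exp (- y)) / 2) ^ 2 - 1) with
      (((exp y + exp (- y)) / 2) ^ 2 - exp y * exp (- y)) by (rewrite E; ring). field. }
  assert (Hs3 : sqrt 3 ^ 2 = 3) by (apply pow2_sqrt; lra).
  unfold first_order_solution. splits.
  1-4: intros y; specialize (Hpos y); specialize (Hcs y);
    auto_derive;
    [ splits; auto; try (eexists; eauto);
      rewrite ?Rmult_1_r; repeat (exact Hpos || apply Rmult_integral_contrapositive_currified)
    | rewrite ?(is_derive_unique (fun x : R => sinh x) _ _ (Hs y)), ?(is_derive_unique (fun x : R => cosh x) _ _ (Hc y));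
      revert Hpos Hcs Hs3; generalize (sinh y) (cosh y) (sqrt 3); intros s c r Hp Hsc Hr;
      field_simplify_eq; [| auto]; replace (r ^ 3) with (r * r ^ 2) by ring;
      replace (s ^ 3) with (s * s ^ 2) by ring; rewrite ?Hr, ?Hsc; ring ].
  - rewrite sinh_0. unfold Rdiv. ring.
  - rewrite cosh_0. field.
  - rewrite cosh_0. field.
  - rewrite sinh_0. unfold Rdiv. ring.
Qed.

Lemma cosh_ge_exp (y : R) : exp y / 2 <= cosh y.
Proof. unfold cosh. pose proof (exp_pos (- y)). lra. Qed.

Lemma is_lim_exp_decay (f : R -> R) (C : R) :
  (forall y, 0 <= y -> Rabs (f y) <= C * exp (- y)) -> is_lim f p_infty 0.
Proof.
  intros H.
  assert (L : forall c, is_lim (fun y => c * exp (- y)) p_infty 0).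
  { intros c. replace (Finite 0) with (Rbar_mult c 0) by (simpl; f_equal; ring).
    apply is_lim_scal_l.
    apply (is_lim_comp exp Ropp p_infty 0 m_infty).
    - apply is_lim_exp_m.
    - apply (is_lim_opp (fun y => y) p_infty p_infty). apply is_lim_id.
    - exists 0. intros. discriminate. }
  apply (is_lim_le_le_loc (fun y => - C * exp (- y)) (fun y => C * exp (- y))); auto.
  exists 0. intros y Hy. specialize (H y ltac:(lra)). apply Rabs_le_between in H. lra.
Qed.

Lemma homoclinic_case (f1 f2 : R -> R) :
  ivp_solution (sqrt 3 / 2) f1 f2 ->
  is_lim f1 p_infty 0 /\ is_lim f2 p_infty 0 /\ ~ periodic f1 f2.
Proof.
  intros Hsol.
  assert (U := first_order_unique _ _ _ _ _ _ _ _ _ (ivp_first_order _ _ _ Hsol) homoclinic_solution).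
  assert (S3 : 0 < sqrt 3) by (apply sqrt_lt_R0; lra).
  assert (C1 : forall y, 1 <= cosh y).
  { intros y. unfold cosh. assert (E : exp y * exp (- y) = 1)
      by (rewrite <- exp_plus, Rplus_opp_r; apply exp_0).
    pose proof (exp_pos y). pose proof (exp_pos (- y)).
    pose proof (pow2_ge_0 (exp y - exp (- y))). nra. }
  assert (Hdec : forall y, / cosh y <= 2 * exp (- y)).
  { intros y. rewrite exp_Ropp. replace (2 * / exp y) with (/ (exp y / 2))
      by (field; pose proof (exp_pos y); lra).
    apply Rinv_le_contravar; [pose proof (exp_pos y); lra | apply cosh_ge_exp]. }
  assert (Hi : forall y, 0 < / cosh y <= 1).
  { intros y. specialize (C1 y). split; [apply Rinv_0_lt_compat; lra |].
    rewrite <- Rinv_1. apply Rinv_le_contravar; lra. }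
  split; [| split].
  - apply (is_lim_exp_decay _ (2 * sqrt 3)). intros y Hy. rewrite (proj1 (U y)).
    specialize (C1 y). specialize (Hdec y). specialize (Hi y).
    assert (Hsh : Rabs (sinh y) <= cosh y).
    { unfold sinh, cosh. pose proof (exp_pos y). pose proof (exp_pos (- y)). apply Rabs_le. lra. }
    replace (sqrt 3 * sinh y / cosh y ^ 2) with (sqrt 3 * / cosh y * (sinh y * / cosh y)) by (field; lra).
    rewrite Rabs_mult, Rabs_pos_eq by (apply Rmult_le_pos; lra).
    rewrite Rabs_mult, (Rabs_pos_eq (/ cosh y)) by lra.
    assert (Rabs (sinh y) * / cosh y <= 1).
    { replace 1 with (cosh y * / cosh y) by (field; lra). apply Rmult_le_compat_r; lra. }
    assert (0 <= sqrt 3 * / cosh y) by (apply Rmult_le_pos; lra).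
    assert (sqrt 3 * / cosh y <= sqrt 3 * (2 * exp (- y))) by (apply Rmult_le_compat_l; lra).
    nra.
  - apply (is_lim_exp_decay _ (2 * sqrt 3)). intros y Hy. rewrite (proj2 (U y)).
    specialize (C1 y). specialize (Hdec y). specialize (Hi y).
    replace (sqrt 3 / 2 / cosh y ^ 2) with (sqrt 3 / 2 * (/ cosh y * / cosh y)) by (field; lra).
    rewrite Rabs_pos_eq by (apply Rmult_le_pos; nra).
    assert (/ cosh y * / cosh y <= / cosh y) by nra.
    assert (sqrt 3 / 2 * (/ cosh y * / cosh y) <= sqrt 3 / 2 * (2 * exp (- y)))
      by (apply Rmult_le_compat_l; lra).
    pose proof (exp_pos (- y)). nra.
  - intros [T [HT Hp]]. specialize (Hp 0). unfold pair_fun in Hp.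
    injection Hp as _ Hp. rewrite !(proj2 (U _)), Rplus_0_l, cosh_0 in Hp.
    assert (Hc : cosh T ^ 2 = 1).
    { specialize (C1 T). apply Rmult_eq_reg_l with (sqrt 3 / 2 / cosh T ^ 2).
      - rewrite Hp at 2. field. nra.
      - apply Rgt_not_eq. apply Rdiv_lt_0_compat; nra. }
    assert (1 < cosh T).
    { unfold cosh. assert (E : exp T * exp (- T) = 1)
        by (rewrite <- exp_plus, Rplus_opp_r; apply exp_0).
      assert (1 < exp T) by (rewrite <- exp_0; apply exp_increasing; auto).
      assert (0 < (exp T - 1) ^ 2) by nra.
      assert (0 < exp (- T)) by apply exp_pos. nra. }
    nra.
Qed.

(** * Flows that separate after a change of time *)

Lemma is_derive_cont (f : R -> R) (x l : R) : is_derive f x l -> continuous f x.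
Proof.
  intros H. apply (ex_derive_continuous (V := R_NormedModule) f). exists l; auto.
Qed.

Lemma mean_value (F dF : R -> R) (x y : R) :
  (forall t, is_derive F t (dF t)) ->
  exists c, Rmin x y <= c <= Rmax x y /\ F y - F x = dF c * (y - x).
Proof.
  intros HF. apply (MVT_gen F x y dF); intros; auto.
  exact (is_derive_continuity_pt _ _ _ (HF x0)).
Qed.

Lemma increment_ge (F dF : R -> R) (d x y : R) :
  (forall t, is_derive F t (dF t)) -> (forall t, d <= dF t) -> x <= y -> d * (y - x) <= F y - F x.
Proof.
  intros HF Hd Hxy. destruct (mean_value F dF x y HF) as [c [_ ->]].
  apply Rmult_le_compat_r; [lra | auto].
Qed.

Lemma increment_abs_le (F dF : R -> R) (C x y : R) :
  (forall t, is_derive F t (dF t)) -> (forall t, Rabs (dF t) <= C) ->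
  Rabs (F y - F x) <= C * Rabs (y - x).
Proof.
  intros HF Hd. destruct (mean_value F dF x y HF) as [c [_ ->]].
  rewrite Rabs_mult. apply Rmult_le_compat_r; [apply Rabs_pos | auto].
Qed.

Lemma eq_of_same_derive (F G dF : R -> R) :
  (forall t, is_derive F t (dF t)) -> (forall t, is_derive G t (dF t)) -> F 0 = G 0 ->
  forall x, F x = G x.
Proof.
  intros HF HG H0 x.
  destruct (mean_value (fun t => F t - G t) (fun t => dF t - dF t) 0 x) as [c [_ Hc]].
  - intros t. apply (is_derive_minus (V := R_NormedModule) F G); auto.
  - rewrite Rminus_eq_0, Rmult_0_l in Hc. lra.
Qed.

Lemma bijection_of_derive_ge (F dF : R -> R) (d : R) :
  0 < d -> (forall t, is_derive F t (dF t)) -> (forall t, d <= dF t) ->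
  (forall t, continuous dF t) ->
  exists G, (forall x, G (F x) = x) /\ (forall y, F (G y) = y) /\
    (forall y, is_derive G y (/ dF (G y))).
Proof.
  intros Hd HF Hge Hcont.
  assert (Hinj : forall x y, F x = F y -> x = y).
  { intros x y E. destruct (Rtotal_order x y) as [H | [H | H]]; auto; exfalso.
    - pose proof (increment_ge F dF d x y HF Hge ltac:(lra)).
      assert (0 < d * (y - x)) by (apply Rmult_lt_0_compat; lra). lra.
    - pose proof (increment_ge F dF d y x HF Hge ltac:(lra)).
      assert (0 < d * (x - y)) by (apply Rmult_lt_0_compat; lra). lra. }
  assert (Hsurj : forall y, { x | F x = y }).
  { intros y. set (r := (Rabs (y - F 0)) / d).
    assert (Hr : d * r = Rabs (y - F 0)) by (unfold r; field; lra).
    assert (Hr0 : 0 <= r) by (apply Rdiv_le_0_compat; [apply Rabs_pos | auto]).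
    destruct (IVT_gen F (- r) r y) as [x [_ Hx]].
    - intros t. exact (is_derive_continuity_pt _ _ _ (HF t)).
    - pose proof (increment_ge F dF d (- r) 0 HF Hge ltac:(lra)).
      pose proof (increment_ge F dF d 0 r HF Hge ltac:(lra)).
      pose proof (Rle_abs (y - F 0)). pose proof (Rle_abs (- (y - F 0))) as Hn.
      rewrite Rabs_Ropp in Hn.
      rewrite Rmin_left, Rmax_right by lra. lra.
    - exists x. exact Hx. }
  set (G y := proj1_sig (Hsurj y)).
  assert (FG : forall y, F (G y) = y) by (intros y; apply (proj2_sig (Hsurj y))).
  assert (GF : forall x, G (F x) = x) by (intros x; apply Hinj, FG).
  exists G. split; [exact GF |]. split; [exact FG |].
  assert (GL : forall y z, d * Rabs (G z - G y) <= Rabs (z - y)).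
  { intros y z. rewrite <- (FG z) at 2. rewrite <- (FG y) at 2.
    destruct (Rle_dec (G y) (G z)) as [H | H].
    - rewrite !Rabs_pos_eq.
      + apply (increment_ge F dF); auto.
      + pose proof (increment_ge F dF d _ _ HF Hge H).
        assert (0 <= d * (G z - G y)) by (apply Rmult_le_pos; lra). lra.
      + lra.
    - rewrite (Rabs_minus_sym (G z)), (Rabs_minus_sym (F (G z))), !Rabs_pos_eq.
      + apply (increment_ge F dF); auto. lra.
      + pose proof (increment_ge F dF d (G z) (G y) HF Hge ltac:(lra)).
        assert (0 <= d * (G y - G z)) by (apply Rmult_le_pos; lra). lra.
      + lra. }
  intros y. apply is_derive_Reals. intros eps Heps.
  assert (Hi : continuous (fun t => / dF t) (G y)).
  { apply (continuous_comp dF Rinv); auto. apply continuous_Rinv. specialize (Hge (G y)). lra. }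
  apply filterlim_locally with (eps := mkposreal eps Heps) in Hi. destruct Hi as [del Hdel].
  assert (Hdd : 0 < d * del) by (apply Rmult_lt_0_compat; [auto | apply cond_pos]).
  exists (mkposreal _ Hdd). intros h Hh Hhd. simpl in Hhd.
  destruct (mean_value F dF (G y) (G (y + h)) HF) as [c [Hc1 Hc2]].
  rewrite !FG in Hc2.
  assert (Hp : 0 < dF c) by (specialize (Hge c); lra).
  replace ((G (y + h) - G y) / h) with (/ dF c).
  2: { assert (Eh : h = dF c * (G (y + h) - G y)) by lra.
       assert (Hne : G (y + h) - G y <> 0) by (intros E; rewrite E, Rmult_0_r in Eh; auto).
       rewrite Eh at 2. field. split; lra. }
  change (Rabs (/ dF c - / dF (G y)) < eps).
  apply (Hdel c). change (Rabs (c - G y) < del).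
  assert (GL1 := GL y (y + h)).
  assert (Hb : Rabs (G (y + h) - G y) < del).
  { apply Rmult_lt_reg_l with d; auto. replace (y + h - y) with h in GL1 by ring. lra. }
  apply Rle_lt_trans with (Rabs (G (y + h) - G y)); auto.
  unfold Rmin, Rmax in Hc1. destruct Rle_dec; unfold Rabs; repeat destruct Rcase_abs; lra.
Qed.

(** Solving the autonomous equation [a' = f a] amounts to inverting the travel
    time [RInt (/ f) 0]. *)
Lemma angle_flow (f : R -> R) (M : R) :
  (forall x, continuous f x) -> (forall x, 0 < f x <= M) ->
  exists a, (forall t, is_derive a t (f (a t))) /\
    (forall t, RInt (fun x => / f x) 0 (a t) = t) /\ (forall x, a (RInt (fun x => / f x) 0 x) = x).
Proof.
  intros Hc Hf.
  assert (Hci : forall x, continuous (fun x => / f x) x).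
  { intros x. apply (continuous_comp f Rinv); auto. apply continuous_Rinv. specialize (Hf x). lra. }
  assert (HM : 0 < M) by (specialize (Hf 0); lra).
  destruct (bijection_of_derive_ge (fun x => RInt (fun x => / f x) 0 x) (fun x => / f x) (/ M))
    as [a [H1 [H2 H3]]]; auto.
  - apply Rinv_0_lt_compat; auto.
  - intros x. apply (is_derive_RInt_cont (fun x => / f x)). auto.
  - intros x. specialize (Hf x). apply Rinv_le_contravar; lra.
  - exists a. splits; auto. intros t. rewrite <- (Rinv_inv (f (a t))). apply H3.
Qed.

Lemma RInt_periodic (f : R -> R) (L x : R) :
  (forall x, continuous f x) -> (forall x, f (x + L) = f x) ->
  RInt f 0 (x + L) = RInt f 0 x + RInt f 0 L.
Proof.
  intros Hc Hp.
  apply (eq_of_same_derive (fun x => RInt f 0 (x + L)) (fun x => RInt f 0 x + RInt f 0 L) f).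
  - intros t. replace (f t) with (1 * f (t + L)) by (rewrite Hp; ring).
    apply (is_derive_comp (fun z => RInt f 0 z) (fun t => t + L)).
    + apply (is_derive_RInt_cont f); auto.
    + auto_derive; auto; ring.
  - intros t. replace (f t) with (f t + 0) by ring.
    apply (is_derive_plus (V := R_NormedModule) (fun z => RInt f 0 z) (fun _ => RInt f 0 L)).
    + apply (is_derive_RInt_cont f); auto.
    + apply (is_derive_const (V := R_NormedModule)).
  - pose proof (RInt_point (V := R_CompleteNormedModule) 0 f) as E. change (RInt f 0 0 = 0) in E.
    rewrite E, Rplus_0_l. symmetry. apply Rplus_0_l.
Qed.

(** The joint motion [x' = f1 x / (m2 y - m1 x)], [y' = f2 y / (m2 y - m1 x)] of
    two angles, solved by a change of time: in the time [t] the angles [a] and [b]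
    evolve independently, [Y] is the original time as a function of [t], and [th]
    is the inverse of [Y]. *)
Set Implicit Arguments.
Record separated (f1 f2 m1 m2 : R -> R) (d C : R) (a b Y th : R -> R) : Prop := {
  sep_d : 0 < d;
  sep_f1 : forall x, continuous f1 x;
  sep_f2 : forall x, continuous f2 x;
  sep_f1_pos : forall x, 0 < f1 x;
  sep_f2_pos : forall x, 0 < f2 x;
  sep_m1 : forall x, continuous m1 x;
  sep_m2 : forall x, continuous m2 x;
  sep_m1_bound : forall x, Rabs (m1 x) <= C;
  sep_gap : forall x y, m1 x + d <= m2 y;
  sep_a : forall t, is_derive a t (f1 (a t));
  sep_b : forall t, is_derive b t (f2 (b t));
  sep_Aa : forall t, RInt (fun x => / f1 x) 0 (a t) = t;
  sep_aA : forall x, a (RInt (fun x => / f1 x) 0 x) = x;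
  sep_Bb : forall t, RInt (fun x => / f2 x) 0 (b t) = t;
  sep_bB : forall x, b (RInt (fun x => / f2 x) 0 x) = x;
  sep_Y : forall t, is_derive Y t (m2 (b t) - m1 (a t));
  sep_Y0 : Y 0 = 0;
  sep_thY : forall t, th (Y t) = t;
  sep_Yth : forall y, Y (th y) = y;
  sep_th : forall y, is_derive th y (/ (m2 (b (th y)) - m1 (a (th y))))
}.
Unset Implicit Arguments.

Lemma separated_exists (f1 f2 m1 m2 : R -> R) (d C M : R) :
  0 < d -> (forall x, continuous f1 x) -> (forall x, continuous f2 x) ->
  (forall x, 0 < f1 x <= M) -> (forall x, 0 < f2 x <= M) ->
  (forall x, continuous m1 x) -> (forall x, continuous m2 x) ->
  (forall x, Rabs (m1 x) <= C) -> (forall x y, m1 x + d <= m2 y) ->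
  exists a b Y th, separated f1 f2 m1 m2 d C a b Y th.
Proof.
  intros Hd c1 c2 p1 p2 n1 n2 HC Hgap.
  destruct (angle_flow f1 M c1 p1) as [a [Ha [Aa aA]]].
  destruct (angle_flow f2 M c2 p2) as [b [Hb [Bb bB]]].
  set (D t := m2 (b t) - m1 (a t)).
  assert (HD : forall t, continuous D t).
  { intros t. apply (continuous_minus (V := R_NormedModule) (fun t => m2 (b t)) (fun t => m1 (a t))).
    - apply (continuous_comp b m2); auto. exact (is_derive_cont _ _ _ (Hb t)).
    - apply (continuous_comp a m1); auto. exact (is_derive_cont _ _ _ (Ha t)). }
  destruct (bijection_of_derive_ge (fun t => RInt D 0 t) D d) as [th [H1 [H2 H3]]]; auto.
  - intros t. apply (is_derive_RInt_cont D); auto.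
  - intros t. unfold D. specialize (Hgap (a t) (b t)). lra.
  - exists a, b, (fun t => RInt D 0 t), th. constructor; auto.
    + intros x; apply p1.
    + intros x; apply p2.
    + intros t. apply (is_derive_RInt_cont D); auto.
    + apply (RInt_point (V := R_CompleteNormedModule)).
Qed.

Lemma inv_continuous (f : R -> R) :
  (forall x, continuous f x) -> (forall x, 0 < f x) -> forall x, continuous (fun x => / f x) x.
Proof.
  intros Hc Hp x. apply (continuous_comp f Rinv); auto. apply continuous_Rinv.
  specialize (Hp x). lra.
Qed.

Section separated_facts.
Context {f1 f2 m1 m2 : R -> R} {d C : R} {a b Y th : R -> R}
  (HS : separated f1 f2 m1 m2 d C a b Y th).

Lemma sep_a0 : a 0 = 0.
Proof.
  rewrite <- (sep_aA HS 0) at 2. rewrite (RInt_point (V := R_CompleteNormedModule)).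
  reflexivity.
Qed.

Lemma sep_b0 : b 0 = 0.
Proof.
  rewrite <- (sep_bB HS 0) at 2. rewrite (RInt_point (V := R_CompleteNormedModule)).
  reflexivity.
Qed.

Lemma sep_th0 : th 0 = 0.
Proof.
  rewrite <- (sep_Y0 HS) at 1. apply (sep_thY HS).
Qed.

Lemma sep_a_shift (L t : R) : (forall x, f1 (x + L) = f1 x) ->
  a (t + RInt (fun x => / f1 x) 0 L) = a t + L.
Proof.
  intros Hp. rewrite <- (sep_Aa HS t) at 1.
  rewrite <- RInt_periodic.
  - apply (sep_aA HS).
  - apply inv_continuous; [apply (sep_f1 HS) | apply (sep_f1_pos HS)].
  - intros x. rewrite Hp. reflexivity.
Qed.

Lemma sep_b_shift (L t : R) : (forall x, f2 (x + L) = f2 x) ->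
  b (t + RInt (fun x => / f2 x) 0 L) = b t + L.
Proof.
  intros Hp. rewrite <- (sep_Bb HS t) at 1.
  rewrite <- RInt_periodic.
  - apply (sep_bB HS).
  - apply inv_continuous; [apply (sep_f2 HS) | apply (sep_f2_pos HS)].
  - intros x. rewrite Hp. reflexivity.
Qed.

Lemma sep_a_increasing (s t : R) : s < t -> a s < a t.
Proof.
  intros Hst. destruct (MVT_cor2 a (fun t => f1 (a t)) s t Hst) as [c [Hc _]].
  - intros c _. apply is_derive_Reals, (sep_a HS).
  - pose proof (sep_f1_pos HS (a c)).
    assert (0 < f1 (a c) * (t - s)) by (apply Rmult_lt_0_compat; lra). lra.
Qed.

Lemma sep_Y_increment (s t : R) : s <= t -> d * (t - s) <= Y t - Y s.
Proof.
  apply (increment_ge Y (fun t => m2 (b t) - m1 (a t))).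
  - apply (sep_Y HS).
  - intros r. pose proof (sep_gap HS (a r) (b r)). lra.
Qed.

Lemma sep_Y_increasing (s t : R) : s < t -> Y s < Y t.
Proof.
  intros H. pose proof (sep_Y_increment s t ltac:(lra)).
  pose proof (sep_d HS).
  assert (0 < d * (t - s)) by (apply Rmult_lt_0_compat; lra). lra.
Qed.

(** The hypotheses make the speed of [Y] periodic. *)
Lemma sep_Y_shift (S t : R) :
  (forall r, m1 (a (r + S)) = m1 (a r)) -> (forall r, m2 (b (r + S)) = m2 (b r)) ->
  Y (t + S) = Y t + Y S.
Proof.
  intros H1 H2.
  assert (HY := sep_Y HS).
  apply (eq_of_same_derive (fun t => Y (t + S)) (fun t => Y t + Y S) (fun t => m2 (b t) - m1 (a t))).
  - intros r. rewrite <- H1, <- H2.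
    replace (m2 (b (r + S)) - m1 (a (r + S))) with (1 * (m2 (b (r + S)) - m1 (a (r + S)))) by ring.
    apply (is_derive_comp Y (fun t => t + S)); auto. auto_derive; auto; ring.
  - intros r. replace (m2 (b r) - m1 (a r)) with (m2 (b r) - m1 (a r) + 0) by ring.
    apply (is_derive_plus (V := R_NormedModule) Y (fun _ => Y S)); auto.
    apply (is_derive_const (V := R_NormedModule)).
  - rewrite Rplus_0_l, (sep_Y0 HS). ring.
Qed.

(** The flow is linear in the coordinates [t1 = A a - B b] and
    [t2 = N2 b - N1 a], where [A], [B] are the travel times and [N1], [N2] the two
    parts of [Y]: [t1] is constant and [t2] grows at unit speed. The gap between
    [m1] and [m2] makes these coordinates a homeomorphism of the plane, mapping
    the lattice of periods of the angles to a lattice. *)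
Lemma separated_quasi_periodic (P1 P2 : R -> R -> R) (L : R) :
  0 < L ->
  (forall x, f1 (x + L) = f1 x) -> (forall x, f2 (x + L) = f2 x) ->
  (forall x, m1 (x + L) = m1 x) -> (forall x, m2 (x + L) = m2 x) ->
  (forall x y, continuity_2d_pt P1 x y) -> (forall x y, continuity_2d_pt P2 x y) ->
  (forall x y, P1 (x + L) y = P1 x y) -> (forall x y, P1 x (y + L) = P1 x y) ->
  (forall x y, P2 (x + L) y = P2 x y) -> (forall x y, P2 x (y + L) = P2 x y) ->
  quasi_periodic (fun y => P1 (a (th y)) (b (th y))) (fun y => P2 (a (th y)) (b (th y))).
Proof.
  intros HL pf1 pf2 pm1 pm2 cP1 cP2 P1a P1b P2a P2b.
  pose proof HS as [Hd cf1 cf2 Hf1 Hf2 cm1 cm2 HC Hgap Ha Hb HAa HaA HBb HbB HY HY0 HthY HYth Hth].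
  assert (ca : forall t, continuous a t) by (intros t; exact (is_derive_cont _ _ _ (Ha t))).
  assert (cb : forall t, continuous b t) by (intros t; exact (is_derive_cont _ _ _ (Hb t))).
  set (n1 t := m1 (a t)). set (n2 t := m2 (b t)).
  assert (cn1 : forall t, continuous n1 t) by (intros t; apply (continuous_comp a m1); auto).
  assert (cn2 : forall t, continuous n2 t) by (intros t; apply (continuous_comp b m2); auto).
  set (N1 t := RInt n1 0 t). set (N2 t := RInt n2 0 t).
  assert (dN1 : forall t, is_derive N1 t (n1 t)) by (intros; apply (is_derive_RInt_cont n1); auto).
  assert (dN2 : forall t, is_derive N2 t (n2 t)) by (intros; apply (is_derive_RInt_cont n2); auto).
  set (S := RInt (fun x => / f1 x) 0 L). set (V := RInt (fun x => / f2 x) 0 L).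
  assert (aS : forall t, a (t + S) = a t + L) by (intros; apply sep_a_shift; auto).
  assert (bV : forall t, b (t + V) = b t + L) by (intros; apply sep_b_shift; auto).
  assert (HSpos : 0 < S).
  { apply RInt_pos_cont; auto. apply inv_continuous; auto. intros; apply Rinv_0_lt_compat; auto. }
  assert (HVpos : 0 < V).
  { apply RInt_pos_cont; auto. apply inv_continuous; auto. intros; apply Rinv_0_lt_compat; auto. }
  set (y1 := N1 S). set (y2 := N2 V).
  assert (N1S : forall t, N1 (t + S) = N1 t + y1).
  { intros t. apply RInt_periodic; auto. intros x. unfold n1. rewrite aS. auto. }
  assert (N2V : forall t, N2 (t + V) = N2 t + y2).
  { intros t. apply RInt_periodic; auto. intros x. unfold n2. rewrite bV. auto. }
  assert (N10 : N1 0 = 0) by apply (RInt_point (V := R_CompleteNormedModule)).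
  assert (N20 : N2 0 = 0) by apply (RInt_point (V := R_CompleteNormedModule)).
  assert (YN : forall t, Y t = N2 t - N1 t).
  { apply (eq_of_same_derive Y (fun t => N2 t - N1 t) (fun t => n2 t - n1 t)).
    - exact HY.
    - intros t. apply (is_derive_minus (V := R_NormedModule) N2 N1); auto.
    - rewrite HY0, N10, N20. ring. }
  assert (HDelta : 0 < y2 * S - y1 * V).
  { assert (Hz : forall z, y1 / S + d <= m2 z).
    { intros z.
      pose proof (increment_ge (fun t => - N1 t) (fun t => - n1 t) (- (m2 z - d)) 0 S) as H.
      specialize (H (fun t => is_derive_opp N1 t _ (dN1 t))).
      assert (Hn : forall t, - (m2 z - d) <= - n1 t)
        by (intros t; unfold n1; specialize (Hgap (a t) z); lra).
      specialize (H Hn ltac:(lra)). cbv beta in H. rewrite N10 in H. fold y1 in H.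
      apply Rmult_le_reg_r with S; auto. field_simplify; lra. }
    pose proof (increment_ge N2 n2 (y1 / S + d) 0 V dN2 (fun t => Hz (b t)) ltac:(lra)) as H.
    rewrite N20 in H. fold y2 in H.
    assert (H' := Rmult_le_compat_r S _ _ (Rlt_le _ _ HSpos) H).
    assert (0 < d * V * S) by (apply Rmult_lt_0_compat; [apply Rmult_lt_0_compat |]; auto).
    replace ((y1 / S + d) * (V - 0) * S) with (y1 * V + d * V * S) in H' by (field; lra). lra. }
  assert (Hsig : exists sig : R -> R -> R, forall t1 t2, N2 (sig t1 t2) - N1 (sig t1 t2 + t1) = t2).
  { apply (choice (fun t1 (s : R -> R) => forall t2, N2 (s t2) - N1 (s t2 + t1) = t2)).
    intros t1.
    destruct (bijection_of_derive_ge (fun s => N2 s - N1 (s + t1)) (fun s => n2 s - n1 (s + t1)) d)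
      as [G [_ [HG _]]]; auto.
    - intros s. apply (is_derive_minus (V := R_NormedModule) N2 (fun s => N1 (s + t1))); auto.
      replace (n1 (s + t1)) with (1 * n1 (s + t1)) by ring.
      apply (is_derive_comp N1 (fun s => s + t1)); auto. auto_derive; auto; ring.
    - intros s. unfold n1, n2. specialize (Hgap (a (s + t1)) (b s)). lra.
    - intros s. apply (continuous_minus (V := R_NormedModule) n2 (fun s => n1 (s + t1))); auto.
      apply (continuous_comp (fun s => s + t1) n1); auto.
      apply (continuous_plus (V := R_NormedModule)); [apply continuous_id | apply continuous_const].
    - exists G. exact HG. }
  destruct Hsig as [sig Hsig].
  assert (Hmono : forall t1 s s', s <= s' ->
    d * (s' - s) <= (N2 s' - N1 (s' + t1)) - (N2 s - N1 (s + t1))).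
  { intros t1 s s' Hs.
    apply (increment_ge (fun s => N2 s - N1 (s + t1)) (fun s => n2 s - n1 (s + t1))); auto.
    - intros r. apply (is_derive_minus (V := R_NormedModule) N2 (fun s => N1 (s + t1))); auto.
      replace (n1 (r + t1)) with (1 * n1 (r + t1)) by ring.
      apply (is_derive_comp N1 (fun s => s + t1)); auto. auto_derive; auto; ring.
    - intros r. unfold n1, n2. specialize (Hgap (a (r + t1)) (b r)). lra. }
  assert (Hlip1 : forall t1 t2 t1' t2', sig t1' t2' <= sig t1 t2 ->
     d * (sig t1 t2 - sig t1' t2') <= Rabs (t2 - t2') + C * Rabs (t1 - t1')).
  { intros t1 t2 t1' t2' Hs. pose proof (Hmono t1 _ _ Hs) as H. rewrite Hsig in H.
    pose proof (Hsig t1' t2') as E.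
    pose proof (increment_abs_le N1 n1 C (sig t1' t2' + t1') (sig t1' t2' + t1) dN1
      (fun t => HC (a t))) as Hi.
    replace (sig t1' t2' + t1 - (sig t1' t2' + t1')) with (t1 - t1') in Hi by ring.
    pose proof (Rle_abs (t2 - t2')). 
    pose proof (Rle_abs (N1 (sig t1' t2' + t1) - N1 (sig t1' t2' + t1'))). lra. }
  assert (Hlip : forall t1 t2 t1' t2',
     d * Rabs (sig t1 t2 - sig t1' t2') <= Rabs (t2 - t2') + C * Rabs (t1 - t1')).
  { intros t1 t2 t1' t2'. destruct (Rle_dec (sig t1' t2') (sig t1 t2)) as [H | H].
    - rewrite Rabs_pos_eq by lra. apply Hlip1; auto.
    - rewrite Rabs_minus_sym, Rabs_pos_eq by lra.
      rewrite (Rabs_minus_sym t2), (Rabs_minus_sym t1). apply Hlip1; lra. }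
  assert (Huniq : forall t1 t2 s, N2 s - N1 (s + t1) = t2 -> sig t1 t2 = s).
  { intros t1 t2 s E. pose proof (Hsig t1 t2) as E'.
    destruct (Rle_dec s (sig t1 t2)) as [H | H].
    - pose proof (Hmono t1 _ _ H). nra.
    - pose proof (Hmono t1 (sig t1 t2) s ltac:(lra)). nra. }
  assert (HC0 : 0 <= C) by (eapply Rle_trans; [apply Rabs_pos | apply (HC 0)]).
  set (T1 := fun z : R * R => S * fst z + - V * snd z).
  set (T2 := fun z : R * R => - y1 * fst z + y2 * snd z).
  assert (cfst : forall z : R * R, continuous (fun z : R * R => fst z) z).
  { intros z. intros Q [e He]. exists e. intros y [Hy _]. apply He. exact Hy. }
  assert (csnd : forall z : R * R, continuous (fun z : R * R => snd z) z).
  { intros z. intros Q [e He]. exists e. intros y [_ Hy]. apply He. exact Hy. }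
  assert (clin : forall (u v : R) (z : R * R), continuous (fun z : R * R => u * fst z + v * snd z) z).
  { intros u v z.
    apply (continuous_plus (V := R_NormedModule) (fun z : R * R => u * fst z) (fun z => v * snd z));
      apply (continuous_scal_r (V := R_NormedModule)); auto. }
  set (sg := fun z : R * R => sig (T1 z) (T2 z)).
  assert (csg : forall z : R * R, continuous sg z).
  { intros z. apply filterlim_locally. intros eps.
    set (e := d * eps / (2 * (1 + C))).
    assert (He : 0 < e).
    { apply Rdiv_lt_0_compat; [apply Rmult_lt_0_compat; [auto | apply cond_pos] | lra]. }
    assert (L1 := proj1 (filterlim_locally _ _) (clin S (- V) z) (mkposreal e He)).
    assert (L2 := proj1 (filterlim_locally _ _) (clin (- y1) y2 z) (mkposreal e He)).
    generalize (filter_and _ _ L1 L2). apply filter_imp. intros w [W1 W2].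
    change (Rabs (T1 w - T1 z) < e) in W1. change (Rabs (T2 w - T2 z) < e) in W2.
    change (Rabs (sg w - sg z) < eps).
    apply Rmult_lt_reg_l with d; auto. eapply Rle_lt_trans; [apply Hlip |].
    assert (C * Rabs (T1 w - T1 z) <= C * e) by (apply Rmult_le_compat_l; lra).
    replace (d * eps) with (2 * (1 + C) * e) by (unfold e; field; lra). nra. }
  assert (cu : forall z : R * R, continuous (fun z => a (sg z + T1 z)) z).
  { intros z. apply (continuous_comp (fun z => sg z + T1 z) a); auto.
    apply (continuous_plus (V := R_NormedModule) sg T1); auto. apply clin. }
  assert (cv : forall z : R * R, continuous (fun z => b (sg z)) z).
  { intros z. apply (continuous_comp sg b); auto. }
  assert (cP : forall P : R -> R -> R, (forall x y, continuity_2d_pt P x y) ->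
     forall z : R * R, continuous (fun z => P (a (sg z + T1 z)) (b (sg z))) z).
  { intros P HP z.
    apply (continuous_comp_2 (fun z => a (sg z + T1 z)) (fun z => b (sg z)) P); auto.
    apply continuity_2d_pt_filterlim. auto. }
  exists (fun z => (P1 (a (sg z + T1 z)) (b (sg z)), P2 (a (sg z + T1 z)) (b (sg z)))),
    (V / (y2 * S - y1 * V)), (S / (y2 * S - y1 * V)).
  split; [| split; [| split]].
  - intros z. apply filterlim_locally. intros eps.
    assert (L1 := proj1 (filterlim_locally _ _) (cP P1 cP1 z) eps).
    assert (L2 := proj1 (filterlim_locally _ _) (cP P2 cP2 z) eps).
    generalize (filter_and _ _ L1 L2). apply filter_imp. intros w [W1 W2]. split; auto.
  - intros s t.
    assert (E1 : T1 (s + 1, t) = T1 (s, t) + S) by (unfold T1; simpl; ring).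
    assert (E2 : sg (s + 1, t) = sg (s, t)).
    { unfold sg. apply Huniq. rewrite E1, <- Rplus_assoc, N1S.
      pose proof (Hsig (T1 (s, t)) (T2 (s, t))).
      replace (T2 (s + 1, t)) with (T2 (s, t) - y1) by (unfold T2; simpl; ring). lra. }
    rewrite E1, E2, <- Rplus_assoc, aS, P1a, P2a. reflexivity.
  - intros s t.
    assert (E1 : T1 (s, t + 1) = T1 (s, t) - V) by (unfold T1; simpl; ring).
    assert (E2 : sg (s, t + 1) = sg (s, t) + V).
    { unfold sg. apply Huniq. rewrite E1.
      replace (sig (T1 (s, t)) (T2 (s, t)) + V + (T1 (s, t) - V))
        with (sig (T1 (s, t)) (T2 (s, t)) + T1 (s, t)) by ring.
      rewrite N2V. pose proof (Hsig (T1 (s, t)) (T2 (s, t))).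
      replace (T2 (s, t + 1)) with (T2 (s, t) + y2) by (unfold T2; simpl; ring). lra. }
    rewrite E1, E2, bV, P1b, P2b.
    replace (sg (s, t) + V + (T1 (s, t) - V)) with (sg (s, t) + T1 (s, t)) by ring. reflexivity.
  - intros y.
    set (z := (V / (y2 * S - y1 * V) * y, S / (y2 * S - y1 * V) * y)).
    assert (E1 : T1 z = 0) by (unfold T1, z; simpl; field; lra).
    assert (E2 : T2 z = y) by (unfold T2, z; simpl; field; lra).
    assert (E3 : sg z = th y).
    { unfold sg. rewrite E1, E2. apply Huniq. rewrite Rplus_0_r, <- YN. apply HYth. }
    rewrite E3, E1, Rplus_0_r. reflexivity.
Qed.

End separated_facts.

(** * The solution in elliptic coordinates *)

Ltac derive_all :=
  repeat match goal with
  | H : forall t, is_derive ?f t _ |- context [Derive (fun x : R => ?f x) ?t] =>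
      rewrite (is_derive_unique (fun x : R => f x) _ _ (H t))
  end.

(** The solution has components [u (th y)] with [u] known in the separated time.
    Their second derivative in [y] involves that of [u] only through the numerator
    [n] of the first, and the equation to check becomes one without denominators. *)
Lemma second_order_change_of_time (u n dn D dD th : R -> R) (q : R -> R) :
  (forall t, is_derive u t (n t)) -> (forall t, is_derive n t (dn t)) ->
  (forall t, is_derive D t (dD t)) -> (forall t, 0 < D t) ->
  (forall y, is_derive th y (/ D (th y))) ->
  (forall t, dn t * D t - n t * dD t = q t * u t * D t ^ 3) ->
  forall y, is_derive (fun y => u (th y)) y (n (th y) / D (th y)) /\
    is_derive (fun y => n (th y) / D (th y)) y (q (th y) * u (th y)).
Proof.
  intros Hu Hn HD Hpos Hth Hq y. split.
  - apply (is_derive_ext (fun y => u (th y))); auto.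
    replace (n (th y) / D (th y)) with (/ D (th y) * n (th y)) by (unfold Rdiv; ring).
    apply (is_derive_comp u th); auto.
  - specialize (Hpos (th y)). specialize (Hq (th y)).
    replace (q (th y) * u (th y)) with
      (/ D (th y) * ((dn (th y) * D (th y) - n (th y) * dD (th y)) / D (th y) ^ 2))
      by (rewrite Hq; field; lra).
    apply (is_derive_comp (fun t => n t / D t) th); auto.
    apply is_derive_div; auto. lra.
Qed.

(** The regime [b < 3]. Here [s], [c] are the sine and cosine of the first angle,
    [x = mu1], [z = mu2], [N] is [(2 * b - 3) * sin * cos] of the second angle, and
    the other functions are square roots of factors of the quintic at [x] and [z].
    Their derivatives are polynomial in one another, so that the equations of
    motion become polynomial identities modulo the values of the squares. *)
Lemma low_regime_core (k : R) (s c X Z M Y G N x z : R -> R) :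
  (forall t, is_derive s t (c t * Y t * G t)) ->
  (forall t, is_derive c t (- s t * Y t * G t)) ->
  (forall t, is_derive X t (N t * Z t * M t)) ->
  (forall t, is_derive Z t (- N t * X t * M t)) ->
  (forall t, is_derive M t (N t * X t * Z t)) ->
  (forall t, is_derive Y t (s t * c t * G t)) ->
  (forall t, is_derive G t (s t * c t * Y t * (2 * s t ^ 2 + 3))) ->
  (forall t, is_derive N t ((5 - 2 * z t) * X t * Z t * M t)) ->
  (forall t, is_derive x t (- 2 * s t * c t * Y t * G t)) ->
  (forall t, is_derive z t (2 * N t * X t * Z t * M t)) ->
  (forall t, s t ^ 2 = 1 - x t) -> (forall t, c t ^ 2 = x t) ->
  (forall t, X t ^ 2 = z t - 1) -> (forall t, Z t ^ 2 = 4 - z t) -> (forall t, M t ^ 2 = z t) ->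
  (forall t, Y t ^ 2 = 4 - x t) -> (forall t, G t ^ 2 = x t ^ 2 - 5 * x t + 4 + k) ->
  (forall t, N t ^ 2 = 5 * z t - z t ^ 2 - 4 - k) ->
  forall th, (forall t, 0 < z t - x t) -> (forall y, is_derive th y (/ (z (th y) - x (th y)))) ->
  let n1 t := c t * Y t * G t * X t + s t * N t * Z t * M t in
  let n2 t := s t * c t * G t * Z t - N t * X t * M t * Y t in
  forall y,
  (is_derive (fun y => s (th y) * X (th y)) y (n1 (th y) / (z (th y) - x (th y))) /\
   is_derive (fun y => n1 (th y) / (z (th y) - x (th y))) y
     ((2 * (x (th y) + z (th y)) - 9) * (s (th y) * X (th y)))) /\
  (is_derive (fun y => Y (th y) * Z (th y)) y (n2 (th y) / (z (th y) - x (th y))) /\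
   is_derive (fun y => n2 (th y) / (z (th y) - x (th y))) y
     ((2 * (x (th y) + z (th y)) - 6) * (Y (th y) * Z (th y)))).
Proof.
  intros ds dc dX dZ dM dY dG dN dx dz rs rc rX rZ rM rY rG rN th Hpos Hth n1 n2 y.
  assert (dD : forall t, is_derive (fun t => z t - x t) t
    (2 * N t * X t * Z t * M t + 2 * s t * c t * Y t * G t)).
  { intros t. auto_derive; [splits; auto; eexists; eauto | derive_all; ring]. }
  split.
  - apply (second_order_change_of_time (fun t => s t * X t) n1
      (fun t => s t * X t * (- Y t ^ 2 * G t ^ 2 + c t ^ 2 * G t ^ 2 + c t ^ 2 * Y t ^ 2 * (2 * s t ^ 2 + 3)
         + (5 - 2 * z t) * Z t ^ 2 * M t ^ 2 - N t ^ 2 * M t ^ 2 + N t ^ 2 * Z t ^ 2)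
         + 2 * (c t * Y t * G t * N t * Z t * M t))
      (fun t => z t - x t) (fun t => 2 * N t * X t * Z t * M t + 2 * s t * c t * Y t * G t) th
      (fun t => 2 * (x t + z t) - 9)); auto.
    + intros t. auto_derive; [splits; auto; eexists; eauto | derive_all; unfold n1; ring].
    + intros t. unfold n1. auto_derive; [splits; auto; eexists; eauto | derive_all; ring].
    + intros t. unfold n1.
      transitivity (c t * Y t * G t * N t * Z t * M t * (2 * (z t - x t) - 2 * X t ^ 2 - 2 * s t ^ 2) +
        s t * X t * ((- Y t ^ 2 * G t ^ 2 + c t ^ 2 * G t ^ 2 + c t ^ 2 * Y t ^ 2 * (2 * s t ^ 2 + 3)
         + (5 - 2 * z t) * Z t ^ 2 * M t ^ 2 - N t ^ 2 * M t ^ 2 + N t ^ 2 * Z t ^ 2) * (z t - x t)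
         - 2 * c t ^ 2 * Y t ^ 2 * G t ^ 2 - 2 * N t ^ 2 * Z t ^ 2 * M t ^ 2)); [ring |].
      rewrite rs, rc, rX, rZ, rM, rY, rG, rN. ring.
  - apply (second_order_change_of_time (fun t => Y t * Z t) n2
      (fun t => Y t * Z t * (c t ^ 2 * G t ^ 2 - s t ^ 2 * G t ^ 2 + s t ^ 2 * c t ^ 2 * (2 * s t ^ 2 + 3)
         - (5 - 2 * z t) * X t ^ 2 * M t ^ 2 - N t ^ 2 * M t ^ 2 - N t ^ 2 * X t ^ 2)
         - 2 * (s t * c t * G t * N t * X t * M t))
      (fun t => z t - x t) (fun t => 2 * N t * X t * Z t * M t + 2 * s t * c t * Y t * G t) th
      (fun t => 2 * (x t + z t) - 6)); auto.
    + intros t. auto_derive; [splits; auto; eexists; eauto | derive_all; unfold n2; ring].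
    + intros t. unfold n2. auto_derive; [splits; auto; eexists; eauto | derive_all; ring].
    + intros t. unfold n2.
      transitivity (s t * c t * G t * N t * X t * M t * (- 2 * (z t - x t) - 2 * Z t ^ 2 + 2 * Y t ^ 2) +
        Y t * Z t * ((c t ^ 2 * G t ^ 2 - s t ^ 2 * G t ^ 2 + s t ^ 2 * c t ^ 2 * (2 * s t ^ 2 + 3)
         - (5 - 2 * z t) * X t ^ 2 * M t ^ 2 - N t ^ 2 * M t ^ 2 - N t ^ 2 * X t ^ 2) * (z t - x t)
         - 2 * s t ^ 2 * c t ^ 2 * G t ^ 2 + 2 * N t ^ 2 * X t ^ 2 * M t ^ 2)); [ring |].
      rewrite rs, rc, rX, rZ, rM, rY, rG, rN. ring.
Qed.

(** The regime [b > 3], with [S], [C] the sine and cosine of the second angle and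
    [n = (4 - b) * sin * cos] of the first. *)
Lemma high_regime_core (b : R) (S C M L H Y V n x z : R -> R) :
  let k := b * (3 - b) in
  (forall t, is_derive S t (C t * M t * L t)) ->
  (forall t, is_derive C t (- S t * M t * L t)) ->
  (forall t, is_derive M t (3 * S t * C t * L t)) ->
  (forall t, is_derive L t (3 * (5 - 2 * z t) * S t * C t * M t)) ->
  (forall t, is_derive H t (n t * Y t * V t)) ->
  (forall t, is_derive Y t (n t * H t * V t)) ->
  (forall t, is_derive V t (n t * H t * Y t)) ->
  (forall t, is_derive n t ((2 * x t - (4 - b)) * H t * Y t * V t)) ->
  (forall t, is_derive x t (- 2 * n t * H t * Y t * V t)) ->
  (forall t, is_derive z t (6 * S t * C t * M t * L t)) ->
  (forall t, 3 * S t ^ 2 = z t - 1) -> (forall t, 3 * C t ^ 2 = 4 - z t) -> (forall t, M t ^ 2 = z t) ->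
  (forall t, L t ^ 2 = 5 * z t - z t ^ 2 - 4 - k) ->
  (forall t, H t ^ 2 = 1 - x t) -> (forall t, Y t ^ 2 = 4 - x t) -> (forall t, V t ^ 2 = 1 + b - x t) ->
  (forall t, n t ^ 2 = x t * (4 - b - x t)) ->
  forall th, (forall t, 0 < z t - x t) -> (forall y, is_derive th y (/ (z (th y) - x (th y)))) ->
  let n1 t := n t * Y t * V t * S t + H t * C t * M t * L t in
  let n2 t := n t * H t * V t * C t - Y t * S t * M t * L t in
  forall y,
  (is_derive (fun y => H (th y) * S (th y)) y (n1 (th y) / (z (th y) - x (th y))) /\
   is_derive (fun y => n1 (th y) / (z (th y) - x (th y))) y
     ((2 * (x (th y) + z (th y)) - 9) * (H (th y) * S (th y)))) /\
  (is_derive (fun y => Y (th y) * C (th y)) y (n2 (th y) / (z (th y) - x (th y))) /\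
   is_derive (fun y => n2 (th y) / (z (th y) - x (th y))) y
     ((2 * (x (th y) + z (th y)) - 6) * (Y (th y) * C (th y)))).
Proof.
  intros k dS dC dM dL dH dY dV dn dx dz rS rC rM rL rH rY rV rn th Hpos Hth n1 n2 y.
  assert (dD : forall t, is_derive (fun t => z t - x t) t
    (6 * S t * C t * M t * L t + 2 * n t * H t * Y t * V t)).
  { intros t. auto_derive; [splits; auto; eexists; eauto | derive_all; ring]. }
  assert (rS' : forall t, S t ^ 2 = (z t - 1) / 3) by (intros t; specialize (rS t); lra).
  assert (rC' : forall t, C t ^ 2 = (4 - z t) / 3) by (intros t; specialize (rC t); lra).
  split.
  - apply (second_order_change_of_time (fun t => H t * S t) n1
      (fun t => H t * S t * ((2 * x t - (4 - b)) * Y t ^ 2 * V t ^ 2 + n t ^ 2 * V t ^ 2 + n t ^ 2 * Y t ^ 2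
         - M t ^ 2 * L t ^ 2 + 3 * C t ^ 2 * L t ^ 2 + 3 * (5 - 2 * z t) * C t ^ 2 * M t ^ 2)
         + 2 * (n t * Y t * V t * C t * M t * L t))
      (fun t => z t - x t) (fun t => 6 * S t * C t * M t * L t + 2 * n t * H t * Y t * V t) th
      (fun t => 2 * (x t + z t) - 9)); auto.
    + intros t. auto_derive; [splits; auto; eexists; eauto | derive_all; unfold n1; ring].
    + intros t. unfold n1. auto_derive; [splits; auto; eexists; eauto | derive_all; ring].
    + intros t. unfold n1.
      transitivity (n t * Y t * V t * C t * M t * L t * (2 * (z t - x t) - 6 * S t ^ 2 - 2 * H t ^ 2) +
        H t * S t * (((2 * x t - (4 - b)) * Y t ^ 2 * V t ^ 2 + n t ^ 2 * V t ^ 2 + n t ^ 2 * Y t ^ 2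
         - M t ^ 2 * L t ^ 2 + 3 * C t ^ 2 * L t ^ 2 + 3 * (5 - 2 * z t) * C t ^ 2 * M t ^ 2) * (z t - x t)
         - 2 * n t ^ 2 * Y t ^ 2 * V t ^ 2 - 6 * C t ^ 2 * M t ^ 2 * L t ^ 2)); [ring |].
      rewrite rS', rC', rM, rL, rH, rY, rV, rn. unfold k. field.
  - apply (second_order_change_of_time (fun t => Y t * C t) n2
      (fun t => Y t * C t * ((2 * x t - (4 - b)) * H t ^ 2 * V t ^ 2 + n t ^ 2 * V t ^ 2 + n t ^ 2 * H t ^ 2
         - M t ^ 2 * L t ^ 2 - 3 * S t ^ 2 * L t ^ 2 - 3 * (5 - 2 * z t) * S t ^ 2 * M t ^ 2)
         - 2 * (n t * H t * V t * S t * M t * L t))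
      (fun t => z t - x t) (fun t => 6 * S t * C t * M t * L t + 2 * n t * H t * Y t * V t) th
      (fun t => 2 * (x t + z t) - 6)); auto.
    + intros t. auto_derive; [splits; auto; eexists; eauto | derive_all; unfold n2; ring].
    + intros t. unfold n2. auto_derive; [splits; auto; eexists; eauto | derive_all; ring].
    + intros t. unfold n2.
      transitivity (n t * H t * V t * S t * M t * L t * (- 2 * (z t - x t) - 6 * C t ^ 2 + 2 * Y t ^ 2) +
        Y t * C t * (((2 * x t - (4 - b)) * H t ^ 2 * V t ^ 2 + n t ^ 2 * V t ^ 2 + n t ^ 2 * H t ^ 2
         - M t ^ 2 * L t ^ 2 - 3 * S t ^ 2 * L t ^ 2 - 3 * (5 - 2 * z t) * S t ^ 2 * M t ^ 2) * (z t - x t)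
         - 2 * n t ^ 2 * H t ^ 2 * V t ^ 2 + 6 * S t ^ 2 * M t ^ 2 * L t ^ 2)); [ring |].
      rewrite rS', rC', rM, rL, rH, rY, rV, rn. unfold k. field.
Qed.

Lemma is_derive_sqrt_of (g : R -> R) (t dg r : R) :
  is_derive g t dg -> 0 < g t -> dg = 2 * sqrt (g t) * r -> is_derive (fun t => sqrt (g t)) t r.
Proof.
  intros Hg Hp E. assert (S := sqrt_lt_R0 _ Hp).
  replace r with (dg / (2 * sqrt (g t))) by (rewrite E; field; lra).
  apply (is_derive_sqrt g); auto.
Qed.

(** In elliptic coordinates [3 * phi1 ^ 2 = (1 - mu1) * (mu2 - 1)] and
    [12 * phi2 ^ 2 = (4 - mu1) * (4 - mu2)]. For [b < 3] the root [mu1] is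
    [cos u ^ 2], and [sin u] is the smooth square root of [1 - mu1] that changes
    sign with [phi1]. *)
Definition low_f1 (k t : R) : R := sqrt ((3 + sin t ^ 2) * (sin t ^ 2 * (3 + sin t ^ 2) + k)).
Definition low_f2 (b t : R) : R := sqrt (mu2 b t * (mu2 b t - 1) * (4 - mu2 b t)).
Definition cos2 (t : R) : R := cos t ^ 2.
Definition low_phi1 (b u v : R) : R := / sqrt 3 * (sin u * sqrt (mu2 b v - 1)).
Definition low_phi2 (b u v : R) : R :=
  / (2 * sqrt 3) * (sqrt (3 + sin u ^ 2) * sqrt (4 - mu2 b v)).

Lemma sqrt_le_of_le_pow2 (x M : R) : 0 <= M -> x <= M ^ 2 -> sqrt x <= M.
Proof.
  intros HM Hx. rewrite <- (sqrt_pow2 M) by auto. apply sqrt_le_1_alt. auto.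
Qed.

Lemma low_separated (b : R) : 0 < b < 3 ->
  exists a v Y th,
    separated (low_f1 (b * (3 - b))) (low_f2 b) cos2 (mu2 b) (Rmin b (3 - b)) 1 a v Y th.
Proof.
  intros Hb.
  assert (Hk : 0 < b * (3 - b) <= 9 / 4) by (pose proof (pow2_ge_0 (b - 3 / 2)); split; nra).
  assert (Hmu := fun t => mu2_bounds b t Hb).
  apply separated_exists with (M := 6).
  - apply Rmin_pos; lra.
  - intros t. pose proof (Jf_pos _ t (proj1 Hk)). unfold low_f1. cont1. lra.
  - intros t. specialize (Hmu t). unfold low_f2, mu2 in *. cont1.
    repeat apply Rmult_lt_0_compat; lra.
  - intros t. pose proof (Jf_pos _ t (proj1 Hk)). pose proof (sin2_bounds t).
    split; [apply sqrt_lt_R0; auto |]. apply sqrt_le_of_le_pow2; [lra |].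
    assert (sin t ^ 2 * (3 + sin t ^ 2) <= 1 * 4) by (apply Rmult_le_compat; lra).
    assert (0 <= sin t ^ 2 * (3 + sin t ^ 2)) by (apply Rmult_le_pos; lra).
    assert ((3 + sin t ^ 2) * (sin t ^ 2 * (3 + sin t ^ 2) + b * (3 - b)) <= 4 * (4 + 9 / 4))
      by (apply Rmult_le_compat; lra). lra.
  - intros t. specialize (Hmu t). unfold low_f2. revert Hmu. generalize (mu2 b t). intros z Hz.
    assert (0 < z * (z - 1)) by (apply Rmult_lt_0_compat; lra).
    split; [apply sqrt_lt_R0, Rmult_lt_0_compat; lra |]. apply sqrt_le_of_le_pow2; [lra |].
    assert (z * (z - 1) * (4 - z) <= 12 * 3) by (apply Rmult_le_compat; nra). lra.
  - intros t. unfold cos2. cont1. auto.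
  - intros t. unfold mu2. cont1. auto.
  - intros t. unfold cos2. pose proof (cos2_bounds t). apply Rabs_le. lra.
  - intros x y. unfold cos2, mu2. pose proof (cos2_bounds x). pose proof (cos2_plus_sin2 y).
    pose proof (cos2_bounds y). pose proof (sin2_bounds y).
    pose proof (Rmin_l b (3 - b)). pose proof (Rmin_r b (3 - b)). nra.
Qed.

Lemma low_solution (p b d C : R) (a v Y th phi1 phi2 : R -> R) :
  0 < p -> b = 4 * p ^ 2 -> b < 3 ->
  separated (low_f1 (b * (3 - b))) (low_f2 b) cos2 (mu2 b) d C a v Y th ->
  ivp_solution p phi1 phi2 ->
  forall y, phi1 y = low_phi1 b (a (th y)) (v (th y)) /\ phi2 y = low_phi2 b (a (th y)) (v (th y)).
Proof.
  intros Hp Eb Hb3 HS Hsol.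
  assert (Hb : 0 < b < 3) by (split; [nra | auto]).
  set (k := b * (3 - b)) in *.
  assert (Hk : 0 < k) by (unfold k; nra).
  pose proof (sep_a0 HS) as a0.
  pose proof (sep_b0 HS) as v0.
  pose proof (sep_th0 HS) as th0.
  pose proof HS as [Hd _ _ _ _ _ _ _ Hgap Ha Hv _ _ _ _ _ _ _ _ Hth].
  assert (Hz : forall t, 1 < mu2 b t < 4) by (intros; apply mu2_bounds; auto).
  set (s := fun t => sin (a t)). set (c := fun t => cos (a t)).
  set (z := fun t => mu2 b (v t)). set (x := fun t => cos2 (a t)).
  set (X := fun t => sqrt (z t - 1)). set (Z := fun t => sqrt (4 - z t)).
  set (M := fun t => sqrt (z t)). set (W := fun t => sqrt (3 + s t ^ 2)).
  set (G := fun t => sqrt (s t ^ 2 * (3 + s t ^ 2) + k)).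
  set (N := fun t => (2 * b - 3) * sin (v t) * cos (v t)).
  assert (Hs2 : forall t, s t ^ 2 = 1 - x t)
    by (intros t; unfold s, x, cos2; pose proof (cos2_plus_sin2 (a t)); lra).
  assert (Hc2 : forall t, c t ^ 2 = x t) by reflexivity.
  assert (Hx : forall t, 0 <= x t <= 1) by (intros; apply cos2_bounds).
  assert (HX2 : forall t, X t ^ 2 = z t - 1)
    by (intros t; apply pow2_sqrt; unfold z; specialize (Hz (v t)); lra).
  assert (HZ2 : forall t, Z t ^ 2 = 4 - z t)
    by (intros t; apply pow2_sqrt; unfold z; specialize (Hz (v t)); lra).
  assert (HM2 : forall t, M t ^ 2 = z t)
    by (intros t; apply pow2_sqrt; unfold z; specialize (Hz (v t)); lra).
  assert (HW2 : forall t, W t ^ 2 = 4 - x t).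
  { intros t. unfold W. rewrite Hs2. specialize (Hx t). rewrite pow2_sqrt; lra. }
  assert (HG2 : forall t, G t ^ 2 = x t ^ 2 - 5 * x t + 4 + k).
  { intros t. unfold G. rewrite Hs2. specialize (Hx t). rewrite pow2_sqrt; nra. }
  assert (HN2 : forall t, N t ^ 2 = 5 * z t - z t ^ 2 - 4 - k).
  { intros t. unfold N, z, mu2, k. 
    replace (((2 * b - 3) * sin (v t) * cos (v t)) ^ 2) with
      ((2 * b - 3) ^ 2 * (sin (v t) ^ 2 * cos (v t) ^ 2)) by ring.
    replace (sin (v t) ^ 2) with (1 - cos (v t) ^ 2) by (pose proof (cos2_plus_sin2 (v t)); lra). ring. }
  assert (da : forall t, is_derive a t (W t * G t)).
  { intros t. unfold W, G, s. pose proof (Jf_pos k (a t) Hk). pose proof (sin2_bounds (a t)).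
    rewrite <- sqrt_mult by nra. apply Ha. }
  assert (dv : forall t, is_derive v t (X t * Z t * M t)).
  { intros t. replace (X t * Z t * M t) with (low_f2 b (v t)); auto.
    unfold X, Z, M, z, low_f2. specialize (Hz (v t)).
    rewrite !sqrt_mult; nra. }
  assert (ds : forall t, is_derive s t (c t * W t * G t)).
  { intros t. unfold s. auto_derive; [eexists; eauto | derive_all; unfold c; ring]. }
  assert (dc : forall t, is_derive c t (- s t * W t * G t)).
  { intros t. unfold c. auto_derive; [eexists; eauto | derive_all; unfold s; ring]. }
  assert (dx : forall t, is_derive x t (- 2 * s t * c t * W t * G t)).
  { intros t. unfold x, cos2. auto_derive; [eexists; eauto | derive_all; unfold s, c; ring]. }
  assert (dz : forall t, is_derive z t (2 * N t * X t * Z t * M t)).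
  { intros t. unfold z, mu2. auto_derive; [splits; auto; eexists; eauto | derive_all; unfold N; ring]. }
  assert (dX : forall t, is_derive X t (N t * Z t * M t)).
  { intros t. apply (is_derive_sqrt_of (fun t => z t - 1) t (2 * N t * X t * Z t * M t)).
    - auto_derive; [eexists; eauto | derive_all; ring].
    - unfold z. specialize (Hz (v t)). lra.
    - fold (X t). ring. }
  assert (dZ : forall t, is_derive Z t (- N t * X t * M t)).
  { intros t. apply (is_derive_sqrt_of (fun t => 4 - z t) t (- (2 * N t * X t * Z t * M t))).
    - auto_derive; [eexists; eauto | derive_all; ring].
    - unfold z. specialize (Hz (v t)). lra.
    - fold (Z t). ring. }
  assert (dM : forall t, is_derive M t (N t * X t * Z t)).
  { intros t. apply (is_derive_sqrt_of (fun t => z t) t (2 * N t * X t * Z t * M t)).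
    - apply dz.
    - unfold z. specialize (Hz (v t)). lra.
    - fold (M t). ring. }
  assert (dW : forall t, is_derive W t (s t * c t * G t)).
  { intros t. apply (is_derive_sqrt_of (fun t => 3 + s t ^ 2) t (2 * s t * (c t * W t * G t))).
    - auto_derive; [eexists; eauto | derive_all; ring].
    - rewrite Hs2. specialize (Hx t). lra.
    - fold (W t). ring. }
  assert (dG : forall t, is_derive G t (s t * c t * W t * (2 * s t ^ 2 + 3))).
  { intros t. apply (is_derive_sqrt_of (fun t => s t ^ 2 * (3 + s t ^ 2) + k) t
      (2 * s t * (c t * W t * G t) * (2 * s t ^ 2 + 3))).
    - auto_derive; [splits; auto; eexists; eauto | derive_all; ring].
    - rewrite Hs2. specialize (Hx t). nra.
    - fold (G t). ring. }
  assert (dN : forall t, is_derive N t ((5 - 2 * z t) * X t * Z t * M t)).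
  { intros t. unfold N. auto_derive; [splits; auto; eexists; eauto |]. derive_all.
    unfold z at 1, mu2.
    transitivity ((2 * b - 3) * (cos (v t) ^ 2 - sin (v t) ^ 2) * (X t * Z t * M t)); [ring |].
    replace (sin (v t) ^ 2) with (1 - cos (v t) ^ 2) by (pose proof (cos2_plus_sin2 (v t)); lra). ring. }
  assert (Hpos : forall t, 0 < z t - x t).
  { intros t. specialize (Hgap (a t) (v t)). unfold z, x. lra. }
  assert (core := low_regime_core k s c X Z M W G N x z ds dc dX dZ dM dW dG dN dx dz
    Hs2 Hc2 HX2 HZ2 HM2 HW2 HG2 HN2 th Hpos Hth).
  cbv zeta in core.
  assert (S3 : 0 < sqrt 3) by (apply sqrt_lt_R0; lra).
  assert (S32 : sqrt 3 ^ 2 = 3) by (apply pow2_sqrt; lra).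
  assert (S32' : (/ sqrt 3) ^ 2 = / 3) by (rewrite pow_inv, S32; reflexivity).
  assert (Es : s 0 = 0) by (unfold s; rewrite a0; apply sin_0).
  assert (Ec : c 0 = 1) by (unfold c; rewrite a0; apply cos_0).
  assert (EN : N 0 = 0) by (unfold N; rewrite v0, sin_0; ring).
  assert (Ez : z 0 = 4 - b) by (unfold z, mu2; rewrite v0, sin_0, cos_0; ring).
  assert (Ex : x 0 = 1) by (rewrite <- Hc2, Ec; ring).
  assert (E2p : sqrt b = 2 * p).
  { rewrite Eb. replace (4 * p ^ 2) with ((2 * p) ^ 2) by ring. apply sqrt_pow2. lra. }
  assert (EW : W 0 = sqrt 3) by (unfold W; rewrite Es; f_equal; ring).
  assert (EG : G 0 = sqrt b * sqrt (3 - b)).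
  { unfold G. rewrite Es, <- sqrt_mult by lra. f_equal. unfold k. ring. }
  assert (EX : X 0 = sqrt (3 - b)) by (unfold X; rewrite Ez; f_equal; ring).
  assert (EZ : Z 0 = sqrt b) by (unfold Z; rewrite Ez; f_equal; ring).
  assert (E3b : sqrt (3 - b) * sqrt (3 - b) = 3 - b) by (apply sqrt_sqrt; lra).
  assert (Hpot : forall y, 2 * (/ sqrt 3 * (s (th y) * X (th y))) ^ 2 +
     8 * (/ (2 * sqrt 3) * (W (th y) * Z (th y))) ^ 2 = 10 - 2 * (x (th y) + z (th y))).
  { intros y. rewrite Rinv_mult. 
    transitivity ((/ sqrt 3) ^ 2 * (2 * (s (th y) ^ 2 * X (th y) ^ 2) + 2 * (W (th y) ^ 2 * Z (th y) ^ 2))).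
    - field. lra.
    - rewrite S32', Hs2, HX2, HW2, HZ2. field. }
  apply (first_order_unique p phi1 (Derive phi1) phi2 (Derive phi2)
    (fun y => low_phi1 b (a (th y)) (v (th y)))
    (fun y => / sqrt 3 * ((c (th y) * W (th y) * G (th y) * X (th y) + s (th y) * N (th y) * Z (th y) * M (th y)) /
       (z (th y) - x (th y))))
    (fun y => low_phi2 b (a (th y)) (v (th y)))
    (fun y => / (2 * sqrt 3) * ((s (th y) * c (th y) * G (th y) * Z (th y) - N (th y) * X (th y) * M (th y) * W (th y)) /
       (z (th y) - x (th y))))).
  { apply ivp_first_order; auto. }
  unfold first_order_solution. splits.
  - intros y. destruct (core y) as [[K1 _] _]. apply (is_derive_scal _ _ _ _ K1).
  - intros y. destruct (core y) as [_ [K1 _]]. apply (is_derive_scal _ _ _ _ K1).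
  - intros y. destruct (core y) as [[_ K1] _].
    replace ((1 - 2 * low_phi1 b (a (th y)) (v (th y)) ^ 2 - 8 * low_phi2 b (a (th y)) (v (th y)) ^ 2) *
      low_phi1 b (a (th y)) (v (th y))) with
      (/ sqrt 3 * ((2 * (x (th y) + z (th y)) - 9) * (s (th y) * X (th y)))).
    + apply (is_derive_scal _ _ _ _ K1).
    + specialize (Hpot y). change (low_phi1 b (a (th y)) (v (th y))) with (/ sqrt 3 * (s (th y) * X (th y))).
      change (low_phi2 b (a (th y)) (v (th y))) with (/ (2 * sqrt 3) * (W (th y) * Z (th y))).
      replace (1 - 2 * (/ sqrt 3 * (s (th y) * X (th y))) ^ 2 - 8 * (/ (2 * sqrt 3) * (W (th y) * Z (th y))) ^ 2)
        with (2 * (x (th y) + z (th y)) - 9) by lra. ring.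
  - intros y. destruct (core y) as [_ [_ K1]].
    replace ((4 - 2 * low_phi1 b (a (th y)) (v (th y)) ^ 2 - 8 * low_phi2 b (a (th y)) (v (th y)) ^ 2) *
      low_phi2 b (a (th y)) (v (th y))) with
      (/ (2 * sqrt 3) * ((2 * (x (th y) + z (th y)) - 6) * (W (th y) * Z (th y)))).
    + apply (is_derive_scal _ _ _ _ K1).
    + specialize (Hpot y). change (low_phi1 b (a (th y)) (v (th y))) with (/ sqrt 3 * (s (th y) * X (th y))).
      change (low_phi2 b (a (th y)) (v (th y))) with (/ (2 * sqrt 3) * (W (th y) * Z (th y))).
      replace (4 - 2 * (/ sqrt 3 * (s (th y) * X (th y))) ^ 2 - 8 * (/ (2 * sqrt 3) * (W (th y) * Z (th y))) ^ 2)
        with (2 * (x (th y) + z (th y)) - 6) by lra. ring.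
  - rewrite th0. change (/ sqrt 3 * (s 0 * X 0) = 0). rewrite Es. ring.
  - rewrite th0. change (/ (2 * sqrt 3) * (W 0 * Z 0) = p). rewrite EW, EZ, E2p. field. lra.
  - rewrite th0, Es, Ec, EW, EG, EX, Ez, Ex.
    transitivity (sqrt b * (sqrt (3 - b) * sqrt (3 - b)) / (3 - b)); [field; lra |].
    rewrite E3b, E2p. field. lra.
  - rewrite th0, Es, EN. unfold Rdiv. ring.
Qed.

(** For [b > 3] the roots [1] and [4 - b] of the quintic have exchanged their
    order: [mu1] now oscillates between 0 and [4 - b], and [mu2] sweeps all of
    [1, 4], so that [phi2] changes sign. *)
Definition high_mu1 (b t : R) : R := (4 - b) * cos t ^ 2.
Definition high_mu2 (t : R) : R := 1 + 3 * sin t ^ 2.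
Definition high_f1 (b t : R) : R :=
  sqrt ((1 - high_mu1 b t) * (4 - high_mu1 b t) * (1 + b - high_mu1 b t)).
Definition high_f2 (b t : R) : R :=
  sqrt (high_mu2 t * ((high_mu2 t - 4 + b) * (1 + b - high_mu2 t))).
Definition high_phi1 (b u v : R) : R := sqrt (1 - high_mu1 b u) * sin v.
Definition high_phi2 (b u v : R) : R := / 2 * (sqrt (4 - high_mu1 b u) * cos v).

Lemma high_mu1_bounds (b t : R) : 3 < b <= 4 -> 0 <= high_mu1 b t <= 4 - b.
Proof. intros Hb. unfold high_mu1. pose proof (cos2_bounds t). split; nra. Qed.

Lemma high_mu2_bounds (t : R) : 1 <= high_mu2 t <= 4.
Proof. unfold high_mu2. pose proof (sin2_bounds t). lra. Qed.

Lemma high_separated (b : R) : 3 < b <= 4 ->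
  exists a v Y th, separated (high_f1 b) (high_f2 b) (high_mu1 b) high_mu2 (b - 3) 1 a v Y th.
Proof.
  intros Hb.
  assert (H1 := fun t => high_mu1_bounds b t Hb). assert (H2 := high_mu2_bounds).
  assert (P1 : forall t, 0 < (1 - high_mu1 b t) * (4 - high_mu1 b t) * (1 + b - high_mu1 b t)).
  { intros t. specialize (H1 t). repeat apply Rmult_lt_0_compat; lra. }
  assert (P2 : forall t, 0 < high_mu2 t * ((high_mu2 t - 4 + b) * (1 + b - high_mu2 t))).
  { intros t. specialize (H2 t). repeat apply Rmult_lt_0_compat; lra. }
  apply separated_exists with (M := 8).
  - lra.
  - intros t. specialize (P1 t). unfold high_f1, high_mu1 in *. cont1. auto.
  - intros t. specialize (P2 t). unfold high_f2, high_mu2 in *. cont1. auto.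
  - intros t. specialize (P1 t). specialize (H1 t). split; [apply sqrt_lt_R0; auto |].
    apply sqrt_le_of_le_pow2; [lra |].
    assert ((1 - high_mu1 b t) * (4 - high_mu1 b t) * (1 + b - high_mu1 b t) <= 1 * 4 * 5)
      by (repeat apply Rmult_le_compat; repeat apply Rmult_le_pos; lra). lra.
  - intros t. specialize (P2 t). specialize (H2 t). split; [apply sqrt_lt_R0; auto |].
    apply sqrt_le_of_le_pow2; [lra |].
    assert (high_mu2 t * ((high_mu2 t - 4 + b) * (1 + b - high_mu2 t)) <= 4 * (4 * 4))
      by (repeat apply Rmult_le_compat; repeat apply Rmult_le_pos; lra). lra.
  - intros t. unfold high_mu1. cont1. auto.
  - intros t. unfold high_mu2. cont1. auto.
  - intros t. specialize (H1 t). apply Rabs_le. lra.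
  - intros x y. specialize (H1 x). specialize (H2 y). lra.
Qed.

Lemma high_solution (p b d C : R) (a v Y th phi1 phi2 : R -> R) :
  0 < p -> b = 4 * p ^ 2 -> 3 < b <= 4 ->
  separated (high_f1 b) (high_f2 b) (high_mu1 b) high_mu2 d C a v Y th ->
  ivp_solution p phi1 phi2 ->
  forall y, phi1 y = high_phi1 b (a (th y)) (v (th y)) /\ phi2 y = high_phi2 b (a (th y)) (v (th y)).
Proof.
  intros Hp Eb Hb HS Hsol.
  set (k := b * (3 - b)) in *.
  pose proof (sep_a0 HS) as a0.
  pose proof (sep_b0 HS) as v0.
  pose proof (sep_th0 HS) as th0.
  pose proof HS as [Hd _ _ _ _ _ _ _ Hgap Ha Hv _ _ _ _ _ _ _ _ Hth].
  set (x := fun t => high_mu1 b (a t)). set (z := fun t => high_mu2 (v t)).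
  assert (Hx : forall t, 0 <= x t <= 4 - b) by (intros; apply high_mu1_bounds; auto).
  assert (Hz : forall t, 1 <= z t <= 4) by (intros; apply high_mu2_bounds).
  set (S := fun t => sin (v t)). set (Cs := fun t => cos (v t)).
  set (M := fun t => sqrt (z t)). set (L := fun t => sqrt ((z t - 4 + b) * (1 + b - z t))).
  set (H := fun t => sqrt (1 - x t)). set (W := fun t => sqrt (4 - x t)).
  set (V := fun t => sqrt (1 + b - x t)).
  set (n := fun t => (4 - b) * sin (a t) * cos (a t)).
  assert (HLp : forall t, 0 < (z t - 4 + b) * (1 + b - z t))
    by (intros t; specialize (Hz t); apply Rmult_lt_0_compat; lra).
  assert (HS2 : forall t, 3 * S t ^ 2 = z t - 1) by (intros t; unfold S, z, high_mu2; ring).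
  assert (HC2 : forall t, 3 * Cs t ^ 2 = 4 - z t)
    by (intros t; unfold Cs, z, high_mu2; pose proof (cos2_plus_sin2 (v t)); lra).
  assert (HM2 : forall t, M t ^ 2 = z t) by (intros t; apply pow2_sqrt; specialize (Hz t); lra).
  assert (HL2 : forall t, L t ^ 2 = 5 * z t - z t ^ 2 - 4 - k).
  { intros t. unfold L. rewrite pow2_sqrt by (specialize (HLp t); lra). unfold k. ring. }
  assert (HH2 : forall t, H t ^ 2 = 1 - x t) by (intros t; apply pow2_sqrt; specialize (Hx t); lra).
  assert (HW2 : forall t, W t ^ 2 = 4 - x t) by (intros t; apply pow2_sqrt; specialize (Hx t); lra).
  assert (HV2 : forall t, V t ^ 2 = 1 + b - x t) by (intros t; apply pow2_sqrt; specialize (Hx t); lra).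
  assert (Hn2 : forall t, n t ^ 2 = x t * (4 - b - x t)).
  { intros t. unfold n, x, high_mu1.
    replace (((4 - b) * sin (a t) * cos (a t)) ^ 2) with ((4 - b) ^ 2 * (sin (a t) ^ 2 * cos (a t) ^ 2)) by ring.
    replace (sin (a t) ^ 2) with (1 - cos (a t) ^ 2) by (pose proof (cos2_plus_sin2 (a t)); lra). ring. }
  assert (da : forall t, is_derive a t (H t * W t * V t)).
  { intros t. replace (H t * W t * V t) with (high_f1 b (a t)); auto.
    unfold H, W, V, high_f1. fold (x t). specialize (Hx t).
    rewrite !sqrt_mult; nra. }
  assert (dv : forall t, is_derive v t (M t * L t)).
  { intros t. replace (M t * L t) with (high_f2 b (v t)); auto.
    unfold M, L, high_f2. fold (z t). specialize (Hz t). specialize (HLp t).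
    rewrite (sqrt_mult (z t)); lra. }
  assert (dS : forall t, is_derive S t (Cs t * M t * L t)).
  { intros t. unfold S. auto_derive; [eexists; eauto | derive_all; unfold Cs; ring]. }
  assert (dC : forall t, is_derive Cs t (- S t * M t * L t)).
  { intros t. unfold Cs. auto_derive; [eexists; eauto | derive_all; unfold S; ring]. }
  assert (dx : forall t, is_derive x t (- 2 * n t * H t * W t * V t)).
  { intros t. unfold x, high_mu1. auto_derive; [eexists; eauto | derive_all; unfold n; ring]. }
  assert (dz : forall t, is_derive z t (6 * S t * Cs t * M t * L t)).
  { intros t. unfold z, high_mu2. auto_derive; [eexists; eauto | derive_all; unfold S, Cs; ring]. }
  assert (dM : forall t, is_derive M t (3 * S t * Cs t * L t)).
  { intros t. apply (is_derive_sqrt_of (fun t => z t) t (6 * S t * Cs t * M t * L t)).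
    - apply dz.
    - specialize (Hz t). lra.
    - fold (M t). ring. }
  assert (dL : forall t, is_derive L t (3 * (5 - 2 * z t) * S t * Cs t * M t)).
  { intros t. apply (is_derive_sqrt_of (fun t => (z t - 4 + b) * (1 + b - z t)) t
      ((5 - 2 * z t) * (6 * S t * Cs t * M t * L t))); auto.
    - auto_derive; [splits; auto; eexists; eauto | derive_all; ring].
    - fold (L t). ring. }
  assert (dH : forall t, is_derive H t (n t * W t * V t)).
  { intros t. apply (is_derive_sqrt_of (fun t => 1 - x t) t (- (- 2 * n t * H t * W t * V t))).
    - auto_derive; [eexists; eauto | derive_all; ring].
    - specialize (Hx t). lra.
    - fold (H t). ring. }
  assert (dW : forall t, is_derive W t (n t * H t * V t)).
  { intros t. apply (is_derive_sqrt_of (fun t => 4 - x t) t (- (- 2 * n t * H t * W t * V t))).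
    - auto_derive; [eexists; eauto | derive_all; ring].
    - specialize (Hx t). lra.
    - fold (W t). ring. }
  assert (dV : forall t, is_derive V t (n t * H t * W t)).
  { intros t. apply (is_derive_sqrt_of (fun t => 1 + b - x t) t (- (- 2 * n t * H t * W t * V t))).
    - auto_derive; [eexists; eauto | derive_all; ring].
    - specialize (Hx t). lra.
    - fold (V t). ring. }
  assert (dn : forall t, is_derive n t ((2 * x t - (4 - b)) * H t * W t * V t)).
  { intros t. unfold n. auto_derive; [splits; auto; eexists; eauto |]. derive_all.
    unfold x at 1, high_mu1.
    transitivity ((4 - b) * (cos (a t) ^ 2 - sin (a t) ^ 2) * (H t * W t * V t)); [ring |].
    replace (sin (a t) ^ 2) with (1 - cos (a t) ^ 2) by (pose proof (cos2_plus_sin2 (a t)); lra). ring. }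
  assert (Hpos : forall t, 0 < z t - x t).
  { intros t. specialize (Hgap (a t) (v t)). unfold z, x. lra. }
  assert (core := high_regime_core b S Cs M L H W V n x z dS dC dM dL dH dW dV dn dx dz
    HS2 HC2 HM2 HL2 HH2 HW2 HV2 Hn2 th Hpos Hth).
  cbv zeta in core.
  assert (En : n 0 = 0) by (unfold n; rewrite a0, sin_0; ring).
  assert (ES : S 0 = 0) by (unfold S; rewrite v0; apply sin_0).
  assert (EC : Cs 0 = 1) by (unfold Cs; rewrite v0; apply cos_0).
  assert (Ez : z 0 = 1) by (unfold z, high_mu2; rewrite v0, sin_0; ring).
  assert (Ex : x 0 = 4 - b) by (unfold x, high_mu1; rewrite a0, cos_0; ring).
  assert (E2p : sqrt b = 2 * p).
  { rewrite Eb. replace (4 * p ^ 2) with ((2 * p) ^ 2) by ring. apply sqrt_pow2. lra. }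
  assert (EM : M 0 = 1) by (unfold M; rewrite Ez; apply sqrt_1).
  assert (EH : H 0 = sqrt (b - 3)) by (unfold H; rewrite Ex; f_equal; ring).
  assert (EL : L 0 = sqrt (b - 3) * sqrt b).
  { unfold L. rewrite Ez, <- sqrt_mult by lra. f_equal. ring. }
  assert (EW : W 0 = sqrt b) by (unfold W; rewrite Ex; f_equal; ring).
  assert (E3b : sqrt (b - 3) * sqrt (b - 3) = b - 3) by (apply sqrt_sqrt; lra).
  assert (Hpot : forall y, 2 * (H (th y) * S (th y)) ^ 2 + 8 * (/ 2 * (W (th y) * Cs (th y))) ^ 2 =
     10 - 2 * (x (th y) + z (th y))).
  { intros y. 
    transitivity (2 / 3 * (H (th y) ^ 2 * (3 * S (th y) ^ 2) + W (th y) ^ 2 * (3 * Cs (th y) ^ 2))); [field |].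
    rewrite HS2, HH2, HW2, HC2. field. }
  apply (first_order_unique p phi1 (Derive phi1) phi2 (Derive phi2)
    (fun y => high_phi1 b (a (th y)) (v (th y)))
    (fun y => (n (th y) * W (th y) * V (th y) * S (th y) + H (th y) * Cs (th y) * M (th y) * L (th y)) /
       (z (th y) - x (th y)))
    (fun y => high_phi2 b (a (th y)) (v (th y)))
    (fun y => / 2 * ((n (th y) * H (th y) * V (th y) * Cs (th y) - W (th y) * S (th y) * M (th y) * L (th y)) /
       (z (th y) - x (th y))))).
  { apply ivp_first_order; auto. }
  unfold first_order_solution. splits.
  - intros y. destruct (core y) as [[K1 _] _]. exact K1.
  - intros y. destruct (core y) as [_ [K1 _]]. apply (is_derive_scal _ _ _ _ K1).
  - intros y. destruct (core y) as [[_ K1] _].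
    replace ((1 - 2 * high_phi1 b (a (th y)) (v (th y)) ^ 2 - 8 * high_phi2 b (a (th y)) (v (th y)) ^ 2) *
      high_phi1 b (a (th y)) (v (th y))) with
      ((2 * (x (th y) + z (th y)) - 9) * (H (th y) * S (th y))).
    + exact K1.
    + specialize (Hpot y). change (high_phi1 b (a (th y)) (v (th y))) with (H (th y) * S (th y)).
      change (high_phi2 b (a (th y)) (v (th y))) with (/ 2 * (W (th y) * Cs (th y))).
      f_equal. lra.
  - intros y. destruct (core y) as [_ [_ K1]].
    replace ((4 - 2 * high_phi1 b (a (th y)) (v (th y)) ^ 2 - 8 * high_phi2 b (a (th y)) (v (th y)) ^ 2) *
      high_phi2 b (a (th y)) (v (th y))) with
      (/ 2 * ((2 * (x (th y) + z (th y)) - 6) * (W (th y) * Cs (th y)))).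
    + apply (is_derive_scal _ _ _ _ K1).
    + specialize (Hpot y). change (high_phi1 b (a (th y)) (v (th y))) with (H (th y) * S (th y)).
      change (high_phi2 b (a (th y)) (v (th y))) with (/ 2 * (W (th y) * Cs (th y))).
      replace (4 - 2 * (H (th y) * S (th y)) ^ 2 - 8 * (/ 2 * (W (th y) * Cs (th y))) ^ 2)
        with (2 * (x (th y) + z (th y)) - 6) by lra. ring.
  - rewrite th0. change (H 0 * S 0 = 0). rewrite ES. ring.
  - rewrite th0. change (/ 2 * (W 0 * Cs 0) = p). rewrite EW, EC, E2p. field.
  - rewrite th0, En, ES, EC, EM, EH, EL, Ez, Ex.
    transitivity (sqrt b * (sqrt (b - 3) * sqrt (b - 3)) / (b - 3)); [field; lra |].
    rewrite E3b, E2p. field. lra.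
  - rewrite th0, En, ES. unfold Rdiv. ring.
Qed.

(** * Periods and zeros for [p < sqrt 3 / 2] *)

Lemma RInt_half_period (h : R -> R) :
  (forall x, continuous h x) -> (forall x, h (- x) = h x) -> (forall x, h (x + PI) = h x) ->
  RInt h 0 PI = 2 * RInt h 0 (PI / 2).
Proof.
  intros Hc He Hp.
  assert (Hodd : forall x, RInt h 0 (- x) = - RInt h 0 x).
  { apply (eq_of_same_derive (fun x => RInt h 0 (- x)) (fun x => - RInt h 0 x) (fun x => - h x)).
    - intros t. rewrite <- He. replace (- h (- t)) with (-1 * h (- t)) by ring.
      apply (is_derive_comp (fun z => RInt h 0 z) (fun t => - t)).
      + apply (is_derive_RInt_cont h); auto.
      + auto_derive; auto; ring.
    - intros t. apply (is_derive_opp (fun z => RInt h 0 z)). apply (is_derive_RInt_cont h); auto.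
    - rewrite Ropp_0. pose proof (RInt_point (V := R_CompleteNormedModule) 0 h) as E.
      change (RInt h 0 0 = 0) in E. rewrite E. ring. }
  pose proof (RInt_periodic h PI (- (PI / 2)) Hc Hp) as E.
  replace (- (PI / 2) + PI) with (PI / 2) in E by field. rewrite Hodd in E. lra.
Qed.

Lemma shift_IZR (g : R -> R) (A P : R) :
  (forall t, g (t + A) = g t + P) -> forall (j : Z) t, g (t + IZR j * A) = g t + IZR j * P.
Proof.
  intros H j. induction j using Z.peano_ind; intros t.
  - rewrite !Rmult_0_l, !Rplus_0_r. reflexivity.
  - rewrite succ_IZR. replace (t + (IZR j + 1) * A) with (t + IZR j * A + A) by ring.
    rewrite H, IHj. ring.
  - rewrite <- Z.sub_1_r, minus_IZR.
    replace (t + (IZR j - 1) * A) with (t - A + IZR j * A) by ring.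
    rewrite IHj. pose proof (H (t - A)) as E. replace (t - A + A) with t in E by ring.
    rewrite E. ring.
Qed.

Lemma sin_add_PI (x : R) : sin (x + PI) = - sin x.
Proof. apply neg_sin. Qed.

Lemma cos_add_PI (x : R) : cos (x + PI) = - cos x.
Proof. apply neg_cos. Qed.

Lemma shift_IZR_PI (h : R -> R) :
  (forall x, h (x + PI) = h x) -> forall (j : Z) x, h (x + IZR j * PI) = h x.
Proof.
  intros H j x. pose proof (shift_IZR h PI 0) as E. rewrite E; [ring |].
  intros t. rewrite H. ring.
Qed.

Lemma mu2_add_PI (b x : R) : mu2 b (x + PI) = mu2 b x.
Proof. unfold mu2. rewrite sin_add_PI, cos_add_PI. ring. Qed.

Lemma cos2_add_PI (x : R) : cos2 (x + PI) = cos2 x.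
Proof. unfold cos2. rewrite cos_add_PI. ring. Qed.

Lemma low_f1_add_PI (k x : R) : low_f1 k (x + PI) = low_f1 k x.
Proof.
  unfold low_f1. rewrite sin_add_PI. replace ((- sin x) ^ 2) with (sin x ^ 2) by ring. reflexivity.
Qed.

Lemma low_f2_add_PI (b x : R) : low_f2 b (x + PI) = low_f2 b x.
Proof. unfold low_f2. rewrite mu2_add_PI. reflexivity. Qed.

Lemma low_f1_travel (k : R) : 0 < k -> RInt (fun x => / low_f1 k x) 0 PI = 2 * J k.
Proof.
  intros Hk. apply (RInt_half_period (Jf k)).
  - intros; apply continuous_Jf; auto.
  - intros x. unfold Jf. rewrite sin_neg. replace ((- sin x) ^ 2) with (sin x ^ 2) by ring. reflexivity.
  - intros x. unfold Jf. rewrite sin_add_PI. replace ((- sin x) ^ 2) with (sin x ^ 2) by ring. reflexivity.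
Qed.

Lemma low_f2_travel (b : R) : 0 < b < 3 -> RInt (fun x => / low_f2 b x) 0 PI = 2 * W b.
Proof.
  intros Hb. apply (RInt_half_period (fun x => / low_f2 b x)).
  - intros t. pose proof (mu2_bounds b t Hb) as Hmu. unfold low_f2, mu2 in *. cont1.
    assert (0 < ((4 - b) * cos t ^ 2 + (1 + b) * sin t ^ 2) *
      ((4 - b) * cos t ^ 2 + (1 + b) * sin t ^ 2 - 1) * (4 - ((4 - b) * cos t ^ 2 + (1 + b) * sin t ^ 2)))
      by (repeat apply Rmult_lt_0_compat; lra).
    splits; auto. apply sqrt_neq_0. auto.
  - intros x. unfold low_f2, mu2. rewrite sin_neg, cos_neg.
    replace ((- sin x) ^ 2) with (sin x ^ 2) by ring. reflexivity.
  - intros x. rewrite low_f2_add_PI. reflexivity.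
Qed.

Lemma exists_least_nat (Q : nat -> Prop) : (exists n, Q n) ->
  exists n, Q n /\ forall m, Q m -> (n <= m)%nat.
Proof.
  intros [n Hn]. revert Hn. induction n as [n IH] using (well_founded_induction Wf_nat.lt_wf). intros Hn.
  destruct (classic (exists m, Q m /\ (m < n)%nat)) as [[m [Hm Hlt]] | H].
  - exact (IH m Hlt Hm).
  - exists n. split; auto. intros m Hm. destruct (Compare_dec.le_lt_dec n m); auto. exfalso. eauto.
Qed.

Lemma at_least_of_exactly (m n : nat) (f : R -> R) (y0 T : R) :
  (m <= n)%nat -> exactly_zeros n f y0 T -> at_least_zeros m f y0 T.
Proof.
  intros Hmn [l [Hl [Hlen Hin]]]. exists (firstn m l). split; [| split].
  - rewrite <- (firstn_skipn m l) in Hl. apply NoDup_app_remove_r in Hl. exact Hl.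
  - rewrite length_firstn. lia.
  - intros y Hy. apply Hin. rewrite <- (firstn_skipn m l). apply in_or_app. auto.
Qed.

Lemma multiples_in_interval (A t : R) : 0 < A ->
  exists j0 : Z, forall (N : nat) (j : Z),
    (t <= IZR j * A < t + INR N * A <-> (j0 <= j < j0 + Z.of_nat N)%Z).
Proof.
  intros HA. destruct (archimed (- (t / A))) as [H1 H2].
  set (u := up (- (t / A))) in *.
  assert (Et : t = t / A * A) by (field; lra). set (q := t / A) in *.
  exists (1 - u)%Z. intros N j. rewrite INR_IZR_INZ, Et.
  assert (E1 : q * A <= IZR j * A < q * A + IZR (Z.of_nat N) * A <->
    q <= IZR j < q + IZR (Z.of_nat N)).
  { split; intros [G1 G2]; split; try nra. }
  rewrite E1. split.
  - intros [G1 G2]. split.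
    + assert (- IZR j < IZR u) by lra. rewrite <- opp_IZR in H. apply lt_IZR in H. lia.
    + assert (IZR j < IZR (1 - u + Z.of_nat N)) by (rewrite plus_IZR, minus_IZR; lra).
      apply lt_IZR in H. lia.
  - intros [G1 G2]. apply IZR_le in G1. rewrite minus_IZR in G1.
    assert (G3 : (j + 1 <= 1 - u + Z.of_nat N)%Z) by lia.
    apply IZR_le in G3. rewrite !plus_IZR, minus_IZR in G3.
    lra.
Qed.

Section low_periods.
Variables (p b : R) (phi1 phi2 a v Y th : R -> R) (d C : R).
Hypothesis Hp : 0 < p.
Hypothesis Eb : b = 4 * p ^ 2.
Hypothesis Hb3 : b < 3.
Hypothesis HS : separated (low_f1 (b * (3 - b))) (low_f2 b) cos2 (mu2 b) d C a v Y th.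
Hypothesis Hsol : ivp_solution p phi1 phi2.
Let A := 2 * J (b * (3 - b)).
Let B := 2 * W b.

Lemma low_b : 0 < b < 3.
Proof. split; [nra | auto]. Qed.

Lemma low_k : 0 < b * (3 - b) <= 9 / 4.
Proof. pose proof low_b. pose proof (pow2_ge_0 (b - 3 / 2)). split; nra. Qed.

Lemma A_pos : 0 < A.
Proof. unfold A. pose proof (J_pos _ (proj1 low_k)). lra. Qed.

Lemma a_shift (j : Z) (t : R) : a (t + IZR j * A) = a t + IZR j * PI.
Proof.
  apply (shift_IZR a). intros r. unfold A. rewrite <- low_f1_travel by apply low_k.
  apply (sep_a_shift HS). apply low_f1_add_PI.
Qed.

Lemma v_shift (j : Z) (t : R) : v (t + IZR j * B) = v t + IZR j * PI.
Proof.
  apply (shift_IZR v). intros r. unfold B. rewrite <- low_f2_travel by apply low_b.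
  apply (sep_b_shift HS). apply low_f2_add_PI.
Qed.

Lemma a_at (j : Z) : a (IZR j * A) = IZR j * PI.
Proof.
  rewrite <- (Rplus_0_l (IZR j * A)), a_shift, (sep_a0 HS). ring.
Qed.

Lemma a_eq_iff (j : Z) (t : R) : a t = IZR j * PI <-> t = IZR j * A.
Proof.
  split.
  - intros E. rewrite <- a_at in E.
    rewrite <- (sep_Aa HS t), E. apply (sep_Aa HS).
  - intros ->. apply a_at.
Qed.

Lemma v_eq (j : Z) (t : R) : v t = IZR j * PI -> t = IZR j * B.
Proof.
  intros E.
  assert (E2 : v (IZR j * B) = IZR j * PI).
  { rewrite <- (Rplus_0_l (IZR j * B)), v_shift, (sep_b0 HS). ring. }
  rewrite <- E2 in E.
  rewrite <- (sep_Bb HS t), E. apply (sep_Bb HS).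
Qed.

Lemma phi1_formula (y : R) :
  exists w, 0 < w /\ phi1 y = w * sin (a (th y)).
Proof.
  exists (/ sqrt 3 * sqrt (mu2 b (v (th y)) - 1)).
  pose proof (mu2_bounds b (v (th y)) low_b). split.
  - apply Rmult_lt_0_compat; [apply Rinv_0_lt_compat |]; apply sqrt_lt_R0; lra.
  - destruct (low_solution p b d C a v Y th phi1 phi2 Hp Eb Hb3 HS Hsol y) as [-> _].
    unfold low_phi1. ring.
Qed.

Lemma phi2_pos (y : R) : 0 < phi2 y.
Proof.
  destruct (low_solution p b d C a v Y th phi1 phi2 Hp Eb Hb3 HS Hsol y) as [_ ->].
  unfold low_phi2. pose proof (mu2_bounds b (v (th y)) low_b). pose proof (sin2_bounds (a (th y))).
  assert (0 < sqrt 3) by (apply sqrt_lt_R0; lra).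
  apply Rmult_lt_0_compat; [apply Rinv_0_lt_compat; lra |].
  apply Rmult_lt_0_compat; apply sqrt_lt_R0; lra.
Qed.

Lemma phi1_zero_iff (y : R) : phi1 y = 0 <-> exists j : Z, th y = IZR j * A.
Proof.
  destruct (phi1_formula y) as [w [Hw ->]]. split.
  - intros E. apply Rmult_integral in E. destruct E as [E | E]; [lra |].
    apply sin_eq_0_0 in E. destruct E as [j Ej]. exists j. apply a_eq_iff. exact Ej.
  - intros [j E]. apply a_eq_iff in E. rewrite E.
    rewrite (sin_eq_0_1 (IZR j * PI)); [ring | exists j; reflexivity].
Qed.

Lemma phi2_at_zero (y : R) : phi1 y = 0 -> phi2 y = p -> b <> 3 / 2 -> exists j : Z, th y = IZR j * B.
Proof.
  intros H1 H2 Hne.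
  assert (Hs : sin (a (th y)) = 0).
  { destruct (phi1_formula y) as [w [Hw Ew]]. rewrite Ew in H1.
    apply Rmult_integral in H1. destruct H1; lra. }
  destruct (low_solution p b d C a v Y th phi1 phi2 Hp Eb Hb3 HS Hsol y) as [_ E].
  rewrite H2 in E. unfold low_phi2 in E. rewrite Hs in E.
  replace (3 + 0 ^ 2) with 3 in E by ring.
  assert (S3 : 0 < sqrt 3) by (apply sqrt_lt_R0; lra).
  pose proof (mu2_bounds b (v (th y)) low_b) as Hmu.
  assert (E2 : sqrt (4 - mu2 b (v (th y))) = 2 * p) by (rewrite E; field; lra).
  assert (E3 : 4 - mu2 b (v (th y)) = b).
  { rewrite <- (pow2_sqrt (4 - mu2 b (v (th y)))) by lra. rewrite E2, Eb. ring. }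
  assert (E4 : (2 * b - 3) * sin (v (th y)) ^ 2 = 0).
  { unfold mu2 in E3. replace (cos (v (th y)) ^ 2) with (1 - sin (v (th y)) ^ 2) in E3
      by (pose proof (cos2_plus_sin2 (v (th y))); lra). lra. }
  apply Rmult_integral in E4. destruct E4 as [E4 | E4]; [lra |].
  assert (E5 : sin (v (th y)) = 0) by (apply Rsqr_0_uniq; unfold Rsqr; lra).
  apply sin_eq_0_0 in E5. destruct E5 as [j Ej]. exists j. apply v_eq. exact Ej.
Qed.

Lemma th_lt (y t : R) : y < Y t -> th y < t.
Proof.
  intros H. destruct (Rlt_le_dec (th y) t) as [|Hle]; auto. exfalso.
  rewrite <- (sep_Yth HS y) in H.
  destruct Hle as [Hl | He]; [| rewrite He in H; lra].
  pose proof (sep_Y_increasing HS _ _ Hl). lra.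
Qed.

Lemma lt_th (y t : R) : Y t < y -> t < th y.
Proof.
  intros H. destruct (Rlt_le_dec t (th y)) as [|Hle]; auto. exfalso.
  rewrite <- (sep_Yth HS y) in H.
  destruct Hle as [Hl | He]; [| rewrite He in H; lra].
  pose proof (sep_Y_increasing HS _ _ Hl). lra.
Qed.

(** A number of turns of the first angle after which the second angle has made a
    whole number of half-turns; for [b = 3 / 2] the second angle is invisible
    because [mu2] is constant. *)
Definition admissible (n : nat) : Prop :=
  (1 <= n)%nat /\ (b = 3 / 2 \/ exists m : Z, INR n * (2 * A) = IZR m * B).

Definition T_of (n : nat) : R := Y (INR n * (2 * A)).

Lemma mu2_constant : b = 3 / 2 -> forall x, mu2 b x = 5 / 2.
Proof.
  intros E x. unfold mu2. rewrite E. pose proof (cos2_plus_sin2 x). lra.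
Qed.

Lemma admissible_shift (n : nat) : admissible n -> forall t,
  sin (a (t + INR n * (2 * A))) = sin (a t) /\
  cos2 (a (t + INR n * (2 * A))) = cos2 (a t) /\
  mu2 b (v (t + INR n * (2 * A))) = mu2 b (v t) /\
  Y (t + INR n * (2 * A)) = Y t + T_of n.
Proof.
  intros [_ Hn].
  assert (En : INR n * (2 * A) = IZR (2 * Z.of_nat n) * A)
    by (rewrite mult_IZR, INR_IZR_INZ; ring).
  assert (H1 : forall t, sin (a (t + INR n * (2 * A))) = sin (a t)).
  { intros t. rewrite En, a_shift, mult_IZR, <- INR_IZR_INZ.
    replace (a t + 2 * INR n * PI) with (a t + 2 * INR n * PI) by ring. apply sin_period. }
  assert (H2 : forall t, cos2 (a (t + INR n * (2 * A))) = cos2 (a t)).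
  { intros t. rewrite En, a_shift. apply (shift_IZR_PI cos2 cos2_add_PI). }
  assert (H3 : forall t, mu2 b (v (t + INR n * (2 * A))) = mu2 b (v t)).
  { intros t. destruct Hn as [E | [m E]].
    - rewrite !mu2_constant; auto.
    - rewrite E, v_shift. apply (shift_IZR_PI (mu2 b) (mu2_add_PI b)). }
  intros t. splits; auto.
  apply (sep_Y_shift HS); auto.
Qed.

Lemma T_of_pos (n : nat) : (1 <= n)%nat -> 0 < T_of n.
Proof.
  intros Hn. unfold T_of. rewrite <- (sep_Y0 HS).
  apply (sep_Y_increasing HS).
  apply le_INR in Hn. simpl in Hn. pose proof A_pos. apply Rmult_lt_0_compat; lra.
Qed.

Lemma admissible_period (n : nat) : admissible n -> is_period (pair_fun phi1 phi2) (T_of n).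
Proof.
  intros Hn. split; [apply T_of_pos, Hn |].
  intros y. set (t := th y).
  assert (Ey : y = Y t) by (symmetry; apply (sep_Yth HS)).
  destruct (admissible_shift n Hn t) as [E1 [_ [E2 E3]]].
  assert (Eth : th (y + T_of n) = t + INR n * (2 * A)).
  { rewrite Ey, <- E3. apply (sep_thY HS). }
  unfold pair_fun.
  destruct (low_solution p b d C a v Y th phi1 phi2 Hp Eb Hb3 HS Hsol y) as [-> ->].
  destruct (low_solution p b d C a v Y th phi1 phi2 Hp Eb Hb3 HS Hsol (y + T_of n)) as [-> ->].
  rewrite Eth. fold t. unfold low_phi1, low_phi2. rewrite E1, E2. reflexivity.
Qed.

Lemma sin_half_turns (j : Z) (x : R) : 0 < x < PI ->
  (Z.odd j = true -> sin (x + IZR j * PI) < 0) /\ (Z.odd j = false -> 0 < sin (x + IZR j * PI)).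
Proof.
  intros Hx. assert (Hs : 0 < sin x) by (apply sin_gt_0; lra).
  assert (He : forall i : Z, sin (x + IZR (2 * i) * PI) = sin x).
  { intros i. replace (IZR (2 * i) * PI) with (IZR i * (2 * PI)) by (rewrite mult_IZR; ring).
    pose proof (shift_IZR sin (2 * PI) 0) as E. rewrite E; [ring |].
    intros t. rewrite <- (sin_period t 1). simpl. rewrite Rplus_0_r. f_equal. ring. }
  split; intros Ho.
  - apply Z.odd_spec in Ho. destruct Ho as [i ->]. rewrite plus_IZR.
    replace (x + (IZR (2 * i) + 1) * PI) with (x + IZR (2 * i) * PI + PI) by ring.
    rewrite sin_add_PI, He. lra.
  - rewrite <- Z.negb_even in Ho. apply Bool.negb_false_iff in Ho.
    apply Z.even_spec in Ho. destruct Ho as [i ->]. rewrite He. exact Hs.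
Qed.

(** At a period the first angle is a multiple of [PI]; comparing the signs of
    [phi1] just after 0 and just after the period shows that the multiple is even. *)
Lemma period_admissible (T : R) : is_period (pair_fun phi1 phi2) T ->
  exists n, admissible n /\ T = T_of n.
Proof.
  intros [HT Hper].
  assert (Hper1 : forall y, phi1 (y + T) = phi1 y)
    by (intros y; specialize (Hper y); unfold pair_fun in Hper; congruence).
  assert (Hper2 : forall y, phi2 (y + T) = phi2 y)
    by (intros y; specialize (Hper y); unfold pair_fun in Hper; congruence).
  assert (Z1 : phi1 T = 0).
  { rewrite <- (Rplus_0_l T), Hper1. apply (ivp_phi1_0 _ _ _ Hsol). }
  assert (Z2 : phi2 T = p).
  { rewrite <- (Rplus_0_l T), Hper2. apply (ivp_phi2_0 _ _ _ Hsol). }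
  destruct (proj1 (phi1_zero_iff T) Z1) as [j Ej].
  assert (HA := A_pos).
  assert (HY0 := sep_Y0 HS).
  assert (HYth := sep_Yth HS).
  assert (HYinc := sep_Y_increasing HS).
  assert (Hth : 0 < th T) by (apply lt_th; rewrite HY0; auto).
  assert (Hj : (0 < j)%Z).
  { apply lt_IZR. rewrite Ej in Hth. apply Rmult_lt_reg_r with A; auto. lra. }
  assert (Hodd : Z.odd j = false).
  { destruct (Z.odd j) eqn:Ho; auto. exfalso.
    assert (Y1 : 0 < Y A) by (rewrite <- HY0; apply HYinc; auto).
    assert (Y2 : T < Y (th T + A)) by (rewrite <- (HYth T) at 1; apply HYinc; lra).
    set (y := Rmin (Y A) (Y (th T + A) - T) / 2).
    assert (Hm : 0 < Rmin (Y A) (Y (th T + A) - T)) by (apply Rmin_pos; lra).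
    assert (y1 : 0 < th y) by (apply lt_th; rewrite HY0; unfold y; lra).
    assert (y2 : th y < A).
    { apply th_lt. unfold y. pose proof (Rmin_l (Y A) (Y (th T + A) - T)). lra. }
    assert (y3 : th T < th (y + T)) by (apply lt_th; rewrite HYth; unfold y; lra).
    assert (y4 : th (y + T) < th T + A).
    { apply th_lt. unfold y. pose proof (Rmin_r (Y A) (Y (th T + A) - T)). lra. }
    assert (Hinc := sep_a_increasing HS).
    assert (a1 : 0 < a (th y) < PI).
    { split.
      - rewrite <- (sep_a0 HS). apply Hinc; auto.
      - replace PI with (a A); [apply Hinc; auto |].
        pose proof (a_at 1) as E. rewrite !Rmult_1_l in E. exact E. }
    set (x := a (th (y + T)) - IZR j * PI).
    assert (a2 : 0 < x < PI).
    { pose proof (Hinc _ _ y3) as G1. pose proof (Hinc _ _ y4) as G2.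
      pose proof (a_shift 1 (th T)) as E. rewrite !Rmult_1_l in E. rewrite E in G2.
      rewrite Ej, a_at in G1, G2. unfold x. rewrite Ej in *. lra. }
    destruct (sin_half_turns j x a2) as [Hneg _]. specialize (Hneg Ho).
    replace (x + IZR j * PI) with (a (th (y + T))) in Hneg by (unfold x; ring).
    assert (Hs : 0 < sin (a (th y))) by (apply sin_gt_0; lra).
    destruct (phi1_formula y) as [w [Hw Ew]]. destruct (phi1_formula (y + T)) as [w' [Hw' Ew']].
    specialize (Hper1 y). rewrite Ew, Ew' in Hper1.
    assert (0 < w * sin (a (th y))) by (apply Rmult_lt_0_compat; auto).
    assert (0 < w' * (- sin (a (th (y + T))))) by (apply Rmult_lt_0_compat; lra). lra. }
  rewrite <- Z.negb_even in Hodd. apply Bool.negb_false_iff, Z.even_spec in Hodd.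
  destruct Hodd as [i Ei]. subst j.
  assert (En : INR (Z.to_nat i) * (2 * A) = th T).
  { rewrite Ej, INR_IZR_INZ, Z2Nat.id, mult_IZR by lia. ring. }
  exists (Z.to_nat i). split.
  - split; [lia |].
    destruct (Req_dec b (3 / 2)) as [E | Hne]; [left; auto | right].
    rewrite En. apply (phi2_at_zero T Z1 Z2 Hne).
  - unfold T_of. rewrite En. symmetry. apply HYth.
Qed.

Lemma T_of_le (n m : nat) : (n <= m)%nat -> T_of n <= T_of m.
Proof.
  intros H. apply le_INR in H. pose proof A_pos.
  destruct (Rle_lt_or_eq_dec (INR n) (INR m) H) as [Hl | He].
  - apply Rlt_le. apply (sep_Y_increasing HS). nra.
  - unfold T_of. rewrite He. lra.
Qed.

Lemma least_period_exists : periodic phi1 phi2 ->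
  exists n, admissible n /\ (forall m, admissible m -> (n <= m)%nat) /\
    is_least_period (pair_fun phi1 phi2) (T_of n).
Proof.
  intros [T HT]. destruct (period_admissible T HT) as [n0 [Hn0 _]].
  destruct (exists_least_nat admissible (ex_intro _ n0 Hn0)) as [n [Hn Hmin]].
  exists n. split; [auto | split; [auto |]]. split; [apply admissible_period; auto |].
  intros T' HT'. destruct (period_admissible T' HT') as [m [Hm ->]]. apply T_of_le. auto.
Qed.

(** In the separated time the zeros of [phi1] are the multiples of the half-turn
    time [A], and the period is [2 * n * A]. *)
Lemma zeros_in_period (n : nat) : admissible n ->
  forall y0, exactly_zeros (2 * n) phi1 y0 (T_of n).
Proof.
  intros Hn y0. set (t0 := th y0).
  assert (E0 : Y t0 = y0) by apply (sep_Yth HS).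
  destruct (multiples_in_interval A t0 A_pos) as [j0 Hj0].
  assert (HYinc := sep_Y_increasing HS).
  assert (HthY := sep_thY HS).
  set (zero := fun i : nat => Y (IZR (j0 + Z.of_nat i) * A)).
  exists (map zero (seq 0 (2 * n))). split; [| split].
  - apply FinFun.Injective_map_NoDup; [| apply seq_NoDup].
    intros i i' E. unfold zero in E. apply (f_equal th) in E. rewrite !HthY in E.
    apply Rmult_eq_reg_r in E; [| pose proof A_pos; lra]. apply eq_IZR in E. lia.
  - rewrite length_map, length_seq. reflexivity.
  - assert (Eend : y0 + T_of n = Y (t0 + INR (2 * n) * A)).
    { rewrite <- E0. destruct (admissible_shift n Hn t0) as [_ [_ [_ E]]].
      rewrite <- E, mult_INR. f_equal. simpl. ring. }
    intros y. unfold zero_in_interval. rewrite Eend. split.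
    + intros Hin. apply in_map_iff in Hin. destruct Hin as [i [<- Hi]]. apply in_seq in Hi.
      assert (Hr : t0 <= IZR (j0 + Z.of_nat i) * A < t0 + INR (2 * n) * A) by (apply Hj0; lia).
      split.
      * split; [| apply HYinc; lra].
        rewrite <- E0. destruct (Rle_lt_or_eq_dec _ _ (proj1 Hr)) as [Hl | He].
        -- apply Rlt_le, HYinc; auto.
        -- unfold zero. rewrite <- He. lra.
      * apply phi1_zero_iff. exists (j0 + Z.of_nat i)%Z. apply HthY.
    + intros [[Hy1 Hy2] Hz]. apply phi1_zero_iff in Hz. destruct Hz as [j Ej].
      assert (Hr : t0 <= IZR j * A < t0 + INR (2 * n) * A).
      { rewrite <- Ej. split; [| apply th_lt; auto].
        destruct (Rle_lt_dec t0 (th y)) as [|Hl]; auto. exfalso.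
        apply HYinc in Hl. rewrite (sep_Yth HS), E0 in Hl. lra. }
      apply Hj0 in Hr. apply in_map_iff. exists (Z.to_nat (j - j0)). split.
      * unfold zero. rewrite Z2Nat.id by lia. replace (j0 + (j - j0))%Z with j by lia.
        rewrite <- Ej. apply (sep_Yth HS).
      * apply in_seq. lia.
Qed.

Lemma admissible_iff (n : nat) : (1 <= n)%nat -> b <> 3 / 2 ->
  (admissible n <-> exists m : Z,
     2 * INR n * J (b * (3 - b)) = IZR m * (J (b * (3 - b)) + K (b * (3 - b)))).
Proof.
  intros Hn Hne. pose proof (period_identity b low_b) as E.
  unfold admissible, A, B. rewrite E. split.
  - intros [_ [H | [m H]]]; [contradiction |]. exists m. lra.
  - intros [m H]. split; auto. right. exists m. lra.
Qed.

(** The ratio of the two periods lies strictly between 1 and 3 / 2, hence is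
    neither an integer nor a half-integer. *)
Lemma admissible_ge_3 (n : nat) : b <> 3 / 2 -> admissible n -> (3 <= n)%nat.
Proof.
  intros Hne Hn. assert (H1 : (1 <= n)%nat) by apply Hn.
  apply admissible_iff in Hn; auto. destruct Hn as [m Hm].
  pose proof (J_pos _ (proj1 low_k)) as HJ. pose proof (K_lt_J _ low_k) as HKJ.
  pose proof (J_lt_3K _ low_k) as HJK.
  revert Hm HJ HKJ HJK. generalize (J (b * (3 - b))) (K (b * (3 - b))). intros j k Hm HJ HKJ HJK.
  assert (Hn' : n = 1%nat \/ n = 2%nat \/ (3 <= n)%nat) by lia.
  destruct Hn' as [-> | [-> | H3]]; auto; exfalso; simpl in Hm.
  - assert (0 < IZR m < 2) by (split; nra).
    assert ((0 < m < 2)%Z) by (split; apply lt_IZR; lra).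
    assert (m = 1%Z) by lia. subst m. lra.
  - assert (2 < IZR m < 4) by (split; nra).
    assert ((2 < m < 4)%Z) by (split; apply lt_IZR; lra).
    assert (m = 3%Z) by lia. subst m. lra.
Qed.

End low_periods.

(** * Countability and density of the set of periodic parameters *)

Lemma level_set_distinct (A B k1 k2 k3 : R) :
  0 < A -> 0 < B -> 0 < k1 -> 0 < k2 -> 0 < k3 -> k1 <> k2 -> k2 <> k3 -> k1 <> k3 ->
  A * J k1 = B * K k1 -> A * J k2 = B * K k2 -> A * J k3 = B * K k3 -> False.
Proof.
  intros HA HB P1 P2 P3 N12 N23 N13 E1 E2 E3.
  assert (Hl : forall x y z, 0 < x -> x < y -> y < z ->
    A * J x = B * K x -> A * J y = B * K y -> A * J z = B * K z -> False)
    by (intros x y z; intros; apply (level_set_at_most_two A B x y z); auto).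
  destruct (Rtotal_order k1 k2) as [H | [H | H]]; [| auto |];
  destruct (Rtotal_order k2 k3) as [H' | [H' | H']]; auto;
  destruct (Rtotal_order k1 k3) as [H'' | [H'' | H'']]; auto; try lra; eauto.
Qed.

Lemma at_most_two_elements (Z : R -> Prop) :
  (forall x y z, Z x -> Z y -> Z z -> x <> y -> y <> z -> x <> z -> False) ->
  exists r : bool -> R, forall x, Z x -> exists i, r i = x.
Proof.
  intros H. destruct (classic (exists x, Z x)) as [[x Hx] | Hn].
  - destruct (classic (exists y, Z y /\ y <> x)) as [[y [Hy Hyx]] | Hn].
    + exists (fun i : bool => if i then x else y). intros z Hz.
      destruct (Req_dec x z) as [E | E]; [exists true; auto |].
      destruct (Req_dec y z) as [E' | E']; [exists false; auto |].
      exfalso. apply (H x y z); auto.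
    + exists (fun _ => x). intros z Hz. exists true.
      destruct (Req_dec x z); auto. exfalso. apply Hn. exists z. auto.
  - exists (fun _ => 0). intros x Hx. exfalso. eauto.
Qed.

Lemma sqrt3_half_sq : (sqrt 3 / 2) ^ 2 = 3 / 4.
Proof.
  replace ((sqrt 3 / 2) ^ 2) with (sqrt 3 ^ 2 / 4) by field. rewrite pow2_sqrt; lra.
Qed.

Lemma low_range (p : R) : 0 < p < sqrt 3 / 2 -> 0 < p <= 1 /\ 4 * p ^ 2 < 3.
Proof.
  intros Hp. pose proof sqrt3_half_sq. assert (p ^ 2 < 3 / 4) by nra.
  split; [| lra]. split; [lra |]. nra.
Qed.

Definition k_of (p : R) : R := 4 * p ^ 2 * (3 - 4 * p ^ 2).

Lemma k_of_pos (p : R) : 0 < p < sqrt 3 / 2 -> 0 < k_of p.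
Proof.
  intros Hp. destruct (low_range p Hp). unfold k_of. apply Rmult_lt_0_compat; nra.
Qed.

Lemma special_sq : sqrt (3 / 8) ^ 2 = 3 / 8.
Proof. apply pow2_sqrt. lra. Qed.

Lemma special_pos : 0 < sqrt (3 / 8).
Proof. apply sqrt_lt_R0. lra. Qed.

Lemma special_iff (p : R) : 0 < p -> (4 * p ^ 2 = 3 / 2 <-> p = sqrt (3 / 8)).
Proof.
  intros Hp. pose proof special_sq. pose proof special_pos. split; intros E.
  - apply Rsqr_inj; unfold Rsqr; lra.
  - rewrite E. lra.
Qed.

Lemma below_special (p : R) : 0 < p -> p < sqrt (3 / 8) -> p ^ 2 < 3 / 8.
Proof.
  intros Hp H. rewrite <- special_sq.
  assert (0 < (sqrt (3 / 8) - p) * (sqrt (3 / 8) + p)) by (apply Rmult_lt_0_compat; lra). lra.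
Qed.

Lemma above_special (p : R) : sqrt (3 / 8) < p -> 3 / 8 < p ^ 2.
Proof.
  intros H. pose proof special_pos. rewrite <- special_sq.
  assert (0 < (p - sqrt (3 / 8)) * (sqrt (3 / 8) + p)) by (apply Rmult_lt_0_compat; lra). lra.
Qed.

(** Summary of the motion for parameters below [sqrt 3 / 2] in which the angles,
    and the times [A] and [B], no longer appear: by [period_identity] the condition
    [n * (2 * A) = m * B] is one on [J] and [K] alone. *)
Lemma low_case (p : R) (phi1 phi2 : R -> R) :
  0 < p < sqrt 3 / 2 -> ivp_solution p phi1 phi2 ->
  quasi_periodic phi1 phi2 /\ (forall y, 0 < phi2 y) /\
  (p = sqrt (3 / 8) -> periodic phi1 phi2 /\ condition_Z phi1 phi2) /\
  (p <> sqrt (3 / 8) ->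
    (periodic phi1 phi2 <-> exists (n : nat) (m : Z), (1 <= n)%nat /\
      2 * INR n * J (k_of p) = IZR m * (J (k_of p) + K (k_of p))) /\
    (periodic phi1 phi2 -> exists T, is_least_period (pair_fun phi1 phi2) T /\
       forall y0, at_least_zeros 6 phi1 y0 T)).
Proof.
  intros Hp Hsol. destruct (low_range p Hp) as [Hp1 Hb3].
  set (b := 4 * p ^ 2) in *.
  assert (Hb : 0 < b < 3) by (split; [unfold b; nra | auto]).
  destruct (low_separated b Hb) as [a [v [Y [th HS]]]].
  assert (Hform := low_solution p b _ _ a v Y th phi1 phi2 (proj1 Hp) eq_refl Hb3 HS Hsol).
  assert (Hmu := fun t => mu2_bounds b t Hb).
  split; [| split; [| split]].
  - assert (Hq := separated_quasi_periodic HS (low_phi1 b) (low_phi2 b) (2 * PI)).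
    assert (HPI := PI_RGT_0).
    assert (Hs : forall x, sin (x + 2 * PI) = sin x)
      by (intros x; rewrite <- (sin_period x 1); f_equal; simpl; ring).
    assert (Hc : forall x, cos (x + 2 * PI) = cos x)
      by (intros x; rewrite <- (cos_period x 1); f_equal; simpl; ring).
    assert (S3 : sqrt 3 <> 0) by (apply sqrt_neq_0; lra).
    destruct Hq as [F [w1 [w2 [F1 [F2 [F3 F4]]]]]].
    + lra.
    + intros x. unfold low_f1. rewrite Hs. reflexivity.
    + intros x. unfold low_f2, mu2. rewrite Hs, Hc. reflexivity.
    + intros x. unfold cos2. rewrite Hc. reflexivity.
    + intros x. unfold mu2. rewrite Hs, Hc. reflexivity.
    + intros x y. specialize (Hmu y). unfold low_phi1, mu2 in *. cont2; lra.
    + intros x y. specialize (Hmu y). pose proof (sin2_bounds x).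
      unfold low_phi2, mu2 in *. cont2; lra.
    + intros x y. unfold low_phi1. rewrite Hs. reflexivity.
    + intros x y. unfold low_phi1, mu2. rewrite Hs, Hc. reflexivity.
    + intros x y. unfold low_phi2. rewrite Hs. reflexivity.
    + intros x y. unfold low_phi2, mu2. rewrite Hs, Hc. reflexivity.
    + exists F, w1, w2. split; [| split; [| split]]; auto. intros y. rewrite <- F4.
      unfold pair_fun. destruct (Hform y) as [-> ->]. reflexivity.
  - exact (phi2_pos p b phi1 phi2 a v Y th _ _ (proj1 Hp) eq_refl Hb3 HS Hsol).
  - intros E. apply special_iff in E; [| apply Hp].
    assert (Hadm : admissible b 1) by (split; [lia | left; exact E]).
    assert (Hper := admissible_period p b phi1 phi2 a v Y th _ _ (proj1 Hp) eq_refl Hb3 HS Hsol 1 Hadm).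
    split; [eexists; exact Hper |]. split.
    + exists (T_of b Y 1). split.
      * split; [exact Hper |]. intros T' HT'.
        destruct (period_admissible p b phi1 phi2 a v Y th _ _ (proj1 Hp) eq_refl Hb3 HS Hsol T' HT')
          as [m [Hm ->]].
        apply (T_of_le p b a v Y th _ _ (proj1 Hp) eq_refl Hb3 HS). apply Hm.
      * exact (zeros_in_period p b phi1 phi2 a v Y th _ _ (proj1 Hp) eq_refl Hb3 HS Hsol 1 Hadm).
    + exact (phi2_pos p b phi1 phi2 a v Y th _ _ (proj1 Hp) eq_refl Hb3 HS Hsol).
  - intros Hne.
    assert (Hbne : b <> 3 / 2) by (intros E; apply Hne, special_iff; auto; apply Hp).
    split; [split |].
    + intros [T HT].
      destruct (period_admissible p b phi1 phi2 a v Y th _ _ (proj1 Hp) eq_refl Hb3 HS Hsol T HT)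
        as [n [Hn _]].
      assert (H1 : (1 <= n)%nat) by apply Hn.
      apply (admissible_iff p b (proj1 Hp) eq_refl Hb3 n H1 Hbne) in Hn.
      destruct Hn as [m Hm]. exists n, m. auto.
    + intros [n [m [H1 Hm]]]. exists (T_of b Y n).
      apply (admissible_period p b phi1 phi2 a v Y th _ _ (proj1 Hp) eq_refl Hb3 HS Hsol).
      apply (admissible_iff p b (proj1 Hp) eq_refl Hb3 n H1 Hbne). exists m. exact Hm.
    + intros Hper.
      destruct (least_period_exists p b phi1 phi2 a v Y th _ _ (proj1 Hp) eq_refl Hb3 HS Hsol Hper)
        as [n [Hn [_ Hleast]]].
      exists (T_of b Y n). split; [exact Hleast |]. intros y0.
      pose proof (admissible_ge_3 p b (proj1 Hp) eq_refl Hb3 n Hbne Hn).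
      apply at_least_of_exactly with (2 * n)%nat; [lia |].
      apply (zeros_in_period p b phi1 phi2 a v Y th _ _ (proj1 Hp) eq_refl Hb3 HS Hsol n Hn).
Qed.

Lemma high_range (p : R) : sqrt 3 / 2 < p <= 1 -> 0 < p /\ 3 < 4 * p ^ 2 <= 4.
Proof.
  intros Hp. pose proof sqrt3_half_sq. assert (0 < sqrt 3) by (apply sqrt_lt_R0; lra).
  split; [lra |]. split; nra.
Qed.

Lemma high_case (p : R) (phi1 phi2 : R -> R) :
  sqrt 3 / 2 < p <= 1 -> ivp_solution p phi1 phi2 ->
  quasi_periodic phi1 phi2 /\ exists y, phi2 y = 0.
Proof.
  intros Hp Hsol. destruct (high_range p Hp) as [Hp0 Hb].
  set (b := 4 * p ^ 2) in *.
  destruct (high_separated b Hb) as [a [v [Y [th HS]]]].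
  assert (Hform := high_solution p b _ _ a v Y th phi1 phi2 Hp0 eq_refl Hb HS Hsol).
  assert (Hmu := fun t => high_mu1_bounds b t Hb).
  split.
  - assert (Hq := separated_quasi_periodic HS (high_phi1 b) (high_phi2 b) (2 * PI)).
    assert (HPI := PI_RGT_0).
    assert (Hs : forall x, sin (x + 2 * PI) = sin x)
      by (intros x; rewrite <- (sin_period x 1); f_equal; simpl; ring).
    assert (Hc : forall x, cos (x + 2 * PI) = cos x)
      by (intros x; rewrite <- (cos_period x 1); f_equal; simpl; ring).
    destruct Hq as [F [w1 [w2 [F1 [F2 [F3 F4]]]]]].
    + lra.
    + intros x. unfold high_f1, high_mu1. rewrite Hc. reflexivity.
    + intros x. unfold high_f2, high_mu2. rewrite Hs. reflexivity.
    + intros x. unfold high_mu1. rewrite Hc. reflexivity.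
    + intros x. unfold high_mu2. rewrite Hs. reflexivity.
    + intros x y. specialize (Hmu x). unfold high_phi1, high_mu1 in *. cont2; lra.
    + intros x y. specialize (Hmu x). unfold high_phi2, high_mu1 in *. cont2; lra.
    + intros x y. unfold high_phi1, high_mu1. rewrite Hc. reflexivity.
    + intros x y. unfold high_phi1. rewrite Hs. reflexivity.
    + intros x y. unfold high_phi2, high_mu1. rewrite Hc. reflexivity.
    + intros x y. unfold high_phi2. rewrite Hc. reflexivity.
    + exists F, w1, w2. split; [| split; [| split]]; auto. intros y. rewrite <- F4.
      unfold pair_fun. destruct (Hform y) as [-> ->]. reflexivity.
  - exists (Y (RInt (fun x => / high_f2 b x) 0 (PI / 2))).
    destruct (Hform (Y (RInt (fun x => / high_f2 b x) 0 (PI / 2)))) as [_ ->].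
    rewrite (sep_thY HS), (sep_bB HS).
    unfold high_phi2. rewrite cos_PI2. ring.
Qed.

Lemma zero_in_each_period (f : R -> R) (T y : R) :
  is_period f T -> f y = 0 -> forall y0, exists y', zero_in_interval f y0 T y'.
Proof.
  intros [HT Hper] Hy y0.
  destruct (multiples_in_interval T (y0 - y) HT) as [j0 Hj].
  specialize (Hj 1%nat j0). destruct Hj as [_ Hj]. specialize (Hj ltac:(lia)). simpl in Hj.
  exists (y + IZR j0 * T). split; [lra |].
  pose proof (shift_IZR f T 0) as E. rewrite E; [lra |].
  intros t. rewrite Hper. ring.
Qed.

Lemma rational_between (x y : R) : x < y ->
  exists (n : nat) (m : Z), (1 <= n)%nat /\ x * INR n < IZR m < y * INR n.
Proof.
  intros Hxy.
  destruct (archimed (/ (y - x))) as [H1 _].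
  assert (Hinv : 0 < / (y - x)) by (apply Rinv_0_lt_compat; lra).
  set (N := up (/ (y - x))) in *.
  assert (HN : (0 < N)%Z) by (apply lt_IZR; lra).
  exists (Z.to_nat N), (up (x * IZR N)). split; [lia |].
  rewrite INR_IZR_INZ, Z2Nat.id by lia.
  destruct (archimed (x * IZR N)) as [H2 H3]. split; [lra |].
  assert (1 < (y - x) * IZR N).
  { replace 1 with ((y - x) * / (y - x)) by (field; lra). apply Rmult_lt_compat_l; lra. }
  lra.
Qed.

Definition ratio (p : R) : R := 2 * J (k_of p) / (J (k_of p) + K (k_of p)).

Lemma K_pos (k : R) : 0 < k <= 9 / 4 -> 0 < K k.
Proof. intros Hk. pose proof (J_pos k (proj1 Hk)). pose proof (J_lt_3K k Hk). lra. Qed.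

Lemma k_of_range (p : R) : 0 < p < sqrt 3 / 2 -> 0 < k_of p <= 9 / 4.
Proof.
  intros Hp. split; [apply k_of_pos; auto |]. unfold k_of. pose proof (pow2_ge_0 (4 * p ^ 2 - 3 / 2)). lra.
Qed.

Lemma continuity_ratio (p : R) : 0 < p < sqrt 3 / 2 -> continuity_pt ratio p.
Proof.
  intros Hp. assert (Hk := k_of_range p Hp).
  assert (HJ := J_pos _ (proj1 Hk)). assert (HK := K_pos _ Hk).
  assert (ck : continuous k_of p) by (unfold k_of; cont1; auto).
  assert (cJ : continuous (fun p => J (k_of p)) p)
    by (apply (continuous_comp k_of J); auto; apply continuous_J, Hk).
  assert (cK : continuous (fun p => K (k_of p)) p)
    by (apply (continuous_comp k_of K); auto; apply continuous_K, Hk).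
  apply continuity_pt_filterlim.
  apply (continuous_mult (fun p => 2 * J (k_of p)) (fun p => / (J (k_of p) + K (k_of p)))).
  - apply (continuous_scal_r (V := R_NormedModule)). auto.
  - apply (continuous_comp (fun p => J (k_of p) + K (k_of p)) Rinv).
    + apply (continuous_plus (V := R_NormedModule)); auto.
    + apply continuous_Rinv. lra.
Qed.

Lemma ratio_level (p c : R) : 0 < p < sqrt 3 / 2 -> ratio p = c ->
  0 < c < 2 /\ (2 - c) * J (k_of p) = c * K (k_of p).
Proof.
  intros Hp <-. assert (Hk := k_of_range p Hp).
  assert (HJ := J_pos _ (proj1 Hk)). assert (HK := K_pos _ Hk). unfold ratio.
  split; [split |].
  - apply Rdiv_lt_0_compat; lra.
  - apply Rmult_lt_reg_r with (J (k_of p) + K (k_of p)); [lra |]. field_simplify; lra.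
  - field. lra.
Qed.

Lemma ivt (f : R -> R) (x y c : R) : x < y ->
  (forall t, x <= t <= y -> continuity_pt f t) ->
  Rmin (f x) (f y) < c < Rmax (f x) (f y) -> exists t, x <= t <= y /\ f t = c.
Proof.
  intros Hxy Hf Hc. destruct (Rle_dec (f x) (f y)) as [H | H].
  - rewrite Rmin_left, Rmax_right in Hc by lra.
    destruct (Ranalysis5.f_interv_is_interv f x y c Hxy) as [t [Ht1 Ht2]]; [lra | auto |].
    exists t. auto.
  - rewrite Rmin_right, Rmax_left in Hc by lra.
    destruct (Ranalysis5.f_interv_is_interv (fun t => - f t) x y (- c) Hxy) as [t [Ht1 Ht2]].
    + lra.
    + intros t Ht. apply (continuity_pt_opp f t). auto.
    + exists t. split; [auto | lra].
Qed.

(** On an interval where [k_of] is injective the ratio of periods takes no value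
    three times, so it is not constant and takes a rational value. *)
Lemma rational_ratio_in_interval (l u : R) :
  0 <= l < u -> u <= sqrt 3 / 2 ->
  (forall p q, l < p < u -> l < q < u -> k_of p = k_of q -> p = q) ->
  exists p, l < p < u /\ exists (n : nat) (m : Z), (1 <= n)%nat /\
    2 * INR n * J (k_of p) = IZR m * (J (k_of p) + K (k_of p)).
Proof.
  intros Hlu Hu Hinj.
  assert (Hr : exists p q, l < p < u /\ l < q < u /\ p < q /\ ratio p <> ratio q).
  { set (p1 := l + (u - l) / 4). set (p2 := l + (u - l) / 2). set (p3 := l + 3 * (u - l) / 4).
    assert (H123 : l < p1 /\ p1 < p2 /\ p2 < p3 /\ p3 < u) by (unfold p1, p2, p3; lra).
    destruct (Req_dec (ratio p1) (ratio p2)) as [E12 | N12].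
    - destruct (Req_dec (ratio p2) (ratio p3)) as [E23 | N23].
      + exfalso.
        destruct (ratio_level p1 (ratio p1) ltac:(lra) eq_refl) as [Hc L1].
        destruct (ratio_level p2 (ratio p1) ltac:(lra) (eq_sym E12)) as [_ L2].
        destruct (ratio_level p3 (ratio p1) ltac:(lra) ltac:(lra)) as [_ L3].
        apply (level_set_distinct (2 - ratio p1) (ratio p1) (k_of p1) (k_of p2) (k_of p3));
          auto; try lra; try (apply k_of_pos; lra);
          intros E; apply Hinj in E; lra.
      + exists p2, p3. repeat split; auto; lra.
    - exists p1, p2. repeat split; auto; lra. }
  destruct Hr as [p [q [Hp [Hq [Hpq Hne]]]]].
  assert (Hmm : Rmin (ratio p) (ratio q) < Rmax (ratio p) (ratio q))
    by (unfold Rmin, Rmax; destruct Rle_dec; lra).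
  destruct (rational_between _ _ Hmm) as [n [m [Hn Hm]]].
  assert (HnR : 0 < INR n) by (apply lt_0_INR; lia).
  destruct (ivt ratio p q (IZR m / INR n) Hpq) as [t [Ht Et]].
  - intros t Ht. apply continuity_ratio. lra.
  - split; apply Rmult_lt_reg_r with (INR n); auto; unfold Rdiv; rewrite Rmult_assoc, Rinv_l; lra.
  - exists t. split; [lra |]. exists n, m. split; auto.
    assert (Hk := k_of_range t ltac:(lra)).
    assert (HJ := J_pos _ (proj1 Hk)). assert (HK := K_pos _ Hk).
    unfold ratio in Et.
    assert (E : 2 * J (k_of t) = IZR m / INR n * (J (k_of t) + K (k_of t)))
      by (rewrite <- Et; field; lra).
    replace (2 * INR n * J (k_of t)) with (INR n * (2 * J (k_of t))) by ring.
    rewrite E. field. lra.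
Qed.

Lemma k_of_injective_side (p q : R) :
  0 < p -> 0 < q -> 0 < (p ^ 2 - 3 / 8) * (q ^ 2 - 3 / 8) -> k_of p = k_of q -> p = q.
Proof.
  intros Hp Hq Hs E. unfold k_of in E.
  assert (E2 : (p ^ 2 - q ^ 2) * (p ^ 2 - 3 / 8 + (q ^ 2 - 3 / 8)) = 0) by lra.
  apply Rmult_integral in E2. destruct E2 as [E2 | E2].
  - apply Rsqr_inj; unfold Rsqr; lra.
  - exfalso. replace (q ^ 2 - 3 / 8) with (- (p ^ 2 - 3 / 8)) in Hs by lra.
    pose proof (pow2_ge_0 (p ^ 2 - 3 / 8)). lra.
Qed.

Lemma k_of_injective_below (p q : R) :
  0 < p < sqrt (3 / 8) -> 0 < q < sqrt (3 / 8) -> k_of p = k_of q -> p = q.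
Proof.
  intros Hp Hq. pose proof (below_special p ltac:(lra) ltac:(lra)).
  pose proof (below_special q ltac:(lra) ltac:(lra)).
  apply k_of_injective_side; try lra. nra.
Qed.

Lemma k_of_injective_above (p q : R) :
  sqrt (3 / 8) < p -> sqrt (3 / 8) < q -> k_of p = k_of q -> p = q.
Proof.
  intros Hp Hq. pose proof (above_special p Hp). pose proof (above_special q Hq).
  pose proof special_pos. apply k_of_injective_side; try lra. nra.
Qed.

Lemma periodic_parameters_dense :
  forall x, 0 < x < sqrt 3 / 2 -> forall eps, 0 < eps ->
  exists p, 0 < p < sqrt 3 / 2 /\ Rabs (p - x) < eps /\ p <> sqrt (3 / 8) /\
  exists (n : nat) (m : Z), (1 <= n)%nat /\
    2 * INR n * J (k_of p) = IZR m * (J (k_of p) + K (k_of p)).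
Proof.
  intros x Hx eps Heps.
  assert (Hs := special_sq). assert (Hs0 := special_pos).
  assert (Hlu : exists l u, 0 <= l < u /\ u <= sqrt 3 / 2 /\ x - eps <= l /\ u <= x + eps /\
    (u <= sqrt (3 / 8) \/ sqrt (3 / 8) <= l)).
  { destruct (Rle_dec (sqrt (3 / 8)) x) as [H | H].
    - exists x, (Rmin (x + eps) (sqrt 3 / 2)).
      pose proof (Rmin_l (x + eps) (sqrt 3 / 2)). pose proof (Rmin_r (x + eps) (sqrt 3 / 2)).
      assert (x < Rmin (x + eps) (sqrt 3 / 2)) by (apply Rmin_glb_lt; lra).
      repeat split; lra.
    - exists (Rmax 0 (x - eps)), x.
      pose proof (Rmax_l 0 (x - eps)). pose proof (Rmax_r 0 (x - eps)).
      assert (Rmax 0 (x - eps) < x) by (apply Rmax_lub_lt; lra).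
      repeat split; lra. }
  destruct Hlu as [l [u [H1 [H2 [H3 [H4 H5]]]]]].
  destruct (rational_ratio_in_interval l u H1 H2) as [p [Hp Hnm]].
  - intros p q Hp Hq. destruct H5 as [H5 | H5].
    + apply k_of_injective_below; lra.
    + apply k_of_injective_above; lra.
  - exists p. split; [lra |]. split; [apply Rabs_lt_between'; lra |]. split; auto.
    intros E. lra.
Qed.

Lemma countable_union (S : nat -> R -> Prop) :
  (forall i, exists r : bool -> R, forall x, S i x -> exists c, r c = x) ->
  countable (fun x => exists i, S i x).
Proof.
  intros H. apply choice in H. destruct H as [r Hr].
  exists (fun N => let (i, c) := Cantor.of_nat N in r i (Nat.eqb c 0)).
  intros x [i Hx]. destruct (Hr i x Hx) as [c Hc].
  exists (Cantor.to_nat (i, if c then 0%nat else 1%nat)).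
  rewrite Cantor.cancel_of_to. destruct c; exact Hc.
Qed.

(** A rational value of the ratio is taken for at most two values of [k], hence
    at most twice on each side of [sqrt (3 / 8)]. *)
Lemma periodic_parameters_countable :
  countable (fun p => 0 < p < sqrt 3 / 2 /\ (p = sqrt (3 / 8) \/
    exists (n : nat) (m : Z), (1 <= n)%nat /\
    2 * INR n * J (k_of p) = IZR m * (J (k_of p) + K (k_of p)))).
Proof.
  set (E := fun (n m : nat) (p : R) => 0 < p < sqrt 3 / 2 /\ (1 <= n)%nat /\
    2 * INR n * J (k_of p) = INR m * (J (k_of p) + K (k_of p))).
  set (S := fun (i : nat) (p : R) =>
    let (n, r) := Cantor.of_nat i in let (m, side) := Cantor.of_nat r in
    match side with
    | 0%nat => p = sqrt (3 / 8)
    | 1%nat => E n m p /\ p < sqrt (3 / 8)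
    | _ => E n m p /\ sqrt (3 / 8) < p
    end).
  assert (Hs := special_sq). assert (Hs0 := special_pos).
  assert (HE : forall n m x y z, E n m x -> E n m y -> E n m z ->
    k_of x <> k_of y -> k_of y <> k_of z -> k_of x <> k_of z -> False).
  { intros n m x y z [Hx [Hn Ex]] [Hy [_ Ey]] [Hz [_ Ez]] Nxy Nyz Nxz.
    assert (Hkx := k_of_range x Hx).
    assert (HJ := J_pos _ (proj1 Hkx)). assert (HK := K_pos _ Hkx).
    assert (HnR : 0 < INR n) by (apply lt_0_INR; lia).
    assert (HmR : 0 < INR m).
    { destruct (Nat.eq_dec m 0) as [-> | H]; [| apply lt_0_INR; lia]. simpl in Ex.
      assert (0 < 2 * INR n * J (k_of x)) by (repeat apply Rmult_lt_0_compat; auto; lra). lra. }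
    assert (HmK : 0 < (2 * INR n - INR m) * J (k_of x)).
    { replace ((2 * INR n - INR m) * J (k_of x)) with (INR m * K (k_of x)) by lra.
      apply Rmult_lt_0_compat; auto. }
    assert (0 < 2 * INR n - INR m).
    { apply Rmult_lt_reg_r with (J (k_of x)); [exact HJ | lra]. }
    apply (level_set_distinct (2 * INR n - INR m) (INR m) (k_of x) (k_of y) (k_of z)); auto; try lra;
      apply k_of_pos; auto. }
  destruct (countable_union S) as [e He].
  - intros i. unfold S. destruct (Cantor.of_nat i) as [n r]. destruct (Cantor.of_nat r) as [m side].
    apply at_most_two_elements. intros x y z.
    destruct side as [| [| side]]; [congruence | |];
    intros [Hx Sx] [Hy Sy] [Hz Sz] Nxy Nyz Nxz; apply (HE n m x y z); auto;
    destruct Hx as [Hx _], Hy as [Hy _], Hz as [Hz _]; intros Ek;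
    first [ apply k_of_injective_below in Ek; [contradiction | lra | lra]
          | apply k_of_injective_above in Ek; [contradiction | lra | lra] ].
  - exists e. intros p [Hp Hor]. apply He.
    destruct Hor as [Hsp | [n [m [Hn Hm]]]].
    + exists (Cantor.to_nat (0%nat, Cantor.to_nat (0%nat, 0%nat))).
      unfold S. rewrite !Cantor.cancel_of_to. exact Hsp.
    + assert (Hk := k_of_range p Hp).
      assert (HJ := J_pos _ (proj1 Hk)). assert (HK := K_pos _ Hk).
      assert (HnR : 0 < INR n) by (apply lt_0_INR; lia).
      assert (Hm0 : (0 <= m)%Z).
      { apply le_IZR. destruct (Rle_dec 0 (IZR m)); auto. exfalso. nra. }
      assert (HEp : E n (Z.to_nat m) p).
      { split; [auto | split; [auto |]]. rewrite (INR_IZR_INZ (Z.to_nat m)), Z2Nat.id; auto. }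
      destruct (Rtotal_order p (sqrt (3 / 8))) as [Hl | [He' | Hg]].
      * exists (Cantor.to_nat (n, Cantor.to_nat (Z.to_nat m, 1%nat))).
        unfold S. rewrite !Cantor.cancel_of_to. auto.
      * exists (Cantor.to_nat (0%nat, Cantor.to_nat (0%nat, 0%nat))).
        unfold S. rewrite !Cantor.cancel_of_to. exact He'.
      * exists (Cantor.to_nat (n, Cantor.to_nat (Z.to_nat m, 2%nat))).
        unfold S. rewrite !Cantor.cancel_of_to. auto.
Qed.

Theorem proposition3p1
  (phi1 phi2 : R -> R -> R)
  (Hsol : forall p, 0 < p <= 1 -> ivp_solution p (phi1 p) (phi2 p)) :
  (forall p, 0 < p <= 1 -> p <> sqrt 3 / 2 ->
     periodic (phi1 p) (phi2 p) \/ quasi_periodic (phi1 p) (phi2 p)) /\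
  (is_lim (phi1 (sqrt 3 / 2)) p_infty 0 /\
   is_lim (phi2 (sqrt 3 / 2)) p_infty 0 /\
   ~ periodic (phi1 (sqrt 3 / 2)) (phi2 (sqrt 3 / 2))) /\
  (forall p, sqrt 3 / 2 < p <= 1 ->
     (exists y, phi2 p y = 0) /\
     (forall T, is_period (phi2 p) T ->
        forall y0, exists y, zero_in_interval (phi2 p) y0 T y) /\
     ~ condition_Z (phi1 p) (phi2 p)) /\
  (exists P : R -> Prop,
     (countable P /\
      dense_subset 0 (sqrt 3 / 2) P /\
      P (sqrt (3 / 8)) /\
      (forall p, 0 < p < sqrt 3 / 2 ->
         (periodic (phi1 p) (phi2 p) <-> P p))) /\
     (condition_Z (phi1 (sqrt (3 / 8))) (phi2 (sqrt (3 / 8))) /\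
      (forall p, P p -> p <> sqrt (3 / 8) ->
         exists T, is_least_period (pair_fun (phi1 p) (phi2 p)) T /\
           forall y0, at_least_zeros 6 (phi1 p) y0 T))).
Proof.
  assert (S3 : 0 < sqrt 3 / 2) by (assert (0 < sqrt 3) by (apply sqrt_lt_R0; lra); lra).
  assert (S31 : sqrt 3 / 2 <= 1) by (pose proof sqrt3_half_sq; nra).
  assert (Hlow : forall p, 0 < p < sqrt 3 / 2 -> ivp_solution p (phi1 p) (phi2 p))
    by (intros p Hp; apply Hsol; lra).
  assert (Hhigh : forall p, sqrt 3 / 2 < p <= 1 -> ivp_solution p (phi1 p) (phi2 p))
    by (intros p Hp; apply Hsol; lra).
  assert (Hspecial : 0 < sqrt (3 / 8) < sqrt 3 / 2).
  { pose proof special_sq. pose proof special_pos. pose proof sqrt3_half_sq. split; auto. nra. }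
  split; [| split; [| split]].
  - intros p Hp Hne. right. destruct (Rtotal_order p (sqrt 3 / 2)) as [H | [H | H]].
    + apply (low_case p); [lra | apply Hlow; lra].
    + contradiction.
    + apply (high_case p); [lra | apply Hhigh; lra].
  - apply homoclinic_case. apply Hsol. lra.
  - intros p Hp. destruct (high_case p _ _ Hp (Hhigh p Hp)) as [_ [y Hy]].
    split; [exists y; exact Hy |]. split.
    + intros T HT. exact (zero_in_each_period _ T y HT Hy).
    + intros [_ Hpos]. specialize (Hpos y). lra.
  - destruct (low_case _ _ _ Hspecial (Hlow _ Hspecial)) as [_ [_ [Hsp _]]].
    destruct (Hsp eq_refl) as [Hper HZ].
    exists (fun p => 0 < p < sqrt 3 / 2 /\ periodic (phi1 p) (phi2 p)).
    split; [split; [| split; [| split]] | split].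
    + destruct periodic_parameters_countable as [e He]. exists e. intros p [Hp Hpp]. apply He.
      split; auto. destruct (Req_dec p (sqrt (3 / 8))) as [E | N]; [left; auto | right].
      destruct (low_case p _ _ Hp (Hlow p Hp)) as [_ [_ [_ H]]].
      destruct (H N) as [Hiff _]. apply Hiff. exact Hpp.
    + split; [intros x [Hx _]; exact Hx |].
      intros x Hx eps Heps. destruct (periodic_parameters_dense x Hx eps Heps) as [p [Hp [Hd [N Hnm]]]].
      exists p. split; [| exact Hd]. split; auto.
      destruct (low_case p _ _ Hp (Hlow p Hp)) as [_ [_ [_ H]]].
      destruct (H N) as [Hiff _]. apply Hiff. exact Hnm.
    + auto.
    + intros p Hp. split; [auto | intros [_ H]; exact H].
    + exact HZ.
    + intros p [Hp Hpp] N.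
      destruct (low_case p _ _ Hp (Hlow p Hp)) as [_ [_ [_ H]]].
      destruct (H N) as [_ Hz]. exact (Hz Hpp).
Qed.
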